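(* Let $G$ be a matchable bipartite graph. Then the following three statements are equivalent: (i) $G$ is strongly uniform; (ii) $G$ has no conformal minor in $\mathcal{A}=\{A_1,A_2,A_3,A_4\}$; (iii) each elementary component of $G$ either is $K_2$ or belongs to $\mathcal{B}_0\cup\mathcal{B}_1\cup\mathcal{B}_2\cup\mathcal{B}_3$.
   Context: All graphs are finite, simple and undirected. A graph is matchable if it has a perfect matching (the graph with no vertices counts as matchable). An edge of a matchable graph $G$ is allowed if it belongs to at least one perfect matching of $G$. The elementary components of a matchable graph $G$ are the connected components of the subgraph of $G$ formed by all allowed edges. Forcing numbers. For a perfect matching $M$ of a graph $G$, an anti-forcing set of $M$ is a set $S\subseteq E(G)\setminus M$ such that $M$ is the only perfect matching of $G-S$; $af(G,M)$ is the smallest size of such a set, and $Af(G)$ is the maximum of $af(G,M)$ over all perfect matchings $M$ of $G$. A global forcing set of a matchable graph $G$ is a set $S\subseteq E(G)$ such that $S\cap M_1\neq S\cap M_2$ for any two distinct perfect matchings $M_1,M_2$ of $G$; $gf(G)$ is the smallest size of such a set. Conformality. A subgraph $H$ of a matchable graph $G$ is conformal if $G-V(H)$ is matchable. A matchable graph $G$ is strongly uniform if $gf(H)=Af(H)$ for every conformal matchable subgraph $H$ of $G$. A bisubdivision of a graph $J$ is a graph obtained from $J$ by replacing each edge in some edge subset by a path of odd length (length 1 allowed), these paths being internally disjoint. $J$ is a conformal minor of a matchable graph $G$ if some bisubdivision of $J$ is a conformal subgraph of $G$. The graphs $A_i$. $A_1$ consists of two vertices joined by three internally disjoint paths of length 3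 (8 vertices, 9 edges). $A_2$ is the cycle $v_1v_2\cdots v_8v_1$ plus the chords $v_1v_4$ and $v_1v_6$. $A_3$ is the cycle $v_1v_2\cdots v_{10}v_1$ plus the chords $v_1v_4$ and $v_6v_9$. $A_4=K_{3,3}$. Chords. Let $C$ be an even cycle with a proper black-white coloring of its vertices. A chord of $C$ is an edge not in $C$ with both end vertices on $C$. Let $x_1x_2$ and $y_1y_2$ be two disjoint chords (each joining vertices of different colors), labelled so that $x_1$ and $y_1$ have the same color. They are parallel if their end vertices appear in the cyclic order $x_1,x_2,y_1,y_2$ along $C$ (in one of the two directions of traversal), and crossed if they appear in the cyclic order $x_1,y_1,x_2,y_2$ along $C$. Crossed chords $x_1x_2,y_1y_2$ are strongly crossed if $\{x_1y_2,x_2y_1\}\subseteq E(C)$. The families $\mathcal{B}_i$. $\mathcal{B}_0$ is the set of all even cycles; $\mathcal{B}_1$ is the set of bipartite graphs consisting of a Hamilton cycle and exactly one chord; $\mathcal{B}_2$ is the set of graphs consisting of an (even) Hamilton cycle and exactly two chords, which are strongly crossed; $\mathcal{B}_3$ is the set of bipartite graphs consisting of a Hamilton cycle with pairwise parallel chords. *)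

(* Defs.v *)
From mathcomp Require Import all_boot.

Set Implicit Arguments.
Unset Strict Implicit.
Unset Printing Implicit Defensive.

(* A finite simple graph whose vertices are taken from an ambient finite type,
   so that subgraphs of a graph are graphs over the same ambient type. *)
Record graph (T : finType) := Graph {
  vset : {set T};
  eset : {set {set T}};
  esetP : eset \subset [set e : {set T} | (#|e| == 2) && (e \subset vset)]
}.

Section Graphs.
Variable T : finType.
Implicit Types (G H K : graph T) (M S : {set {set T}}) (W : {set T}).
Implicit Types (s : seq T) (e f : {set T}) (c : T -> bool).

Lemma rel_graph_subproof (r : rel T) :
  [set [set p.1; p.2] | p : T * T & (p.1 != p.2) && r p.1 p.2]
    \subset [set e : {set T} | (#|e| == 2) && (e \subset [set: T])].
Proof.
apply/subsetP => e /imsetP[p]; rewrite inE => /andP[ne _] ->.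
by rewrite inE cards2 ne subsetT.
Qed.

(* The graph on all of T in which distinct u, v are adjacent when r u v or
   r v u holds. *)
Definition rel_graph (r : rel T) : graph T := Graph (rel_graph_subproof r).

Definition subgraph H G : bool :=
  (vset H \subset vset G) && (eset H \subset eset G).

Lemma spanning_subproof G S :
  eset G :&: S
    \subset [set e : {set T} | (#|e| == 2) && (e \subset vset G)].
Proof. exact: subset_trans (subsetIl _ _) (esetP G). Qed.

(* The spanning subgraph of G with edge set E(G) :&: S. *)
Definition spanning G S : graph T := Graph (spanning_subproof G S).

Definition del_edges G S : graph T := spanning G (~: S).

Lemma induced_subproof G W :
  [set e in eset G | e \subset W]
    \subset [set e : {set T} | (#|e| == 2) && (e \subset vset G :&: W)].
Proof.
apply/subsetP => e; rewrite !inE => /andP[eG eW].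
by have := subsetP (esetP G) _ eG; rewrite inE subsetI eW andbT.
Qed.

Definition induced G W : graph T := Graph (induced_subproof G W).

Definition del_vertices G W : graph T := induced G (~: W).

Definition perfect_matching G M : bool :=
  (M \subset eset G) && partition M (vset G).

Definition matchable G : bool := [exists M, perfect_matching G M].

(* Every edge in E has ends of different colors. *)
Definition proper_coloring c (E : {set {set T}}) : Prop :=
  forall x y, x != y -> [set x; y] \in E -> c x != c y.

Definition bipartite G : Prop := exists c, proper_coloring c (eset G).

(** Elementary components *)

Definition adj G : rel T := fun x y => [set x; y] \in eset G.

Definition component G x : graph T :=
  induced G [set y | connect (adj G) x y].

Definition is_component K G : Prop :=
  exists2 x, x \in vset G & K = component G x.

Definition allowed G e : bool :=
  [exists M, perfect_matching G M && (e \in M)].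

(* In a matchable graph every vertex is covered by an allowed edge, so the
   subgraph formed by the allowed edges is spanning. *)
Definition allowed_subgraph G : graph T := spanning G [set e | allowed G e].

Definition elementary_component K G : Prop :=
  is_component K (allowed_subgraph G).

(** Forcing numbers *)

Definition antiforcing G M S : bool :=
  (S \subset eset G :\: M) &&
  [forall M', perfect_matching (del_edges G S) M' == (M' == M)].

(* If M is a perfect matching of G, then E(G) :\: M is an anti-forcing set of
   M, so the minimum ranges over a nonempty family. *)
Definition af G M : nat :=
  #|[arg min_(S < eset G :\: M | antiforcing G M S) #|S|]|.

Definition Af G : nat := \max_(M | perfect_matching G M) af G M.

Definition global_forcing G S : bool :=
  (S \subset eset G) &&
  [forall M1, forall M2,
     [&& perfect_matching G M1, perfect_matching G M2 & M1 != M2]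
       ==> (S :&: M1 != S :&: M2)].

(* E(G) itself is always a global forcing set. *)
Definition gf G : nat :=
  #|[arg min_(S < eset G | global_forcing G S) #|S|]|.

(** Conformality *)

Definition conformal H G : bool :=
  subgraph H G && matchable (del_vertices G (vset H)).

Definition strongly_uniform G : Prop :=
  forall H, conformal H G -> matchable H -> gf H = Af H.

(* The edges of the path (resp. closed walk) visiting the vertices of s in
   order. *)
Definition path_edges s : {set {set T}} :=
  [set:: [seq [set p.1; p.2] | p <- zip s (behead s)]].

Definition cycle_edges s : {set {set T}} :=
  [set:: [seq [set p.1; p.2] | p <- zip s (rot 1 s)]].

(* s lists the vertices of a path of odd length whose set of end vertices is
   D. *)
Definition odd_path s (D : {set T}) : Prop :=
  uniq s /\
  exists x p, [/\ s = x :: p, odd (size p) & [set x; last x p] = D].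

(** Cycles and chords: a cycle is given by the list s of its vertices in
    cyclic order. *)

Definition hamilton_cycle G s : Prop :=
  [/\ uniq s, 2 < size s, [set:: s] = vset G & cycle_edges s \subset eset G].

Definition chords G s : {set {set T}} := eset G :\: cycle_edges s.

(* The vertices of t appear in this cyclic order along s, in one of the two
   directions of traversal. *)
Definition cyclic_order s (t : seq T) : Prop :=
  exists i, subseq t (rot i s) \/ subseq t (rot i (rev s)).

(* In the next two definitions c is a proper coloring of the cycle s; the
   four end vertices are distinct as soon as s is duplicate-free. *)
Definition parallel c s e f : Prop :=
  exists x1 x2 y1 y2,
    [/\ e = [set x1; x2], f = [set y1; y2],
        [/\ c x1 != c x2, c y1 != c y2 & c x1 = c y1]
      & cyclic_order s [:: x1; x2; y1; y2]].

Definition strongly_crossed c s e f : Prop :=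
  exists x1 x2 y1 y2,
    [/\ e = [set x1; x2], f = [set y1; y2],
        [/\ c x1 != c x2, c y1 != c y2 & c x1 = c y1],
        cyclic_order s [:: x1; y1; x2; y2]
      & [set [set x1; y2]; [set x2; y1]] \subset cycle_edges s].

Definition is_K2 G : Prop :=
  exists x y, [/\ x != y, vset G = [set x; y] & eset G = [set [set x; y]]].

Definition in_B0 G : Prop :=
  exists s, [/\ hamilton_cycle G s, ~~ odd (size s) & chords G s = set0].

Definition in_B1 G : Prop :=
  bipartite G /\ exists s, hamilton_cycle G s /\ #|chords G s| = 1.

Definition in_B2 G : Prop :=
  exists s c e f,
    [/\ hamilton_cycle G s, ~~ odd (size s),
        proper_coloring c (cycle_edges s),
        e != f /\ chords G s = [set e; f]
      & strongly_crossed c s e f].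

Definition in_B3 G : Prop :=
  bipartite G /\
  exists s c,
    [/\ hamilton_cycle G s, proper_coloring c (cycle_edges s)
      & {in chords G s &, forall e f, e != f -> parallel c s e f}].

End Graphs.

(* h is the placement in H of the vertices of J, and P e is the path of H
   that replaces the edge e of J. *)
Definition bisubdivision (U T : finType) (J : graph U) (H : graph T) : Prop :=
  exists (h : U -> T) (P : {set U} -> seq T),
    [/\ {in vset J &, injective h},
        {in eset J, forall e, odd_path (P e) (h @: e)},
        (* the interior of a path avoids the placed vertices and the other
           paths *)
        {in eset J, forall e x, x \in P e -> x \notin h @: e ->
           x \notin h @: vset J /\
           {in eset J, forall f, e != f -> x \notin P f}},
        vset H = h @: vset J :|: \bigcup_(e in eset J) [set:: P e]
      & eset H = \bigcup_(e in eset J) path_edges (P e)].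

Definition conformal_minor (U T : finType) (J : graph U) (G : graph T) : Prop :=
  exists2 H : graph T, conformal H G & bisubdivision J H.

(** The graphs A_i; the vertex v_k of A_2 and A_3 is the ordinal k - 1. *)

(* The paths 0-2-3-1, 0-4-5-1 and 0-6-7-1. *)
Definition A1 : graph 'I_8 := rel_graph (fun i j : 'I_8 =>
  (val i, val j) \in [:: (0, 2); (2, 3); (3, 1);
                         (0, 4); (4, 5); (5, 1);
                         (0, 6); (6, 7); (7, 1)]).

Definition A2 : graph 'I_8 := rel_graph (fun i j : 'I_8 =>
  (val j == i.+1 %% 8) || ((val i, val j) \in [:: (0, 3); (0, 5)])).

Definition A3 : graph 'I_10 := rel_graph (fun i j : 'I_10 =>
  (val j == i.+1 %% 10) || ((val i, val j) \in [:: (0, 3); (5, 8)])).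

Definition A4 : graph (bool * 'I_3)%type :=
  rel_graph (fun u v : bool * 'I_3 => u.1 != v.1).

(* Main.v *)
(* Both numbers gf and Af depend only on the family of perfect matchings.  For
   a conformal subgraph H of G that family arises from the one of G by
   prescribing some edges and forbidding others, and it is a product over the
   elementary components of G; gf and Af add up over such a product.

   (iii) => (i): the perfect matchings of a Hamilton cycle with k pairwise
   parallel chords are a discrete cube (switch any set of k disjoint
   alternating cycles, one for each chord) together with one more matching; for
   two strongly crossed chords they are the four points of {0,1}^2.  In every
   restriction of such a family the minima are read off directly.

   (i) => (ii): contracting the paths of a bisubdivision is a bijection on
   perfect matchings that does not increase gf and does not decrease af, and
   gf > Af holds for each A_i by inspection of its few perfect matchings.

   (ii) => (iii): let s be a longest conformal cycle of an elementary component.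
   If s is not a Hamilton cycle, a cycle in the symmetric difference of two
   perfect matchings yields an ear of s of length at least 3; the resulting
   theta graph contains A_1 or a longer conformal cycle.  So s is a Hamilton
   cycle, and two chords that share an end give A_2, two chords that do not
   cross and are not parallel give A_3, two chords that cross but not strongly
   give A_1, and a third chord added to two strongly crossed ones gives A_1,
   A_2, A_3 or A_4. *)

Require Import Defs.
From mathcomp Require Import all_boot zify.

Set Implicit Arguments.
Unset Strict Implicit.
Unset Printing Implicit Defensive.

(** The forcing numbers are computed on abstract set families: [good] certifies a common value n by
    witnesses and matching bounds, so no minimum is ever evaluated. Prescribing and forbidding edges
    is an interval constraint on a family, hence [hereditarily_good]. A cube with one extra point
    survives such constraints because each edge depends on at most one coordinate: what remains is a
    subcube, possibly empty, with or without the extra point. Unless the subcube is empty, the value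
    is its dimension, plus one if the extra point is still there.

    The cube requires the arcs cut off by the chords to be pairwise disjoint. Every chord has two
    arcs, told apart by the color of the end at which they start; parallelism selects a color only
    for each pair, and one color must be found that serves all pairs.

    For the A_i the gap is witnessed by one number k with Af <= k < gf, namely k = 1, 2, 2, 3.

    Strong crossing is what remains when crossing chords fail to produce A_1: the two arcs that
    would serve as a third path of a theta graph have no inner vertex. *)

Section Basics.
Variable T : finType.
Implicit Types (G H K : graph T) (M N S : {set {set T}}) (W : {set T}).
Implicit Types (e f : {set T}) (s p q : seq T).

(** * Edges, perfect matchings, paths and cycles *)

Lemma set2_injr (x y z : T) : [set x; y] = [set x; z] -> y = z.
Proof.
move=> E; have := set22 x y; rewrite E !inE => /orP[/eqP yx|/eqP //].
by have := set22 x z; rewrite -E yx !inE orbb => /eqP.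
Qed.

Lemma edgeP G e : e \in eset G -> exists x y,
  [/\ x != y, e = [set x; y], x \in vset G & y \in vset G].
Proof.
move=> eG; have := subsetP (esetP G) _ eG; rewrite inE => /andP[/cards2P[x [y [xy ->]]]].
rewrite subUset !sub1set => /andP[xG yG].
by exists x, y.
Qed.

Lemma edge_sub G e : e \in eset G -> e \subset vset G.
Proof. by move/(subsetP (esetP G)); rewrite inE => /andP[]. Qed.

Lemma edge_vset G e x : e \in eset G -> x \in e -> x \in vset G.
Proof. by move/edge_sub/subsetP; apply. Qed.

Lemma edge_pair G e x y :
  e \in eset G -> x \in e -> y \in e -> x != y -> e = [set x; y].
Proof.
case/edgeP=> a [b [ab -> _ _]]; rewrite !inE.
by case/orP=> /eqP-> /orP[] /eqP-> //; rewrite ?eqxx // setUC.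
Qed.

Lemma edge_other G e x : e \in eset G -> x \in e ->
  exists2 y, y != x & e = [set x; y].
Proof.
case/edgeP=> a [b [ab -> _ _]]; rewrite !inE.
case/orP=> /eqP->; first by exists b; rewrite // eq_sym.
by exists a; rewrite // setUC.
Qed.

Lemma edge_neq G x y : [set x; y] \in eset G -> x != y.
Proof.
case/edgeP=> a [b [ab E _ _]]; apply/eqP => xy; move: E; rewrite -xy setUid => E.
by have := set21 a b; have := set22 a b; rewrite -E !inE => /eqP bx /eqP ax;
   rewrite ax bx eqxx in ab.
Qed.

Lemma adj_sym G : symmetric (adj G).
Proof. by move=> x y; rewrite /adj setUC. Qed.

Lemma adj_vl G x y : adj G x y -> x \in vset G.
Proof. by move/edge_vset; apply; rewrite set21. Qed.

Lemma adj_vr G x y : adj G x y -> y \in vset G.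
Proof. by move/edge_vset; apply; rewrite set22. Qed.

Lemma colorP (c : T -> bool) G x y :
  proper_coloring c (eset G) -> adj G x y -> c y = ~~ c x.
Proof.
by move=> cG xy; have := cG _ _ (edge_neq xy) xy; case: (c x) (c y) => [] [].
Qed.

(** * Perfect matchings *)

Lemma pm_sub G M e : perfect_matching G M -> e \in M -> e \in eset G.
Proof. by case/andP=> /subsetP MG _ /MG. Qed.

Lemma pm_ex G M x : perfect_matching G M -> x \in vset G ->
  exists2 e, e \in M & x \in e.
Proof.
case/andP=> _ /and3P[/eqP<- _ _] /bigcupP[e eM xe]; by exists e.
Qed.

Lemma pm_uniq G M e f x : perfect_matching G M ->
  e \in M -> f \in M -> x \in e -> x \in f -> e = f.
Proof.
case/andP=> _ /and3P[_ /trivIsetP tM _] eM fM xe xf; apply/eqP/negPn/negP => ef.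
by have /pred0P/(_ x) := tM _ _ eM fM ef; rewrite /= xe xf.
Qed.

Lemma pmI G M : {subset M <= eset G} ->
  (forall x, x \in vset G -> exists2 e, e \in M & x \in e) ->
  (forall e f x, e \in M -> f \in M -> x \in e -> x \in f -> e = f) ->
  perfect_matching G M.
Proof.
move=> MG Mex Muniq; apply/andP; split; first exact/subsetP.
apply/and3P; split.
- apply/eqP/setP => x; apply/bigcupP/idP => [[e /MG eG xe]|/Mex[e eM xe]].
    exact: edge_vset eG xe.
  by exists e.
- apply/trivIsetP => e f eM fM ef; apply/pred0P => x /=; apply/negP => /andP[xe xf].
  by rewrite (Muniq _ _ _ eM fM xe xf) eqxx in ef.
- by apply/negP => /MG/edgeP[x [y [_ E _ _]]]; have := set21 x y; rewrite -E inE.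
Qed.

Lemma pm_pair_uniq G M x y z : perfect_matching G M ->
  [set x; y] \in M -> [set x; z] \in M -> y = z.
Proof.
move=> MG xy xz; apply: (@set2_injr x).
by apply: (pm_uniq MG xy xz (x := x)); rewrite set21.
Qed.

Lemma pm_other G M x : perfect_matching G M -> x \in vset G ->
  exists2 y, x != y & [set x; y] \in M.
Proof.
move=> MG /(pm_ex MG)[e eM xe].
have [y yx ee] := edge_other (pm_sub MG eM) xe.
by exists y; rewrite 1?eq_sym // -ee.
Qed.

Lemma pm_subset_eq G M M' :
  perfect_matching G M -> perfect_matching G M' -> M \subset M' -> M = M'.
Proof.
move=> MG M'G /subsetP sMM'; apply/setP => e; apply/idP/idP => [/sMM' //|eM'].
have [x [y [_ ee xG _]]] := edgeP (pm_sub M'G eM').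
have [f fM xf] := pm_ex MG xG.
by rewrite (pm_uniq M'G eM' (sMM' _ fM) (x := x)) // ee set21.
Qed.

Lemma pm_diff_ex G M M' :
  perfect_matching G M -> perfect_matching G M' -> M != M' ->
  exists2 e, e \in M & e \notin M'.
Proof.
move=> MG M'G ne; suff /subsetPn[e eM eM'] : ~~ (M \subset M') by exists e.
by apply/negP => /(pm_subset_eq MG M'G) E; rewrite E eqxx in ne.
Qed.

Lemma matchableP G : reflect (exists M, perfect_matching G M) (matchable G).
Proof. exact: existsP. Qed.

(** * Paths and cycles *)

Lemma path_edges1 (x : T) : path_edges [:: x] = set0.
Proof. by apply/setP => e; rewrite !inE. Qed.

Lemma path_edges_cons (x y : T) p :
  path_edges [:: x, y & p] = [set x; y] |: path_edges (y :: p).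
Proof. by apply/setP => e; rewrite !inE. Qed.

Lemma path_edges_cat p (x : T) q :
  path_edges (p ++ x :: q) = path_edges (rcons p x) :|: path_edges (x :: q).
Proof.
elim: p => [|y p IH]; first by rewrite path_edges1 set0U.
case: p IH => [|z p] IH /=; first by rewrite !path_edges_cons path_edges1 setU0.
by rewrite !path_edges_cons -setUA -IH.
Qed.

Lemma path_edges_rev p : path_edges (rev p) = path_edges p.
Proof.
elim: p => // x [|y p] IH //; rewrite path_edges_cons -IH !rev_cons.
rewrite -cats1 cat_rcons path_edges_cat setUC path_edges_cons path_edges1 setU0.
by rewrite [[set y; x]]setUC.
Qed.

Lemma cycle_edges_path (x : T) p : cycle_edges (x :: p) = path_edges (x :: rcons p x).
Proof.
rewrite /cycle_edges /path_edges rot1_cons /=.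
suff -> : zip (x :: p) (rcons p x) = zip (x :: rcons p x) (rcons p x) by [].
by elim: p {1 3}x => [|y p IH] z //=; rewrite IH.
Qed.

Lemma cycle_edges_rot n s : cycle_edges (rot n s) = cycle_edges s.
Proof.
rewrite -{2}(cat_take_drop n s) /rot; move: (take n s) (drop n s) => p q.
case: q p => [|x q] [|y p]; rewrite ?cats0 //= !cycle_edges_path.
rewrite !rcons_cat /= -!cat_cons.
by rewrite (path_edges_cat (x :: q)) (path_edges_cat (y :: p)) setUC.
Qed.

Lemma path_edges_adj G (x : T) p :
  (path_edges (x :: p) \subset eset G) = path (adj G) x p.
Proof.
elim: p x => [|y p IH] x; first by rewrite path_edges1 sub0set.
by rewrite path_edges_cons subUset IH sub1set.
Qed.

Lemma cycle_edges_adj G s : (cycle_edges s \subset eset G) = cycle (adj G) s.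
Proof.
case: s => [|x p]; last by rewrite cycle_edges_path path_edges_adj.
by apply/subsetP => e; rewrite !inE.
Qed.

Lemma path_edgesP e s :
  reflect (exists p x y q, s = p ++ x :: y :: q /\ e = [set x; y])
          (e \in path_edges s).
Proof.
apply: (iffP idP) => [|[p [x [y [q [-> ->]]]]]]; last first.
  by rewrite path_edges_cat path_edges_cons !inE eqxx orbT.
elim: s => [|x [|y s] IH]; [by rewrite inE|by rewrite path_edges1 inE|].
rewrite path_edges_cons => /setU1P[->|/IH[p [a [b [q [-> ->]]]]]].
  by exists [::], x, y, s.
by exists (x :: p), a, b, q.
Qed.

Lemma path_edges_mem s e (x : T) : e \in path_edges s -> x \in e -> x \in s.
Proof.
case/path_edgesP=> p [a [b [q [-> ->]]]]; rewrite !inE mem_cat !inE.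
by case/orP=> ->; rewrite ?orbT.
Qed.

End Basics.

(** * Forcing numbers of abstract set families *)

Section Families.
Variable E : finType.
Implicit Types (F : {set {set E}}) (M S D N : {set E}).

(** The global forcing sets of a family. Here S ranges over all subsets of the ambient type;
    intersecting S with the edge set of the graph, as in [separates_subset], leads back to the
    original notion. The same holds for [antiforces] and [anti_subset]. *)
Definition separates F S : Prop :=
  {in F &, forall M M', S :&: M = S :&: M' -> M = M'}.

Definition antiforces F M S : Prop :=
  S :&: M = set0 /\ {in F, forall M', S :&: M' = set0 -> M' = M}.

(* gf and Af, read for the family F in place of the perfect matchings, both
   equal n. *)
Definition good F : Prop := exists n,
  [/\ exists2 S, separates F S & #|S| <= n,
      forall S, separates F S -> n <= #|S|,
      {in F, forall M, exists2 S, antiforces F M S & #|S| <= n}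
    & exists2 M, M \in F & forall S, antiforces F M S -> n <= #|S|].

Definition restrict F D : {set {set E}} := [set M :&: D | M in F].

(** Says that F is the product of its restrictions to D and to the complement of D: the outer part
    of one member can be glued to the inner part of another. *)
Definition mixing F D : Prop :=
  {in F &, forall M M', (M :\: D) :|: (M' :&: D) \in F}.

Lemma mem_restrict F D M : M \in F -> M :&: D \in restrict F D.
Proof. exact: imset_f. Qed.

Lemma mixingC F D : mixing F D -> mixing F (~: D).
Proof.
move=> mF M M' MF M'F; have := mF _ _ M'F MF; rewrite setUC.
by rewrite [M :\: _]setDE setCK [M' :\: D]setDE.
Qed.

(** If S :&: D does not distinguish the inner parts of M and M', then S does not distinguish M from
    the member obtained by replacing the inner part of M by that of M'. *)
Lemma separates_restrict F D S :
  mixing F D -> separates F S -> separates (restrict F D) (S :&: D).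
Proof.
move=> mF sS _ _ /imsetP[M MF ->] /imsetP[M' M'F ->] E1.
have /setP E2 : M = (M :\: D) :|: (M' :&: D).
  apply: sS => //; first exact: mF.
  apply/setP => e; move/setP/(_ e): E1; rewrite !inE.
  by do !case: (e \in _).
by apply/setP => e; move: (E2 e); rewrite !inE; do !case: (e \in _).
Qed.

Lemma anti_restrict F D M S : mixing F D -> M \in F ->
  antiforces F M S -> antiforces (restrict F D) (M :&: D) (S :&: D).
Proof.
move=> mF MF [SM aS]; split.
  apply/setP => e; move/setP/(_ e): SM; rewrite !inE.
  by do !case: (e \in _).
move=> _ /imsetP[M' M'F ->] E1.
have /setP E2 : (M :\: D) :|: (M' :&: D) = M.
  apply: aS; first exact: mF.
  apply/setP => e; move/setP/(_ e): E1; move/setP/(_ e): SM; rewrite !inE.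
  by do !case: (e \in _).
by apply/setP => e; move: (E2 e); rewrite !inE; do !case: (e \in _).
Qed.

(** In a product, a set forces exactly when its two parts force in the two factors, so both numbers
    add up and n1 + n2 is the common value. *)
Lemma good_mixing F D : mixing F D ->
  good (restrict F D) -> good (restrict F (~: D)) -> good F.
Proof.
move=> mF [n1 [[S1 sS1 S1n] lo1 up1 [_ /imsetP[M1 M1F ->] M1n]]].
move=> [n2 [[S2 sS2 S2n] lo2 up2 [_ /imsetP[M2 M2F ->] M2n]]].
have mFC := mixingC mF.
have cU (A B : {set E}) : #|A| <= n1 -> #|B| <= n2 -> #|(A :&: D) :|: (B :\: D)| <= n1 + n2.
  move=> An Bn; apply: leq_trans (leq_card_setU _ _) _.
  by apply: leq_add; [apply: leq_trans An|apply: leq_trans Bn];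
     rewrite subset_leq_card // (subsetIl, subsetDl).
exists (n1 + n2); split.
- exists ((S1 :&: D) :|: (S2 :\: D)); last exact: cU.
  move=> M M' MF M'F E0.
  have E1 : M :&: D = M' :&: D.
    apply: sS1; rewrite ?mem_restrict //.
    apply/setP => e; move/setP/(_ e): E0; rewrite !inE.
    by do !case: (e \in _).
  have E2 : M :&: ~: D = M' :&: ~: D.
    apply: sS2; rewrite ?mem_restrict //.
    apply/setP => e; move/setP/(_ e): E0; rewrite !inE.
    by do !case: (e \in _).
  apply/setP => e; move/setP/(_ e): E2; move/setP/(_ e): E1; rewrite !inE.
  by do !case: (e \in _).
- move=> S sS; rewrite -(cardsID D S) setDE leq_add //.
    by apply: lo1; apply: separates_restrict.
  by apply: lo2; apply: separates_restrict.
- move=> M MF.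
  have [T1 [T1M aT1] T1n] := up1 _ (mem_restrict D MF).
  have [T2 [T2M aT2] T2n] := up2 _ (mem_restrict (~: D) MF).
  exists ((T1 :&: D) :|: (T2 :\: D)); last exact: cU.
  split.
    apply/setP => e; move/setP/(_ e): T1M; move/setP/(_ e): T2M; rewrite !inE.
    by do !case: (e \in _).
  move=> M' M'F E0.
  have /setP E1 : M' :&: D = M :&: D.
    apply: aT1; rewrite ?mem_restrict //.
    apply/setP => e; move/setP/(_ e): E0; rewrite !inE.
    by do !case: (e \in _).
  have /setP E2 : M' :&: ~: D = M :&: ~: D.
    apply: aT2; rewrite ?mem_restrict //.
    apply/setP => e; move/setP/(_ e): E0; rewrite !inE.
    by do !case: (e \in _).
  apply/setP => e; move: (E1 e) (E2 e); rewrite !inE.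
  by do !case: (e \in _).
- set M := (M2 :\: D) :|: (M1 :&: D).
  have MF : M \in F by apply: mF.
  exists M => // S aS; rewrite -(cardsID D S) setDE leq_add //.
    apply: M1n; suff <- : M :&: D = M1 :&: D by apply: anti_restrict.
    by apply/setP => e; rewrite !inE; do !case: (e \in _).
  apply: M2n; suff <- : M :&: ~: D = M2 :&: ~: D by apply: anti_restrict.
  by apply/setP => e; rewrite !inE; do !case: (e \in _).
Qed.

Lemma good1 M : good [set M].
Proof.
exists 0; split=> [||M'|].
- by exists set0; rewrite ?cards0 // => A B /set1P-> /set1P->.
- by [].
- move=> /set1P->; exists set0; rewrite ?cards0 //; split; first by rewrite set0I.
  by move=> A /set1P->.
- by exists M; rewrite ?set11.
Qed.

(** Iterates [good_mixing], splitting off one block at a time. The list may contain a block several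
    times, hence the alternative in the disjointness hypothesis; after its first occurrence a block
    contributes only the empty set. *)
Lemma good_blocks (Ds : seq {set E}) F :
  F != set0 ->
  {in Ds, forall D, mixing F D} ->
  {in F, forall M e, e \in M -> exists2 D, D \in Ds & e \in D} ->
  {in Ds &, forall D D', D = D' \/ D :&: D' = set0} ->
  {in Ds, forall D, good (restrict F D)} -> good F.
Proof.
elim: Ds F => [|D Ds IH] F F0 mF cov dis gF.
  suff -> : F = [set set0] by apply: good1.
  have F1 M : M \in F -> M = set0.
    move=> MF; apply/setP => e; rewrite inE; apply/negP => /(cov _ MF).
    by case=> D; rewrite in_nil.
  have [M MF] := set0Pn _ F0; apply/setP => M'; rewrite inE.
  by apply/idP/eqP => [/F1 //|->]; rewrite -(F1 _ MF).
have DD : D \in D :: Ds by rewrite inE eqxx.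
have Dsub D' : D' \in Ds -> D' \in D :: Ds by rewrite inE orbC => ->.
apply: (good_mixing (mF _ DD) (gF _ DD)); apply: IH.
- have [M MF] := set0Pn _ F0; apply/set0Pn; exists (M :&: ~: D).
  exact: mem_restrict.
- move=> D' D'Ds _ _ /imsetP[M MF ->] /imsetP[M' M'F ->].
  apply/imsetP; exists (M :\: D' :|: M' :&: D').
    by apply: mF; rewrite ?Dsub.
  by apply/setP => e; rewrite !inE; do !case: (e \in _).
- move=> _ /imsetP[M MF ->] e; rewrite !inE => /andP[/(cov _ MF)[D']].
  by rewrite inE => /predU1P[-> -> //|D'Ds eD' _]; exists D'.
- by move=> D1 D2 /Dsub D1s /Dsub D2s; apply: dis.
- move=> D' D'Ds; have [eD|D0] := dis _ _ DD (Dsub _ D'Ds).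
    rewrite -eD; suff -> : restrict (restrict F (~: D)) D = [set set0].
      exact: good1.
    have DM M : M :&: ~: D :&: D = set0.
      by apply/setP => e; rewrite !inE; do !case: (e \in _).
    have [M MF] := set0Pn _ F0; apply/setP => M'; rewrite inE.
    apply/imsetP/eqP => [[_ /imsetP[M1 M1F ->] ->] //|->].
    by exists (M :&: ~: D); rewrite ?mem_restrict ?DM.
  suff -> : restrict (restrict F (~: D)) D' = restrict F D' by apply/gF/Dsub.
  have DM M : M :&: ~: D :&: D' = M :&: D'.
    apply/setP => e; move/setP/(_ e): D0; rewrite !inE.
    by do !case: (e \in _).
  apply/setP => M'; apply/imsetP/imsetP => [[_ /imsetP[M1 M1F ->] ->]|[M1 M1F ->]].
    by exists M1.
  by exists (M1 :&: ~: D); rewrite ?mem_restrict // DM.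
Qed.

(** All members meet N in the same set, so elements of N distinguish nothing: deleting N is
    injective on F, and N can be removed from any forcing set of the new family. *)
Lemma good_setD F N N0 : {in F, forall M, M :&: N = N0} ->
  good F -> good [set M :\: N | M in F].
Proof.
move=> FN [n [[S sS Sn] lo up [M MF Mn]]].
have inj M1 M2 : M1 \in F -> M2 \in F -> M1 :\: N = M2 :\: N -> M1 = M2.
  by move=> M1F M2F E0; rewrite -(setID M1 N) -(setID M2 N) !FN // E0.
have memD M1 : M1 \in F -> M1 :\: N \in [set M :\: N | M in F].
  exact: imset_f.
exists n; split.
- exists S => // _ _ /imsetP[M1 M1F ->] /imsetP[M2 M2F ->] E0.
  rewrite (sS M1 M2) //; have E1 := FN _ M1F; have := FN _ M2F; rewrite -E1 => E2.
  apply/setP => e; move/setP/(_ e): E2; move/setP/(_ e): E0; rewrite !inE.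
  by do !case: (e \in _).
- move=> S1 sS1; apply: leq_trans (lo (S1 :\: N) _) _; last first.
    by rewrite subset_leq_card // subsetDl.
  move=> M1 M2 M1F M2F E0; apply: inj => //.
  apply: sS1; rewrite ?memD //.
  apply/setP => e; move/setP/(_ e): E0; rewrite !inE.
  by do !case: (e \in _).
- move=> _ /imsetP[M1 M1F ->]; have [S1 [S1M aS1] S1n] := up _ M1F.
  exists S1 => //; split.
    apply/setP => e; move/setP/(_ e): S1M; rewrite !inE.
    by do !case: (e \in _).
  move=> _ /imsetP[M2 M2F ->] E0; rewrite (aS1 M2) //.
  have E1 := FN _ M1F; have := FN _ M2F; rewrite -E1 => E2.
  apply/setP => e; move/setP/(_ e): E2; move/setP/(_ e): E0.
  move/setP/(_ e): S1M; rewrite !inE; by do !case: (e \in _).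
- exists (M :\: N); first exact: memD.
  move=> S1 [S1M aS1]; apply: leq_trans (Mn (S1 :\: N) _) _; last first.
    by rewrite subset_leq_card // subsetDl.
  split.
    apply/setP => e; move/setP/(_ e): S1M; rewrite !inE.
    by do !case: (e \in _).
  move=> M' M'F E0; apply: inj => //; apply: aS1; rewrite ?memD //.
  apply/setP => e; move/setP/(_ e): E0; rewrite !inE.
  by do !case: (e \in _).
Qed.

Lemma separates_card F S : separates F S -> #|F| <= 2 ^ #|S|.
Proof.
move=> sS; rewrite -card_powerset -(card_in_imset sS) subset_leq_card //.
by apply/subsetP => _ /imsetP[M _ ->]; rewrite inE subsetIl.
Qed.

Lemma anti_hit F M M' S : antiforces F M S -> M' \in F -> M' != M ->
  exists e, [/\ e \in S, e \in M' & e \notin M].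
Proof.
move=> [SM aS] M'F ne; have /set0Pn[e] : S :&: M' != set0.
  by apply: contra ne => /eqP/(aS _ M'F)->.
rewrite inE => /andP[eS eM']; exists e; split=> //; apply/negP => eM.
by move/setP/(_ e): SM; rewrite !inE eS eM.
Qed.

Lemma antiI F M S : {in S, forall e, e \notin M} ->
  {in F, forall M', M' != M -> exists2 e, e \in S & e \in M'} -> antiforces F M S.
Proof.
move=> SM hit; split.
  apply/setP => e; rewrite !inE; apply/andP => -[/SM eM]; exact/negP.
move=> M' M'F E0; apply/eqP/negPn/negP => /(hit _ M'F)[e eS eM'].
by move/setP/(_ e): E0; rewrite !inE eS eM'.
Qed.

(** The two bits of p and q embed F into the square {0,1}^2, in which opposite corners are disjoint
    sets and p' is the negation of p. The common value is 0, 1 or 2 when F has one, two, or at least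
    three members. *)
Lemma good_code2 F (p p' q : E) : F != set0 ->
  {in F, forall M, (p' \in M) = (p \notin M)} ->
  {in F &, forall M M', (p \in M) = (p \in M') -> (q \in M) = (q \in M') -> M = M'} ->
  {in F &, forall M M', (p \in M) != (p \in M') -> (q \in M) != (q \in M') ->
     M :&: M' = set0} ->
  {in F &, forall M M', M != M' -> exists2 e, e \in M & e \notin M'} ->
  good F.
Proof.
move=> F0 pp' inj dis anc.
have : 0 < #|F| by rewrite card_gt0.
case cF: #|F| => [|[|[|k]]] // _.
- have /cards1P[M ->] : #|F| == 1 by rewrite cF.
  exact: good1.
- have /cards2P[A [B [AB FE]]] : #|F| == 2 by rewrite cF.
  have AF : A \in F by rewrite FE !inE eqxx.
  have BF : B \in F by rewrite FE !inE eqxx orbT.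
  have BA : B != A by rewrite eq_sym.
  have [a aA aB] := anc _ _ AF BF AB.
  have [b bB bA] := anc _ _ BF AF BA.
  exists 1; split.
  + exists [set a]; last by rewrite cards1.
    move=> M M'; rewrite FE !inE => /orP[] /eqP-> /orP[] /eqP-> // /setP/(_ a);
    by rewrite !inE eqxx aA (negbTE aB).
  + move=> S /separates_card; rewrite cF card_gt0 => c2.
    by apply/eqP => S0; rewrite S0 cards0 in c2.
  + move=> M; rewrite {1}FE !inE => /orP[] /eqP->.
      exists [set b]; rewrite ?cards1 //; apply: antiI => [e /set1P-> //|M'].
      by rewrite FE !inE => /orP[/eqP->|/eqP-> _]; [rewrite eqxx|exists b; rewrite ?set11].
    exists [set a]; rewrite ?cards1 //; apply: antiI => [e /set1P-> //|M'].
    by rewrite FE !inE => /orP[/eqP-> _|/eqP->]; [exists a; rewrite ?set11|rewrite eqxx].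
  + exists A => // S aS; have [e [eS _ _]] := anti_hit aS BF BA.
    by rewrite card_gt0; apply/set0Pn; exists e.
exists 2; split.
- exists [set p; q]; last by rewrite cards2; case: (_ == _).
  move=> M M' MF M'F /setP E0; apply: (inj _ _) => //.
    by have := E0 p; rewrite !inE eqxx.
  by have := E0 q; rewrite !inE eqxx orbT.
- move=> S /separates_card; rewrite cF => c2.
  by case: #|S| c2 => [|[|]].
(* [p0] is the one of p, p' outside M, so it hits every member that differs from M in the first bit.
   By injectivity at most one further member shares the first bit, and a single edge of it completes
   the anti-forcing set. *)
- move=> M MF; pose p0 := if p \in M then p' else p.
  have p0M : p0 \notin M by rewrite /p0; case: ifPn => //; rewrite pp' // => ->.
  have p0M' M' : M' \in F -> (p \in M) != (p \in M') -> p0 \in M'.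
    move=> M'F; rewrite /p0; case: ifPn => pM; rewrite ?pp' //.
    by case: (p \in M').
  have [M1 /and3P[M1F pM1 M1M]|none] :=
    pickP (fun M1 => [&& M1 \in F, (p \in M) == (p \in M1) & M1 != M]).
    have [e eM1 eM] := anc _ _ M1F MF M1M.
    exists [set p0; e]; last by rewrite cards2; case: (_ == _).
    apply: antiI => [x|M' M'F M'M].
      by rewrite !inE => /orP[] /eqP->.
    have [pM'|/(p0M' _ M'F) pM'] := eqVneq (p \in M) (p \in M').
      exists e; first by rewrite set22.
      suff -> : M' = M1 by [].
      apply: (inj _ _) => //; first by rewrite -pM' (eqP pM1).
      apply/eqP/negPn/negP => qM.
      have: (q \in M') != (q \in M).
        apply: contra M'M => /eqP qq; apply/eqP; exact: (inj _ _).
      have: (q \in M1) != (q \in M).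
        apply: contra M1M => /eqP qq; apply/eqP; apply: (inj _ _) => //.
        by rewrite (eqP pM1).
      by move: qM; do !case: (q \in _).
    by exists p0; rewrite ?set21.
  exists [set p0]; last by rewrite cards1.
  apply: antiI => [x /set1P-> //|M' M'F M'M].
  exists p0; first by rewrite set11.
  by apply: p0M' => //; have := none M'; rewrite M'F M'M andbT /= => ->.
(* Among three corners of a square two are opposite, hence disjoint as sets. They become M1 and M2,
   and an anti-forcing set of the remaining corner M0 needs a separate element for each of them. *)
- have [M0 [M1 [M2 [M0F M1F M2F [M10 M20 d12]]]]] : exists M0 M1 M2,
    [/\ M0 \in F, M1 \in F, M2 \in F & [/\ M1 != M0, M2 != M0 & M1 :&: M2 = set0]].
    have c3 : 2 < #|F| by rewrite cF.
    have [A [B [C [[AF BF CF] [AB BC CA]]]]] := card_gt2P c3.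
    have nn M M' : M \in F -> M' \in F -> M != M' ->
        ~~ (((p \in M) == (p \in M')) && ((q \in M) == (q \in M'))).
      move=> MF M'F; apply: contra => /andP[/eqP e1 /eqP e2]; apply/eqP; exact: (inj _ _).
    have := nn _ _ AF BF AB; have := nn _ _ BF CF BC; have := nn _ _ CF AF CA.
    have dAB := dis _ _ AF BF; have dBC := dis _ _ BF CF; have dCA := dis _ _ CF AF.
    have [pA|pA] := boolP ((p \in A) != (p \in B)).
      have [qA|qA] := boolP ((q \in A) != (q \in B)).
        by move=> _ _ _; exists C, A, B; rewrite dAB // eq_sym CA BC.
      have [pB|pB] := boolP ((p \in B) != (p \in C)).
        have [qB|qB] := boolP ((q \in B) != (q \in C)).
          by move=> _ _ _; exists A, B, C; rewrite dBC // eq_sym AB.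
        move: pA pB qA qB; do !case: (_ \in _); done.
      have [qC|qC] := boolP ((q \in C) != (q \in A)).
        have [pC|pC] := boolP ((p \in C) != (p \in A)).
          by move=> _ _ _; exists B, C, A; rewrite dCA // eq_sym BC.
        by move: pA pB qA pC; do !case: (_ \in _).
      by move: pA pB qA qC; do !case: (_ \in _).
    have [pC|pC] := boolP ((p \in C) != (p \in A)).
      have [qC|qC] := boolP ((q \in C) != (q \in A)).
        by move=> _ _ _; exists B, C, A; rewrite dCA // eq_sym BC.
      have [qB|qB] := boolP ((q \in B) != (q \in C)).
        have [pB|pB] := boolP ((p \in B) != (p \in C)).
          by move=> _ _ _; exists A, B, C; rewrite dBC // eq_sym AB.
        by move: pA pB pC; do !case: (_ \in _).
      by move: pA pC qC qB; do !case: (_ \in _).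
    by move: pA pC; do !case: (_ \in _).
  exists M0 => // S aS.
  have [e [eS eM1 _]] := anti_hit aS M1F M10.
  have [f [fS fM2 _]] := anti_hit aS M2F M20.
  have ef : e != f.
    by apply/eqP => ef; move/setP/(_ e): d12; rewrite !inE eM1 ef fM2.
  suff : #|[set e; f]| <= #|S| by rewrite cards2 ef.
  by rewrite subset_leq_card // subUset !sub1set eS.
Qed.

End Families.

(** * A cube of matchings with one additional matching *)

Section Cube.
Variables (E : finType) (Ch M1 M2 : {set E}) (A : E -> {set E}).
Implicit Types (I J L U M S : {set E}) (i e : E).

(* M1 switched along the alternating cycles i |: A i, for i in I; M1 and M2
   alternate along each A i. *)
Definition cube I : {set E} :=
  I :|: (M1 :\: \bigcup_(i in I) A i) :|: (M2 :&: \bigcup_(i in I) A i).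

Hypothesis Ch_M1 : {in Ch, forall i, i \notin M1}.
Hypothesis Ch_M2 : {in Ch, forall i, i \notin M2}.
Hypothesis M1_M2 : {in M1, forall e, e \notin M2}.
Hypothesis A_uniq : {in Ch &, forall i j e, e \in A i -> e \in A j -> i = j}.
Hypothesis A_M1 : {in Ch, forall i, exists2 e, e \in M1 & e \in A i}.

Lemma mem_bigA I i e : I \subset Ch -> i \in Ch -> e \in A i ->
  (e \in \bigcup_(j in I) A j) = (i \in I).
Proof.
move=> /subsetP ICh iCh eA; apply/bigcupP/idP => [[j jI eAj]|iI]; last by exists i.
by rewrite (A_uniq iCh (ICh _ jI) eA eAj).
Qed.

Lemma cube_ch I e : e \in Ch -> (e \in cube I) = (e \in I).
Proof. by move=> eC; rewrite !inE (negbTE (Ch_M1 eC)) (negbTE (Ch_M2 eC)) andbF !orbF. Qed.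

Lemma cube_M1 I e : I \subset Ch -> e \in M1 ->
  (e \in cube I) = (e \notin \bigcup_(i in I) A i).
Proof.
move=> /subsetP IC eM; rewrite !inE eM (negbTE (M1_M2 eM)) andbT orbF.
by rewrite orb_idl // => /IC/Ch_M1; rewrite eM.
Qed.

Lemma cube_M2 I e : I \subset Ch -> e \in M2 ->
  (e \in cube I) = (e \in \bigcup_(i in I) A i).
Proof.
move=> /subsetP IC eM.
have eM1 : e \notin M1 by apply: contraL eM => /M1_M2.
rewrite !inE eM (negbTE eM1) andbF orbF.
by rewrite orb_idl // => /IC/Ch_M2; rewrite eM.
Qed.

Lemma cube0 : cube set0 = M1.
Proof. by apply/setP => e; rewrite /cube big_set0 !inE andbF orbF. Qed.

(** A chord is governed by its own coordinate, an element of A i by i alone since the A i are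
    disjoint, and everything else by no coordinate. This is why bounds on the members cut an
    interval out of the cube. *)
Lemma cube_coord e :
  (exists2 i, i \in Ch & forall I J, I \subset Ch -> J \subset Ch ->
     (i \in I) = (i \in J) -> (e \in cube I) = (e \in cube J)) \/
  (forall I J, I \subset Ch -> J \subset Ch -> (e \in cube I) = (e \in cube J)).
Proof.
have [eC|eC] := boolP (e \in Ch).
  by left; exists e => // I J _ _; rewrite !cube_ch.
have nI I : I \subset Ch -> (e \in I) = false.
  by move/subsetP=> IC; apply: contraNF eC => /IC.
have [/bigcupP[i iC eA]|eA] := boolP (e \in \bigcup_(i in Ch) A i).
  left; exists i => // I J IC JC ij.
  by rewrite !inE (nI _ IC) (nI _ JC) !(mem_bigA _ iC) // ij.
right=> I J IC JC; rewrite !inE (nI _ IC) (nI _ JC).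
have nA L : L \subset Ch -> (e \in \bigcup_(i in L) A i) = false.
  move/subsetP=> KC; apply: contraNF eA => /bigcupP[i /KC iC eA].
  by apply/bigcupP; exists i.
by rewrite !nA.
Qed.

Variable P : {set {set E}}.
Hypothesis P_M2 : M2 \in P.
Hypothesis P_cube : forall I, I \subset Ch -> cube I \in P.
Hypothesis P_cases :
  {in P, forall M, M = M2 \/ exists2 I : {set E}, I \subset Ch & M = cube I}.
Hypothesis P_anti :
  {in P &, forall M M', M != M' -> exists2 e, e \in M & e \notin M'}.
Hypothesis M1_neq_M2 : M1 != M2.

Lemma cube_neq_M2 I : I \subset Ch -> cube I != M2.
Proof.
move=> IC; have [->|/set0Pn[i iI]] := eqVneq I set0; first by rewrite cube0.
have iC := subsetP IC _ iI; apply: contraNneq (Ch_M2 iC) => <-.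
by rewrite cube_ch.
Qed.

(** The indices I with cube I in F form an interval between Lo and Up of the subset lattice. With J
    = Up :\: Lo, the common value is the size of J, plus 1 if M2 belongs to F. *)
Lemma good_cube L U (F := [set M in P | (L \subset M) && (M \subset U)]) :
  F != set0 -> good F.
Proof.
move=> F0.
have FP M : M \in F -> M \in P by rewrite inE => /andP[].
pose F1 := [set I : {set E} | (I \subset Ch) && (cube I \in F)].
have [F10|F1n] := eqVneq F1 set0.
  suff -> : F = [set M2] by apply: good1.
  have FM2 M : M \in F -> M = M2.
    move=> MF; have [//|[I IC E0]] := P_cases (FP _ MF).
    by move/setP/(_ I): F10; rewrite !inE IC -E0; move: MF; rewrite inE => ->.
  have [M MF] := set0Pn _ F0; apply/setP => M'; rewrite in_set1.
  by apply/idP/eqP => [/FM2 //|->]; rewrite -(FM2 _ MF).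
pose Lo := \bigcap_(I in F1) I; pose Up := \bigcup_(I in F1) I.
have UpC : Up \subset Ch by apply/bigcupsP => I; rewrite inE => /andP[].
have LoUp : Lo \subset Up.
  have [I IF] := set0Pn _ F1n; apply: (subset_trans (bigcap_inf _ IF)).
  exact: bigcup_sup.
have F1P I : (I \in F1) = (Lo \subset I) && (I \subset Up).
  apply/idP/andP => [IF|[LI IU]].
    by split; [apply: bigcap_inf|apply: bigcup_sup].
  have IC := subset_trans IU UpC.
  have toC J : J \in F1 -> J \subset Ch by rewrite inE => /andP[].
  (* Since e sees only one coordinate, its status in cube I already occurs at some index of F1; the
     bounds L and U can thus be checked for cube I edge by edge. *)
  have key e : exists2 J, J \in F1 & (e \in cube J) = (e \in cube I).
    have [J0 J0F] := set0Pn _ F1n.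
    have [[i iC eq_e]|eq_e] := cube_coord e; last first.
      by exists J0 => //; apply: eq_e => //; apply: toC.
    have [iI|iI] := boolP (i \in I).
      have /bigcupP[J JF iJ] := subsetP IU _ iI.
      exists J; first exact: JF.
      apply: eq_e; [exact: toC|exact: IC|by rewrite iJ iI].
    have : i \notin Lo by apply: contra iI => /(subsetP LI).
    move=> iLo; have /exists_inP[J JF iJ] : [exists J in F1, i \notin J].
      apply: contraNT iLo => /exists_inPn H; apply/bigcapP => J JF.
      by have := H _ JF; rewrite negbK.
    exists J; first exact: JF.
    apply: eq_e; [exact: toC|exact: IC|by rewrite (negbTE iJ) (negbTE iI)].
  rewrite inE IC inE P_cube //=; apply/andP; split; apply/subsetP => e.
    move=> eL; have [J JF <-] := key e; move: JF.
    rewrite inE [cube J \in _]inE => /and4P[_ _ /subsetP LJ _].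
    exact: LJ.
  have [J JF <-] := key e; move: JF.
  by rewrite inE [cube J \in _]inE => /and4P[_ _ _ /subsetP JU] /JU.
have cF I : Lo \subset I -> I \subset Up -> cube I \in F.
  by move=> LI IU; have : I \in F1 by [rewrite F1P LI IU]; rewrite inE => /andP[].
have Fc M : M \in F -> M = M2 \/ exists I : {set E}, [/\ Lo \subset I, I \subset Up & M = cube I].
  move=> MF; have [->|[I IC E0]] := P_cases (FP _ MF); [by left|right].
  have : I \in F1 by rewrite inE IC -E0.
  by rewrite F1P => /andP[LI IU]; exists I.
pose J := Up :\: Lo.
have JC : J \subset Ch by apply: subset_trans UpC; apply: subsetDl.
have UJ I : I \subset Up -> I \subset Ch by move/subset_trans; apply.
have eqJ I I' : Lo \subset I -> I \subset Up -> Lo \subset I' -> I' \subset Up ->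
    {in J, forall i, (i \in I) = (i \in I')} -> I = I'.
  move=> /subsetP LI /subsetP IU /subsetP LI' /subsetP IU' eqI.
  apply/setP => i; have [iL|iL] := boolP (i \in Lo); first by rewrite LI ?LI'.
  have [iU|iU] := boolP (i \in Up); first by apply: eqI; rewrite inE iL.
  by apply/idP/idP => [/IU|/IU']; rewrite (negbTE iU).
(* The part of cube I inside M2 grows with I, so an element of M2 missing from cube Up is missing
   from all cube I with I below Up. The single element a tells M2 from all of them. *)
have [a aM2 aU] : exists2 a, a \in M2 & a \notin cube Up.
  by apply: P_anti; rewrite ?P_cube // eq_sym cube_neq_M2.
have aI I : I \subset Up -> a \notin cube I.
  move=> IU; apply: contra aU; rewrite !cube_M2 ?UJ // => /bigcupP[i iI eA].
  by apply/bigcupP; exists i; rewrite // (subsetP IU).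
pose S2 := if M2 \in F then [set a] else set0.
have S2c : #|S2| = (M2 \in F) by rewrite /S2; case: ifP; rewrite ?cards1 ?cards0.
have S2I I : I \subset Up -> {in S2, forall e, e \notin cube I}.
  move=> IU e; rewrite /S2; case: ifP => _; last by rewrite inE.
  by move/set1P->; apply: aI.
have card2 (B : {set E}) n : #|B| <= n -> #|B :|: S2| <= n + (M2 \in F).
  by move=> Bn; rewrite -S2c (leq_trans (leq_card_setU _ _)) // leq_add2r.
(* [b i] is the negation of the coordinate i: it belongs to cube I exactly when i is not in I. The
   default is never returned for i in Ch. *)
pose b i := odflt i [pick e in M1 :&: A i].
have bP i : i \in Ch -> b i \in M1 /\ b i \in A i.
  move=> iC; rewrite /b; case: pickP => [e|none]; first by rewrite inE => /andP.
  by have [e e1 e2] := A_M1 iC; have := none e; rewrite inE e1 e2.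
have b_cube I i : I \subset Ch -> i \in Ch -> (b i \in cube I) = (i \notin I).
  move=> IC iC; have [b1 b2] := bP _ iC.
  by rewrite cube_M1 // (mem_bigA _ iC).
exists (#|J| + (M2 \in F)); split.
- exists (J :|: S2); last exact: card2.
  have eqc I I' : Lo \subset I -> I \subset Up -> Lo \subset I' -> I' \subset Up ->
      (J :|: S2) :&: cube I = (J :|: S2) :&: cube I' -> I = I'.
    move=> LI IU LI' IU' /setP E0; apply: eqJ => // i iJ.
    by have := E0 i; rewrite !in_setI in_setU iJ /= !cube_ch ?(subsetP JC).
  have M2c I : M2 \in F -> I \subset Up -> (J :|: S2) :&: M2 <> (J :|: S2) :&: cube I.
    move=> M2F IU /setP/(_ a); rewrite !in_setI in_setU /S2 M2F set11 orbT aM2.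
    by rewrite (negbTE (aI _ IU)).
  move=> M M' MF M'F E0.
  have [eM|[I [LI IU eM]]] := Fc _ MF; have [eM'|[I' [LI' IU' eM']]] := Fc _ M'F.
  + by rewrite eM eM'.
  + by rewrite eM eM' in E0 MF; case: (M2c _ MF IU').
  + by rewrite eM eM' in E0 M'F; case: (M2c _ M'F IU).
  + by rewrite eM eM'; rewrite eM eM' in E0; rewrite (eqc I I').
(* Counting suffices: the cube contributes 2 ^ #|J| members, and M2 as one more member pushes the
   count beyond that power of two. *)
- move=> S /separates_card cS.
  have inj : {in powerset J &, injective (fun X => cube (Lo :|: X))}.
    move=> X Y; rewrite !inE => XJ YJ /setP E0; apply/setP => i.
    have [iJ|iJ] := boolP (i \in J); last first.
      by apply/idP/idP => [/(subsetP XJ)|/(subsetP YJ)]; rewrite (negbTE iJ).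
    have := E0 i; rewrite !cube_ch ?(subsetP JC) // !in_setU.
    by move: iJ; rewrite inE => /andP[/negbTE-> _].
  pose FX := [set cube (Lo :|: X) | X in powerset J].
  have cFX : #|FX| = 2 ^ #|J| by rewrite card_in_imset // card_powerset.
  have FXF : FX \subset F.
    apply/subsetP => _ /imsetP[X XJ ->]; rewrite inE in XJ.
    apply: cF; first exact: subsetUl.
    by rewrite subUset LoUp (subset_trans XJ) // subsetDl.
  have M2FX : M2 \notin FX.
    apply/imsetP => -[X]; rewrite inE => XJ /eqP; apply/negP.
    rewrite eq_sym cube_neq_M2 // subUset (subset_trans LoUp UpC).
    exact: subset_trans XJ JC.
  case M2F: (M2 \in F); last first.
    rewrite addn0 -(leq_exp2l (m := 2)) // -cFX.
    exact: leq_trans (subset_leq_card FXF) cS.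
  rewrite addn1 -(ltn_exp2l (m := 2)) // -cFX; apply: leq_trans cS.
  apply: proper_card; apply/properP; split=> //; by exists M2.
- move=> M MF; have [eM|[I [LI IU eM]]] := Fc _ MF; last first.
    (* One element for each coordinate in J, the chord i or its negation [b i], whichever is absent
       from cube I; each member of the cube that differs at i contains it. *)
    exists ((J :\: I) :|: [set b i | i in J :&: I] :|: S2).
      rewrite eM; apply: antiI => [e /setUP[/setUP[/setDP[iJ iI]|]|/(S2I _ IU) //]|M' M'F].
          by rewrite cube_ch ?(subsetP JC).
        case/imsetP=> i /setIP[iJ iI] ->.
        by rewrite b_cube ?UJ ?(subsetP JC) // iI.
      have [eM'|[I' [LI' IU' ->]]] := Fc _ M'F.
        exists a; rewrite ?eM' // !in_setU /S2 -eM' M'F set11.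
        by rewrite orbT.
      move=> ne; have /forall_inPn[i iJ iI] : ~~ [forall i in J, (i \in I) == (i \in I')].
        apply: contra ne => /forall_inP H; rewrite (eqJ I' I) // => i /H /eqP //.
      have iC := subsetP JC _ iJ.
      have [i1|i1] := boolP (i \in I).
        exists (b i).
          rewrite !in_setU; apply/orP; left; apply/orP; right.
          by apply: imset_f; rewrite in_setI iJ.
        by rewrite b_cube ?UJ //; move: iI; rewrite i1; case: (i \in I').
      exists i; first by rewrite !in_setU in_setD i1 iJ.
      by rewrite cube_ch //; move: iI; rewrite (negbTE i1); case: (i \in I').
    apply: card2; apply: leq_trans (leq_card_setU _ _) _.
    rewrite -(cardsID I J) addnC leq_add2r; exact: leq_imset_card.
  have M2F : M2 \in F by rewrite -eM.
  rewrite M2F addn1 eM.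
  have [J0|/set0Pn[i iJ]] := eqVneq J set0.
    have [e e1 e2] : exists2 e, e \in cube Lo & e \notin M2.
      apply: P_anti; rewrite ?P_cube ?cube_neq_M2 //; exact: UJ.
    exists [set e]; last by rewrite cards1.
    apply: antiI => [x /set1P-> //|M' M'F M'2].
    exists e; first by rewrite set11.
    have [eM'|[I' [LI' IU' ->]]] := Fc _ M'F; first by rewrite eM' eqxx in M'2.
    by rewrite (eqJ I' Lo) // => j; rewrite J0 inE.
  have iC := subsetP JC _ iJ; have [b1 b2] := bP _ iC.
  (* Every cube I' contains i or b i and M2 contains neither, so two elements are enough; J is
     nonempty here, so 2 is within the bound. *)
  exists [set i; b i].
    apply: antiI => [x|M' M'F M'2].
      by rewrite !inE => /orP[] /eqP->; [apply: Ch_M2|apply: M1_M2].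
    have [eM'|[I' [LI' IU' ->]]] := Fc _ M'F; first by rewrite eM' eqxx in M'2.
    have [iI'|iI'] := boolP (i \in I').
      by exists i; rewrite ?set21 // cube_ch.
    by exists (b i); rewrite ?set22 // b_cube ?UJ.
  rewrite cards2; apply: (@leq_trans 2); first by case: (_ == _).
  by rewrite ltnS card_gt0; apply/set0Pn; exists i.
(* The top corner is extremal for Af. Removing i from Up adds only elements of M1 lying in A i, so
   each i in J demands its own element of M1; excluding M2 demands an element of M2, hence one
   outside M1. *)
- exists (cube Up); first exact: cF.
  move=> S aS.
  have hit i : i \in J -> exists e, [/\ e \in S, e \in M1 & e \in A i].
    move=> iJ; have iC := subsetP JC _ iJ.
    have /andP[iL iU] : (i \notin Lo) && (i \in Up) by rewrite -in_setD.
    have UiC : Up :\ i \subset Ch by apply: subset_trans UpC; apply: subD1set.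
    have cFi : cube (Up :\ i) \in F.
      by apply: cF; rewrite ?subD1set // subsetD1 LoUp.
    have [|e [eS e1 e2]] := anti_hit aS cFi.
      by apply: contraTneq iU => E0; rewrite -(cube_ch Up) // -E0 cube_ch // !inE eqxx.
    have eC : e \notin Ch.
      apply: contra e2 => eC; move: e1; rewrite !cube_ch // => /setD1P[] //.
    have eM1 : e \in M1.
      apply: contraNT e2 => eM1; move: (e1); rewrite !inE (negbTE eM1) andbF orbF.
      have -> : (e \in Up) = false by apply: contraNF eC => /(subsetP UpC).
      rewrite andbF /= => /andP[eM2 /bigcupP[j /setD1P[ji jU] eA]].
      by rewrite eM2 andbF /=; apply/bigcupP; exists j.
    exists e; split=> //; move: e2; rewrite cube_M1 // negbK => /bigcupP[j jU eA].
    have [<- //|ji] := eqVneq j i.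
    move: e1; rewrite cube_M1 // => /bigcupP[]; exists j => //.
    by rewrite !inE ji.
  pose g i := odflt i [pick e in S :&: (M1 :&: A i)].
  have gP i : i \in J -> [/\ g i \in S, g i \in M1 & g i \in A i].
    move=> iJ; rewrite /g; case: pickP => [e|none]; first by rewrite !inE => /and3P.
    by have [e [e1 e2 e3]] := hit _ iJ; have := none e; rewrite !inE e1 e2 e3.
  have injg : {in J &, injective g}.
    move=> i j iJ jJ gij; have [_ _ g1] := gP _ iJ; have [_ _ g2] := gP _ jJ.
    by apply: (A_uniq (subsetP JC _ iJ) (subsetP JC _ jJ) g1); rewrite gij.
  have gS : g @: J \subset S :&: M1.
    by apply/subsetP => _ /imsetP[i /gP[g1 g2 _] ->]; rewrite inE g1.
  rewrite -(card_in_imset injg) -(cardsID M1 S) leq_add ?subset_leq_card //.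
  case M2F: (M2 \in F) => //.
  have [|e [eS e1 e2]] := anti_hit aS M2F; first by rewrite eq_sym cube_neq_M2.
  rewrite card_gt0; apply/set0Pn; exists e; rewrite inE eS andbT.
  by apply: contraL e1 => /M1_M2.
Qed.

End Cube.

(** * Forcing numbers of graphs and reduction to elementary components *)

Section Forcing.
Variable T : finType.
Implicit Types (G H K : graph T) (M N S : {set {set T}}) (e f : {set T}).

Definition matchings G : {set {set {set T}}} := [set M | perfect_matching G M].

Lemma pm_del_edges G S M :
  perfect_matching (del_edges G S) M = perfect_matching G M && (S :&: M == set0).
Proof.
rewrite /perfect_matching /= subsetI -!andbA; congr (_ && _).
by rewrite andbC -disjoints_subset setI_eq0 disjoint_sym /partition -!andbA.
Qed.

Lemma separatesP H S :
  global_forcing H S <-> S \subset eset H /\ separates (matchings H) S.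
Proof.
split=> [/andP[SH /forallP H1]|[SH sS]].
  split=> // M M'; rewrite !inE => MH M'H E0; apply/eqP/negPn/negP => ne.
  have /forallP/(_ M') := H1 M; rewrite MH M'H ne /= => /negP; apply.
  exact/eqP.
apply/andP; split=> //; apply/forallP => M; apply/forallP => M'.
apply/implyP => /and3P[MH M'H]; apply: contra => /eqP E0; apply/eqP.
by apply: sS; rewrite ?inE.
Qed.

Lemma antiP H M S : perfect_matching H M ->
  antiforcing H M S <-> S \subset eset H :\: M /\ antiforces (matchings H) M S.
Proof.
move=> MH; split=> [/andP[SH /forallP H1]|[SH [SM aS]]].
  have SM0 : S :&: M = set0.
    by apply/eqP; rewrite setI_eq0; move: SH; rewrite subsetD => /andP[].
  split=> //; split=> // M'; rewrite inE => M'H /eqP M'S.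
  by have /eqP := H1 M'; rewrite pm_del_edges M'H M'S => /esym/eqP.
apply/andP; split=> //; apply/forallP => M'; apply/eqP.
rewrite pm_del_edges; apply/andP/eqP => [[M'H /eqP M'S]|->].
  by apply: aS; rewrite ?inE.
by rewrite MH SM.
Qed.

Lemma separates_subset H S : separates (matchings H) S -> separates (matchings H) (S :&: eset H).
Proof.
move=> sS M M' MH M'H E0; apply: sS => //.
have sub M1 : M1 \in matchings H -> S :&: eset H :&: M1 = S :&: M1.
  by rewrite inE => /andP[/setIidPr ME _]; rewrite -setIA ME.
by rewrite -sub // E0 sub.
Qed.

Lemma anti_subset H M S : M \in matchings H ->
  antiforces (matchings H) M S -> antiforces (matchings H) M (S :&: eset H) /\ S :&: eset H \subset eset H :\: M.
Proof.
move=> MH [SM aS].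
have sub M1 : M1 \in matchings H -> S :&: eset H :&: M1 = S :&: M1.
  by rewrite inE => /andP[/setIidPr ME _]; rewrite -setIA ME.
split; first by split=> [|M' M'H]; rewrite sub //; apply: aS.
by rewrite subsetD subsetIr -setI_eq0 sub // SM eqxx.
Qed.

Lemma gf_le H S : separates (matchings H) S -> gf H <= #|S|.
Proof.
move=> sS; apply: leq_trans (subset_leq_card (subsetIl S (eset H))).
rewrite /gf; case: arg_minnP => [|S0 _]; last first.
  by apply; apply/separatesP; rewrite subsetIr; split=> //; apply: separates_subset.
apply/separatesP; split=> // M M'; rewrite !inE => /andP[/setIidPr ME _].
by case/andP=> /setIidPr M'E _; rewrite ME M'E.
Qed.

Lemma gf_ge H n : (forall S, separates (matchings H) S -> n <= #|S|) -> n <= gf H.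
Proof.
move=> lo; rewrite /gf; case: arg_minnP => [|S0 /separatesP[_ /lo //]].
apply/separatesP; split=> // M M'; rewrite !inE => /andP[/setIidPr ME _].
by case/andP=> /setIidPr M'E _; rewrite ME M'E.
Qed.

Lemma antiforcing_compl H M : perfect_matching H M -> antiforcing H M (eset H :\: M).
Proof.
move=> MH; apply/antiP => //; split=> //; split.
  by rewrite setIC setIDA; apply/setP => e; rewrite !inE; case: (e \in M).
move=> M'; rewrite inE => M'H E0; apply: (pm_subset_eq M'H MH).
apply/subsetP => e eM'; move/setP/(_ e): E0; rewrite !inE eM' (pm_sub M'H eM').
by rewrite !andbT => /negbFE.
Qed.

Lemma af_le H M S : perfect_matching H M -> antiforces (matchings H) M S -> af H M <= #|S|.
Proof.
move=> MH aS; apply: leq_trans (subset_leq_card (subsetIl S (eset H))).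
rewrite /af; case: arg_minnP => [|S0 _]; first exact: antiforcing_compl.
apply; apply/antiP => //; have [] := @anti_subset H M S => //; by rewrite inE.
Qed.

Lemma af_ge H M n : perfect_matching H M ->
  (forall S, antiforces (matchings H) M S -> n <= #|S|) -> n <= af H M.
Proof.
move=> MH lo; rewrite /af; case: arg_minnP => [|S0 /(antiP _ MH)[_ /lo //]].
exact: antiforcing_compl.
Qed.

Lemma good_gf_Af H : good (matchings H) -> gf H = Af H.
Proof.
case=> n [[S sS Sn] lo up [M]]; rewrite inE => MH Mn.
have -> : gf H = n.
  by apply/eqP; rewrite eqn_leq gf_ge // andbT (leq_trans (gf_le sS)).
apply/eqP; rewrite eqn_leq; apply/andP; split.
  by apply: leq_trans (leq_bigmax_cond _ MH); apply: af_ge.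
apply/bigmax_leqP => M' M'H; have [|S' aS'] := up M'; first by rewrite inE.
exact/leq_trans/af_le.
Qed.

(** The gap Af <= k < gf, stated for a family so that it can be carried from a graph to its
    bisubdivisions. *)
Definition bad (F : {set {set {set T}}}) : Prop := exists k,
  (forall S, separates F S -> k < #|S|) /\
  {in F, forall M, exists2 S, antiforces F M S & #|S| <= k}.

Lemma bad_gf_Af H : bad (matchings H) -> gf H <> Af H.
Proof.
case=> k [lo up] E0; have := gf_ge lo; rewrite E0 ltnNge => /negP; apply.
apply/bigmax_leqP => M MH; have [|S aS] := up M; first by rewrite inE.
exact/leq_trans/af_le.
Qed.

(** L collects the prescribed edges and the complement of U the forbidden ones. A conformal subgraph
    induces on every elementary component a family of this kind, up to deletion of a fixed set. *)
Definition hereditarily_good (F : {set {set {set T}}}) : Prop :=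
  forall L U : {set {set T}},
  [set M in F | (L \subset M) && (M \subset U)] != set0 ->
  good [set M in F | (L \subset M) && (M \subset U)].

(** * Elementary components *)

Lemma pm_union G H M N : subgraph H G -> perfect_matching H M ->
  perfect_matching (del_vertices G (vset H)) N -> perfect_matching G (M :|: N).
Proof.
case/andP=> /subsetP HV /subsetP HE MH NG.
have NE e : e \in N -> e \in eset G /\ e \subset ~: vset H.
  by move/(pm_sub NG); rewrite inE => /andP[].
have dis e f x : e \in M -> f \in N -> x \in e -> x \in f -> False.
  move=> /(pm_sub MH)/edge_vset eH /NE[_ /subsetP fN] /eH xH /fN.
  by rewrite inE xH.
apply: pmI => [e|x xG|e f x].
- by case/setUP=> [/(pm_sub MH)/HE //|/NE[]].
- have [xH|xH] := boolP (x \in vset H).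
    by have [e eM xe] := pm_ex MH xH; exists e; rewrite ?inE ?eM.
  have [|e eN xe] := @pm_ex _ _ _ x NG; first by rewrite !inE xG.
  by exists e; rewrite ?inE ?eN ?orbT.
- case/setUP=> eM /setUP[] fM xe xf.
  + exact: (pm_uniq MH eM fM xe xf).
  + by case: (dis e f x).
  + by case: (dis f e x).
  + exact: (pm_uniq NG eM fM xe xf).
Qed.

Lemma pm_allowed_edge G M e :
  perfect_matching G M -> e \in M -> e \in eset (allowed_subgraph G).
Proof.
move=> MG eM; rewrite !inE (pm_sub MG eM); apply/existsP; exists M.
by rewrite MG.
Qed.

Lemma component_vset G x : x \in vset G -> x \in vset (component G x).
Proof. by move=> xG; rewrite !inE xG connect0. Qed.

Lemma component_edge G x e v : e \in eset G -> v \in e ->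
  v \in vset (component G x) -> e \in eset (component G x).
Proof.
move=> eG ve; rewrite !inE eG => /andP[_ xv]; apply/subsetP => u ue; rewrite inE.
have [-> //|uv] := eqVneq u v; apply: connect_trans xv _; apply: connect1.
by rewrite /adj -(edge_pair eG ve ue) // eq_sym.
Qed.

Lemma component_eq G x z : z \in vset (component G x) -> component G z = component G x.
Proof.
have cs : connect_sym (adj G) by apply: sym_connect_sym; apply: adj_sym.
rewrite !inE => /andP[_ xz]; congr induced.
by apply/setP => y; rewrite !inE (same_connect cs xz).
Qed.

Lemma pm_component G K M : elementary_component K G ->
  perfect_matching G M -> perfect_matching K (M :&: eset K).
Proof.
move=> [x xG ->] MG; apply: pmI => [e /setIP[] //|v vK|e f v].
  have vG : v \in vset G by move: vK; rewrite !inE => /andP[].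
  have [e eM ve] := pm_ex MG vG; exists e; rewrite // in_setI eM.
  exact: component_edge (pm_allowed_edge MG eM) ve vK.
by move=> /setIP[eM _] /setIP[fM _]; apply: (pm_uniq MG).
Qed.

(** Let N be a perfect matching of G minus the vertices of H. Adding N turns matchings of H into
    matchings of G, so their edges are allowed and none joins two elementary components: the
    matchings of H form a product over these. The factor at K consists of the matchings of K that
    contain N :&: eset K and lie in eset H :|: N, with N deleted. *)
Lemma strongly_uniformI G :
  (forall K, elementary_component K G -> hereditarily_good (matchings K)) ->
  strongly_uniform G.
Proof.
move=> gK H /andP[HG /matchableP[N NP]] /matchableP[M0 M0H].
apply: good_gf_Af; set AG := allowed_subgraph G.
have [HV HE] : {subset vset H <= vset G} /\ {subset eset H <= eset G}.
  by case/andP: HG => /subsetP ? /subsetP.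
have MNG M : M \in matchings H -> perfect_matching G (M :|: N).
  by rewrite inE => MH; apply: pm_union NP.
have MAG M e : M \in matchings H -> e \in M -> e \in eset AG.
  by move=> MH eM; apply: pm_allowed_edge (MNG _ MH) _; rewrite inE eM.
have N_notH e x : e \in N -> x \in e -> x \notin vset H.
  move/(pm_sub NP); rewrite inE => /andP[_ /subsetP eN] /eN.
  by rewrite inE.
have MN M e : M \in matchings H -> e \in M -> e \notin N.
  rewrite inE => MH eM; have [a [b [_ ee aH _]]] := edgeP (pm_sub MH eM).
  by apply: contraL aH => eN; apply: (N_notH _ _ eN); rewrite ee set21.
pose Ds := [seq eset (component AG x) | x <- enum (vset G)].
have mixD x : x \in vset G -> mixing (matchings H) (eset (component AG x)).
  move=> xG M M' MF M'F; have := MF; have := M'F; rewrite !inE => M'H MH.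
  apply: pmI => [e|v vH|e f v].
  + by case/setUP=> [/setDP[eM _]|/setIP[eM _]]; [apply: pm_sub eM|apply: pm_sub M'H _].
  + have [vK|vK] := boolP (v \in vset (component AG x)).
      have [e eM ve] := pm_ex M'H vH; exists e; rewrite // in_setU !in_setI eM.
      by rewrite (component_edge (MAG _ _ M'F eM) ve vK) orbT.
    have [e eM ve] := pm_ex MH vH; exists e; rewrite // in_setU !in_setD eM andbT.
    by apply/orP; left; apply: contra vK => /edge_vset; apply.
  + have sep e1 e2 : e1 \in M :\: eset (component AG x) -> 
       e2 \in M' :&: eset (component AG x) -> v \in e1 -> v \in e2 -> False.
      move=> /setDP[e1M /negP e1K] /setIP[_ e2K] v1 v2; apply: e1K.
      exact: component_edge (MAG _ _ MF e1M) v1 (edge_vset e2K v2).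
    case/setUP=> eM /setUP[] fM ve vf.
    * case/setDP: eM fM => eM _ /setDP[fM _]; exact: (pm_uniq MH eM fM ve vf).
    * by case: (sep _ _ eM fM).
    * by case: (sep _ _ fM eM).
    * case/setIP: eM fM => eM _ /setIP[fM _]; exact: (pm_uniq M'H eM fM ve vf).
apply: (@good_blocks _ Ds).
- by apply/set0Pn; exists M0; rewrite inE.
- by move=> _ /mapP[x xG ->]; apply: mixD; rewrite mem_enum in xG.
- move=> M MF e eM; have [a [b [_ ee aG _]]] := edgeP (MAG _ _ MF eM).
  exists (eset (component AG a)).
    by apply/mapP; exists a; rewrite ?mem_enum.
  apply: (component_edge (MAG _ _ MF eM) (v := a)); first by rewrite ee set21.
  exact: component_vset.
- move=> _ _ /mapP[x xG ->] /mapP[y yG ->].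
  set D1 := eset _; set D2 := eset _.
  have [->|/set0Pn[e /setIP[e1 e2]]] := eqVneq (D1 :&: D2) set0; [by right|left].
  have [a [b [_ ee aV _]]] := edgeP e1.
  have aV2 : a \in vset (component AG y).
    by apply: (edge_vset e2); rewrite ee set21.
  by rewrite /D1 /D2 -(component_eq aV) -(component_eq aV2).
move=> _ /mapP[x xG ->]; rewrite mem_enum in xG.
set K := component AG x.
have KG : elementary_component K G by exists x.
pose F' := [set M in matchings K | (N :&: eset K \subset M) && (M \subset eset H :|: N)].
have inF' M : M \in matchings H -> (M :|: N) :&: eset K \in F'.
  move=> MF; rewrite inE [_ \in matchings K]inE (pm_component KG (MNG _ MF)) /=.
  rewrite setSI ?subsetUr //=; apply: subset_trans (subsetIl _ _) _.
  by apply: setSU; move: MF; rewrite inE => /andP[].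
have E0 M : M \in matchings H -> ((M :|: N) :&: eset K) :\: N = M :&: eset K.
  move=> MF; apply/setP => e; rewrite !in_setD !in_setI in_setU.
  have [eN|eN] := boolP (e \in N); last by rewrite orbF.
  have /negbTE-> // : e \notin M by apply: contraL eN; apply: MN.
have -> : restrict (matchings H) (eset K) = [set M :\: N | M in F'].
  apply/setP => B; apply/imsetP/imsetP => [[M MF ->]|[M' M'F ->]].
    by exists ((M :|: N) :&: eset K); rewrite ?inF' ?E0.
  move: M'F; rewrite inE [_ \in matchings K]inE => /and3P[M'K /subsetP NM' /subsetP M'HN].
  have M'D e : e \in M' -> e \in eset K by apply: pm_sub.
  (* A matching of K within the bounds is completed to one of H by the fixed matching M0 outside K;
     the prescribed edges of N lie outside H and are dropped. *)
  exists ((M0 :\: eset K) :|: (M' :\: N)); last first.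
    apply/setP => e; rewrite !in_setI in_setU !in_setD.
    have [/M'D->|eM'] := boolP (e \in M'); first by rewrite /= !andbT.
    by rewrite !andbF orbF; case: (e \in eset K); rewrite ?andbF.
  have M0F : M0 \in matchings H by rewrite inE.
  have sep e1 e2 v : e1 \in M0 :\: eset K -> e2 \in M' :\: N ->
      v \in e1 -> v \in e2 -> False.
    move=> /setDP[e1M /negP e1K] /setDP[e2K _] v1 v2; apply: e1K.
    exact: component_edge (MAG _ _ M0F e1M) v1 (edge_vset (M'D _ e2K) v2).
  rewrite inE; apply: pmI => [e|v vH|e f v].
  + case/setUP=> [/setDP[eM _]|/setDP[/M'HN/setUP[//|eN] /negP[] //]].
    exact: pm_sub eM.
  + have [vK|vK] := boolP (v \in vset K).
      have [e eM ve] := pm_ex M'K vK; exists e; rewrite // in_setU !in_setD eM andbT.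
      by apply/orP; right; apply: contraL vH => eN; apply: N_notH ve.
    have [e eM ve] := pm_ex M0H vH; exists e; rewrite // in_setU !in_setD eM andbT.
    by apply/orP; left; apply: contra vK => /edge_vset; apply.
  + case/setUP=> eM /setUP[] fM ve vf.
    * case/setDP: eM fM => eM _ /setDP[fM _]; exact: (pm_uniq M0H eM fM ve vf).
    * by case: (sep _ _ _ eM fM ve vf).
    * by case: (sep _ _ _ fM eM vf ve).
    * case/setDP: eM fM => eM _ /setDP[fM _]; exact: (pm_uniq M'K eM fM ve vf).
apply: (@good_setD _ _ _ (N :&: eset K)).
  move=> M; rewrite inE [_ \in matchings K]inE => /and3P[MK /subsetP NM _].
  apply/setP => e; rewrite !in_setI; apply/andP/andP => [[eM eN]|[eN eK]].
    by rewrite (pm_sub MK eM).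
  by split=> //; apply: NM; rewrite in_setI eN.
apply: gK => //; apply/set0Pn; exists ((M0 :|: N) :&: eset K).
by apply: inF'; rewrite inE.
Qed.

End Forcing.

(** * Cyclic sequences *)

Section SeqFacts.
Variable T : eqType.
Implicit Types (s t : seq T) (x y u v : T).

Lemma subseq_consE x t s : subseq (x :: t) s ->
  exists a s', s = a ++ x :: s' /\ subseq t s'.
Proof.
elim: s => //= y s IH; case: ifP => [/eqP-> st|_ /IH[a [s' [-> st]]]].
  by exists [::], s.
by exists (y :: a), s'.
Qed.

Lemma next_split s i a u v b : uniq s -> rot i s = a ++ u :: v :: b -> next s u = v.
Proof.
move=> us E; have : fcycle (next s) (rot i s) by rewrite rot_cycle cycle_next.
rewrite E; case: a E => [|w a] E /=; first by case/andP=> /eqP.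
by rewrite rcons_cat cat_path /= => /and3P[_ _ /andP[/eqP]].
Qed.

Lemma prev_split s i a u v b : uniq s -> rot i s = a ++ u :: v :: b -> prev s v = u.
Proof. by move=> us /(next_split us) <-; rewrite prev_next. Qed.

(** Makes a local rule along the cycle global. It is applied to the difference of two matchings and
    to the difference of two colorings. *)
Lemma next_invariant (P : T -> bool) s : uniq s ->
  {in s, forall x, P (next s x) = P x} -> {in s &, forall x y, P x = P y}.
Proof.
move=> us inv; suff all0 x0 : x0 \in s -> {in s, forall x, P x = P x0}.
  by move=> x y xs ys; apply: all0.
move=> /rot_to[i p E] x; rewrite -(mem_rot i s) E.
have pin y : y \in x0 :: p -> P (next s y) = P y.
  by rewrite -E mem_rot; apply: inv.
have : path (frel (next s)) x0 p.
  have : fcycle (next s) (rot i s) by rewrite rot_cycle cycle_next.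
  by rewrite E /= rcons_path => /andP[].
rewrite inE => fp; case/predU1P=> [-> //|]; move: {i E} fp x.
elim: p x0 pin => // y p IH x0 pin /= /andP[/eqP xy fp] x.
have Py : P y = P x0 by rewrite -xy pin ?inE ?eqxx.
rewrite inE => /predU1P[-> //|xp]; rewrite -Py; apply: IH xp => // z zp.
by apply: pin; rewrite inE zp orbT.
Qed.

End SeqFacts.

(** * Perfect matchings along a Hamilton cycle *)

Section Hamilton.
Variables (T : finType) (K : graph T) (s : seq T).
Implicit Types (M N S : {set {set T}}) (e f : {set T}) (x y u v : T).
Hypothesis hs : hamilton_cycle K s.

Let us : uniq s. Proof. by case: hs. Qed.

Lemma ham_mem x : (x \in s) = (x \in vset K).
Proof. by case: hs => _ _ <- _; rewrite inE. Qed.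

(** Cycle edges are indexed by the vertex that they leave, so that subsets of the cycle can be
    described by sets of vertices. *)
Definition next_edge x : {set T} := [set x; next s x].

Lemma mem_next_edge x : x \in next_edge x. Proof. exact: set21. Qed.

Lemma mem_next_edge_prev x : x \in next_edge (prev s x).
Proof. by rewrite /next_edge next_prev // set22. Qed.

Lemma cycle_edgesP e :
  reflect (exists2 x, x \in s & e = next_edge x) (e \in cycle_edges s).
Proof.
apply: (iffP idP) => [|[x xs ->]]; last first.
  have : cycle (fun x y => [set x; y] \in cycle_edges s) s.
    case: (s) => // y p; rewrite cycle_edges_path /=.
    elim: (rcons p y) {1 3}y => //= z q IH w.
    rewrite path_edges_cons setU11; apply: sub_path (IH z) => a b ab.
    by rewrite inE ab orbT.
  by move/next_cycle; apply.
suff key t : e \in cycle_edges t -> fcycle (next s) t -> exists2 x, x \in t & e = next_edge x.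
  by move=> eC; apply: key eC (cycle_next us).
case: t => [|x p]; first by rewrite inE.
rewrite /= cycle_edges_path => /path_edgesP[a [u [v [b [E1 ->]]]]] fp.
exists u.
  have : u \in x :: rcons p x by rewrite E1 mem_cat inE eqxx orbT.
  by rewrite !inE mem_rcons inE orbA orbb.
rewrite /next_edge; case: a E1 => [|y a] [yx E1]; move: fp; rewrite E1 -?yx /=.
  by rewrite yx => /andP[/eqP->].
by rewrite cat_path /= => /and3P[_ _ /andP[/eqP-> _]].
Qed.

(** Rests on the cycle having at least three vertices. On two vertices both would index the same
    edge, and [next_edge] would not be injective. *)
Lemma next2_neq x : x \in s -> next s (next s x) != x.
Proof.
case: hs => _ s2 _ _ /rot_to[i p E].
case: p E => [|y [|z p]] E; try by move: s2; rewrite -(size_rot i) E.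
have n1 : next s x = y by apply: (@next_split _ s i [::] x y (z :: p)).
have n2 : next s y = z by apply: (@next_split _ s i [:: x] y z p).
have : uniq (rot i s) by rewrite rot_uniq.
rewrite n1 n2 E /= !inE !negb_or; case/andP=> /and3P[_ xz _] _.
by rewrite eq_sym.
Qed.

Lemma next_edge_inj : {in s &, injective next_edge}.
Proof.
move=> x y xs ys; rewrite /next_edge => E; apply/eqP/negPn/negP => xy.
have := set21 x (next s x); rewrite E !inE (negbTE xy) /= => /eqP xE.
have := set21 y (next s y); rewrite -E !inE eq_sym (negbTE xy) /= => /eqP yE.
by have := next2_neq ys; rewrite -xE -yE eqxx.
Qed.

Lemma next_neq x : x \in s -> next s x != x.
Proof. by move=> xs; apply: contraNneq (next2_neq xs) => E; rewrite !E. Qed.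

Lemma next_edge_edge x : x \in s -> next_edge x \in eset K.
Proof.
move=> xs; case: hs => _ _ _ /subsetP; apply; apply/cycle_edgesP.
by exists x.
Qed.

Lemma mem_next_edgeE x v : x \in s -> (v \in next_edge x) = (x == v) || (x == prev s v).
Proof.
move=> xs; rewrite !inE; congr (_ || _); first by rewrite eq_sym.
by apply/eqP/eqP => ->; rewrite ?prev_next ?next_prev.
Qed.

Lemma edge_cases e : e \in eset K -> e \in chords K s \/ exists2 x, x \in s & e = next_edge x.
Proof.
move=> eK; have [/cycle_edgesP|e1] := boolP (e \in cycle_edges s); [by right|left].
by rewrite inE e1.
Qed.

Lemma chord_next_edge x e : x \in s -> e \in chords K s -> e != next_edge x.
Proof.
move=> xs; rewrite inE => /andP[e1 _]; apply: contraNneq e1 => ->.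
by apply/cycle_edgesP; exists x.
Qed.

Lemma pm_next M x : perfect_matching K M -> x \in s ->
  next_edge x \in M -> next_edge (prev s x) \in M -> False.
Proof.
move=> MK xs m1 m2; have : next_edge x = next_edge (prev s x).
  by apply: (pm_uniq MK m1 m2 (mem_next_edge x)); rewrite mem_next_edge_prev.
move/next_edge_inj; rewrite mem_prev => /(_ xs xs) E.
by have := next_neq xs; rewrite {1}E next_prev ?eqxx.
Qed.

Lemma pm_chord M e x : perfect_matching K M -> x \in s -> e \in chords K s ->
  x \in e -> e \in M -> next_edge x \notin M /\ next_edge (prev s x) \notin M.
Proof.
move=> MK xs ec xe eM; split; apply/negP => m.
  have := chord_next_edge xs ec.
  by rewrite (pm_uniq MK eM m xe (mem_next_edge x)) eqxx.
have xs' : prev s x \in s by rewrite mem_prev.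
have := chord_next_edge xs' ec.
by rewrite (pm_uniq MK eM m xe (mem_next_edge_prev x)) eqxx.
Qed.

Lemma pm_at M x : perfect_matching K M -> x \in s ->
  [\/ next_edge x \in M, next_edge (prev s x) \in M |
      exists e, [/\ e \in M, e \in chords K s & x \in e]].
Proof.
move=> MK xs; have xK : x \in vset K by rewrite -ham_mem.
have [e eM xe] := pm_ex MK xK.
have [ec|[y ys E]] := edge_cases (pm_sub MK eM); first by constructor 3; exists e.
by move: xe; rewrite E mem_next_edgeE // => /orP[] /eqP yE;
  [constructor 1|constructor 2]; rewrite -yE -E.
Qed.

Lemma pm_step M x : perfect_matching K M -> x \in s ->
  (forall e, e \in chords K s -> e \in M -> x \notin e) ->
  (next_edge x \in M) = (next_edge (prev s x) \notin M).
Proof.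
move=> MK xs nc; apply/idP/idP => [m1|/negP m2].
  by apply/negP => m2; apply: pm_next m1 m2.
by have [//|//|[e [eM ec xe]]] := pm_at MK xs; have := nc _ ec eM; rewrite xe.
Qed.

Lemma pm_determined M M' : perfect_matching K M -> perfect_matching K M' ->
  {in chords K s, forall e, (e \in M) = (e \in M')} ->
  {in s, forall x, (next_edge x \in M) = (next_edge x \in M')} -> M = M'.
Proof.
move=> MK M'K Ec Es; apply/setP => e; apply/idP/idP => eM.
  have [ec|[x xs E]] := edge_cases (pm_sub MK eM); first by rewrite -Ec.
  by rewrite E -Es // -E.
have [ec|[x xs E]] := edge_cases (pm_sub M'K eM); first by rewrite Ec.
by rewrite E Es // -E.
Qed.

(* Where M and M' differ is propagated along the cycle by every vertex that
   is not covered by a common chord, and a covered vertex forces agreement. *)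
Lemma pm_same_chords M M' : perfect_matching K M -> perfect_matching K M' ->
  {in chords K s, forall e, (e \in M) = (e \in M')} ->
  M = M' \/ (forall x, x \in s -> (next_edge x \in M) = (next_edge x \notin M')).
Proof.
move=> MK M'K Ec.
pose d x := (next_edge x \in M) (+) (next_edge x \in M').
have dn x : x \in s -> d (next s x) = d x.
  move=> xs; have ns : next s x \in s by rewrite mem_next.
  have [/exists_inP[e ec /andP[eM xe]]|/exists_inPn nc] :=
      boolP [exists e in chords K s, (e \in M) && (next s x \in e)].
    have [/negbTE m1 /negbTE m2] := pm_chord MK ns ec xe eM.
    have eM' : e \in M' by rewrite -Ec.
    have [/negbTE m3 /negbTE m4] := pm_chord M'K ns ec xe eM'.
    by rewrite prev_next // in m2 m4; rewrite /d m1 m2 m3 m4.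
  have nc1 e : e \in chords K s -> e \in M -> next s x \notin e.
    by move=> /nc; rewrite negb_and => /orP[/negP//|].
  have nc2 e : e \in chords K s -> e \in M' -> next s x \notin e.
    by move=> ec; rewrite -Ec //; apply: nc1.
  rewrite /d (pm_step MK ns nc1) (pm_step M'K ns nc2) prev_next //.
  by rewrite addbN addNb negbK.
have [/hasP[x0 x0s d0]|/hasPn dF] := boolP (has (fun x => ~~ d x) s).
  left; apply: pm_determined => // x xs.
  have : d x = false by rewrite -(next_invariant us dn x0s xs); apply/negbTE.
  by rewrite /d; do !case: (_ \in _).
right=> x xs; have := dF _ xs; rewrite negbK /d.
by do !case: (_ \in _).
Qed.

Lemma sub_mem_rot i a b x : rot i s = a ++ x :: b -> x \in s.
Proof. by move=> E; rewrite -(mem_rot i s) E mem_cat inE eqxx orbT. Qed.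

End Hamilton.

Section Orders.
Variable T : eqType.
Implicit Types (s t : seq T).

Lemma rot_rot_ex m n s : exists k, rot m (rot n s) = rot k s.
Proof.
have [ns|ns] := leqP n (size s); last by exists m; rewrite (rot_oversize (ltnW ns)).
have [ms|ms] := leqP m (size s); last first.
  by exists n; rewrite rot_oversize // size_rot ltnW.
by exists (if m + n <= size s then m + n else m + n - size s); rewrite rot_add_mod.
Qed.

Lemma next_last s j x p : uniq s -> rot j s = x :: p -> next s (last x p) = x.
Proof.
move=> us E; have : fcycle (next s) (rot j s) by rewrite rot_cycle cycle_next.
by rewrite E /= rcons_path => /andP[_ /eqP].
Qed.

Lemma subseq4 a b c d s : subseq [:: a; b; c; d] s ->
  exists p0 p1 p2 p3 p4, s = p0 ++ a :: p1 ++ b :: p2 ++ c :: p3 ++ d :: p4.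
Proof.
case/subseq_consE=> p0 [s0 [-> /subseq_consE[p1 [s1 [-> /subseq_consE]]]]].
case=> p2 [s2 [-> /subseq_consE[p3 [p4 [-> _]]]]].
by exists p0, p1, p2, p3, p4.
Qed.

Lemma uniq_crossed (x1 y1 x2 y2 : T) P Q : uniq (x1 :: P ++ y1 :: x2 :: Q ++ [:: y2]) ->
  [/\ [/\ x1 \notin P, x1 != y1, x1 != x2, x1 \notin Q & x1 != y2],
      [/\ y1 \notin P, x2 \notin P & y2 \notin P],
      [/\ y1 != x2, y1 \notin Q & y1 != y2]
    & [/\ x2 \notin Q, x2 != y2 & y2 \notin Q]].
Proof.
rewrite /= cat_uniq /= cat_uniq /=.
rewrite !(mem_cat, inE, has_cat, negb_or, orbF, andbT) /= ?orbF ?negb_or ?andbT -!andbA.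
case/and5P=> -> -> -> -> /and5P[-> _ -> -> /and5P[_ -> -> -> /and5P[-> -> -> _ ->]]].
by [].
Qed.
End Orders.

(** Reversing a rotation of [rev s] gives a rotation of s, so both directions of traversal become
    decompositions of rotations of s, with the four vertices in the given or in the reverse
    order. *)
Lemma cyclic_order4 (T : finType) (s : seq T) a b c d : cyclic_order s [:: a; b; c; d] ->
  exists j p1 p2 p3 p4,
    rot j s = a :: p1 ++ b :: p2 ++ c :: p3 ++ d :: p4 \/
    rot j s = d :: p1 ++ c :: p2 ++ b :: p3 ++ a :: p4.
Proof.
case=> i [].
  case/subseq4=> p0 [p1 [p2 [p3 [p4 E]]]].
  have [k Ek] := rot_rot_ex (size p0) i s.
  exists k, p1, p2, p3, (p4 ++ p0); left; rewrite -Ek E rot_size_cat.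
  by rewrite /= -!catA /= -!catA /= -!catA.
rewrite -subseq_rev rev_rot revK => /subseq4[p0 [p1 [p2 [p3 [p4 E]]]]].
have [k Ek] := rot_rot_ex (size p0) (size s - i) s.
exists k, p1, p2, p3, (p4 ++ p0); right; rewrite -Ek -/(rotr i s) E rot_size_cat.
by rewrite /= -!catA /= -!catA /= -!catA.
Qed.

(** Here p, q, m1, m2 tell whether the cycle edges leaving x1, x2, y1, y2 are in the matching, and
    e, f whether the chords are. The equations say that each of the four chord ends is covered once;
    every solution is determined by p and q. *)
Lemma crossed_code (p q m1 m2 e f : bool) :
  p + m2 + e = 1 -> q + m1 + e = 1 -> m1 + ~~ p + f = 1 -> m2 + ~~ q + f = 1 ->
  [/\ m1 = p && ~~ q, m2 = ~~ p && q, e = ~~ p && ~~ q & f = p && q].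
Proof. by case: p q m1 m2 e f => [] [] [] [] [] []. Qed.

(** * Two strongly crossed chords *)

Section HamColor.
Variables (T : finType) (K : graph T) (s : seq T) (c : T -> bool).
Implicit Types (M N S : {set {set T}}) (e f : {set T}) (x y u v : T).
Hypothesis hs : hamilton_cycle K s.
Hypothesis cs : proper_coloring c (cycle_edges s).

Let us : uniq s. Proof. by case: hs. Qed.

Lemma color_next x : x \in s -> c (next s x) = ~~ c x.
Proof.
move=> xs; have E : [set x; next s x] \in cycle_edges s.
  by apply/(cycle_edgesP hs); exists x.
have ne : x != next s x by rewrite eq_sym (next_neq hs).
by have := cs ne E; case: (c x); case: (c (next s x)).
Qed.

Lemma color_prev x : x \in s -> c (prev s x) = ~~ c x.
Proof.
move=> xs; rewrite -{2}(next_prev us x) color_next ?mem_prev // negbK.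
by [].
Qed.

Lemma pm_one M e v : perfect_matching K M -> v \in s -> e \in chords K s ->
  v \in e -> {in chords K s, forall f, v \in f -> f = e} ->
  (next_edge s v \in M) + (next_edge s (prev s v) \in M) + (e \in M) = 1.
Proof.
move=> MK vs ec ve e1.
case: (boolP (e \in M)) => [eM|eM].
  by have [/negbTE-> /negbTE->] := pm_chord hs MK vs ec ve eM.
rewrite (pm_step hs MK vs); first by case: (_ \in M).
by move=> f fc fM; apply: contraNN eM => vf; rewrite -(e1 f).
Qed.

(** At a vertex without chords exactly one of the two cycle edges is in M. Membership in M and color
    thus alternate together, and their exclusive or stays constant. *)
Lemma segment_const M j a x p b : perfect_matching K M ->
  rot j s = a ++ x :: p ++ b ->
  {in p, forall v, {in chords K s, forall e, v \notin e}} ->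
  {in x :: p, forall v, (next_edge s v \in M) (+) c v = (next_edge s x \in M) (+) c x}.
Proof.
move=> MK; elim: p a x => [|z p IH] a x E nc v; first by rewrite inE => /eqP->.
have xs : x \in s by apply: (sub_mem_rot E).
have zs : z \in s by rewrite -(mem_rot j) E !(mem_cat, inE) eqxx !orbT.
rewrite inE => /predU1P[-> //|vp].
rewrite (IH (rcons a x) z) //; last first.
- by move=> w wp; apply: nc; rewrite inE wp orbT.
- by rewrite cat_rcons.
have zx : prev s z = x by apply: (prev_split us E).
rewrite (pm_step hs MK zs) ?zx; last first.
  by move=> e ec _; apply: nc; rewrite // inE eqxx.
have -> : c z = ~~ c x by rewrite -zx color_prev // negbK.
by case: (_ \in M); case: (c x).
Qed.

(** The two long arcs, from x1 to y1 and from x2 to y2, carry one free bit each, and these bits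
    determine the chords and the two short edges. Flipping both bits changes every edge of the long
    arcs and leaves no common edge elsewhere. *)
Lemma crossed_good x1 P y1 x2 Q y2 j :
  rot j s = x1 :: P ++ y1 :: x2 :: Q ++ [:: y2] ->
  c x1 = c y1 -> c x1 != c x2 -> c y1 != c y2 ->
  chords K s = [set [set x1; x2]; [set y1; y2]] ->
  hereditarily_good (matchings K).
Proof.
move=> E cxy cx cy chE L U; set F := [set M in _ | _] => F0.
have FK M : M \in F -> perfect_matching K M by rewrite !inE => /andP[].
have uE : uniq (x1 :: P ++ y1 :: x2 :: Q ++ [:: y2]) by rewrite -E rot_uniq.
have ms v : (v \in s) = [|| v \in x1 :: P, v == y1, v \in x2 :: Q | v == y2].
  by rewrite -(mem_rot j) E !(inE, mem_cat) -!orbA.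
have x1s : x1 \in s by rewrite ms inE eqxx.
have x2s : x2 \in s by rewrite ms !inE eqxx !orbT.
have y1s : y1 \in s by rewrite ms !inE eqxx !orbT.
have y2s : y2 \in s by rewrite ms !inE eqxx !orbT.
have [[x1P x1y1 x1x2 x1Q x1y2] [y1P x2P y2P] [y1x2 y1Q y1y2] [x2Q x2y2 y2Q]] :=
  uniq_crossed uE.
have ncP : {in P, forall v, {in chords K s, forall e, v \notin e}}.
  move=> v vP e; rewrite chE !inE => /orP[] /eqP->; rewrite !inE negb_or;
  by apply/andP; split; apply: contraTneq vP => ->.
have ncQ : {in Q, forall v, {in chords K s, forall e, v \notin e}}.
  move=> v vQ e; rewrite chE !inE => /orP[] /eqP->; rewrite !inE negb_or;
  by apply/andP; split; apply: contraTneq vQ => ->.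
have E2 : rot j s = (x1 :: P ++ [:: y1]) ++ x2 :: Q ++ [:: y2].
  by rewrite E /= -catA.
have segP M := @segment_const M j [::] x1 P (y1 :: x2 :: Q ++ [:: y2]).
have segQ M := @segment_const M j (x1 :: P ++ [:: y1]) x2 Q [:: y2].
have nxx1 : prev s x1 = y2.
  rewrite -{1}(next_last us E) prev_next // last_cat /= last_cat /=.
  by [].
have nxx2 : prev s x2 = y1 by apply: (@prev_split _ s j (x1 :: P) y1 x2 (Q ++ [:: y2])).
have nxy1 : prev s y1 = last x1 P.
  apply: (@prev_split _ s j (belast x1 P) _ _ (x2 :: Q ++ [:: y2])) => //.
  by rewrite -[RHS]cat_rcons -lastI E.
have nxy2 : prev s y2 = last x2 Q.
  apply: (@prev_split _ s j (x1 :: P ++ y1 :: belast x2 Q) _ _ [::]) => //.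
  by rewrite -[RHS]cat_rcons rcons_cons rcons_cat rcons_cons -lastI E /= -catA.
set e := [set x1; x2] in chE; set f := [set y1; y2] in chE.
have ec : e \in chords K s by rewrite chE !inE eqxx.
have fc : f \in chords K s by rewrite chE !inE eqxx orbT.
have one v : v \in e -> v \notin f -> {in chords K s, forall g : {set T}, v \in g -> g = e}.
  by move=> ve vf g; rewrite chE !inE => /orP[] /eqP-> // vg; rewrite vg in vf.
have onf v : v \in f -> v \notin e -> {in chords K s, forall g : {set T}, v \in g -> g = f}.
  by move=> ve vf g; rewrite chE !inE => /orP[] /eqP-> // vg; rewrite vg in vf.
have lP M : perfect_matching K M -> (next_edge s (last x1 P) \in M) = (next_edge s x1 \notin M).
  move=> MK; have := segP _ MK E ncP _ (mem_last x1 P).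
  rewrite -nxy1 (color_prev y1s) cxy.
  by case: (_ \in M); case: (_ \in M); case: (c y1).
have lQ M : perfect_matching K M -> (next_edge s (last x2 Q) \in M) = (next_edge s x2 \notin M).
  move=> MK; have := segQ _ MK E2 ncQ _ (mem_last x2 Q).
  rewrite -nxy2 (color_prev y2s); have -> : c x2 = c y2.
    by move: cx cy; rewrite cxy; case: (c y1); case: (c x2); case: (c y2).
  by case: (_ \in M); case: (_ \in M); case: (c y2).
have a1 M : perfect_matching K M ->
    (next_edge s x1 \in M) + (next_edge s y2 \in M) + (e \in M) = 1.
  move=> MK; rewrite -nxx1; apply: pm_one; rewrite ?set21 //.
  by apply: one; rewrite !inE ?eqxx // negb_or x1y1.
have a2 M : perfect_matching K M ->
    (next_edge s x2 \in M) + (next_edge s y1 \in M) + (e \in M) = 1.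
  move=> MK; rewrite -nxx2; apply: pm_one; rewrite ?set22 //.
  by apply: one; rewrite !inE ?eqxx ?orbT // negb_or eq_sym y1x2.
have a3 M : perfect_matching K M ->
    (next_edge s y1 \in M) + (next_edge s x1 \notin M) + (f \in M) = 1.
  move=> MK; rewrite -lP // -nxy1; apply: pm_one; rewrite ?set21 //.
  by apply: onf; rewrite !inE ?eqxx // negb_or eq_sym x1y1.
have a4 M : perfect_matching K M ->
    (next_edge s y2 \in M) + (next_edge s x2 \notin M) + (f \in M) = 1.
  move=> MK; rewrite -lQ // -nxy2; apply: pm_one; rewrite ?set22 //.
  by apply: onf; rewrite !inE ?eqxx ?orbT // negb_or eq_sym x1y2 eq_sym.
have det M MK := crossed_code (a1 M MK) (a2 M MK) (a3 M MK) (a4 M MK).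
(* Since x1 and y1 have the same color, the arc between them has even length; its first and its last
   edge are therefore complementary and serve as p and p'. *)
apply: (@good_code2 _ F (next_edge s x1) (next_edge s (last x1 P)) (next_edge s x2)) => //.
- by move=> M /FK /lP.
- move=> M M' /FK MK /FK M'K p1 p2.
  have [b1 b2 b3 b4] := det _ MK; have [d1 d2 d3 d4] := det _ M'K.
  apply: (pm_determined hs) => // [g|v].
    by rewrite chE !inE => /orP[] /eqP->; rewrite ?b3 ?b4 ?d3 ?d4 p1 p2.
  rewrite ms => /or4P[vP|/eqP->|vQ|/eqP->].
  + by apply: (can_inj (addbK (c v))); rewrite segP // (segP M') // p1.
  + by rewrite b1 d1 p1 p2.
  + by apply: (can_inj (addbK (c v))); rewrite segQ // (segQ M') // p2.
  + by rewrite b2 d2 p1 p2.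
- move=> M M' /FK MK /FK M'K /negP p1 /negP p2.
  have {}p1 : (next_edge s x1 \in M') = (next_edge s x1 \notin M).
    by move: p1; case: (_ \in M); case: (_ \in M').
  have {}p2 : (next_edge s x2 \in M') = (next_edge s x2 \notin M).
    by move: p2; case: (_ \in M); case: (_ \in M').
  have [b1 b2 b3 b4] := det _ MK; have [d1 d2 d3 d4] := det _ M'K.
  rewrite p1 p2 in d1 d2 d3 d4.
  apply/setP => g; rewrite in_setI in_set0.
  have [gM|//] := boolP (g \in M); apply/negbTE.
  have [|[v vs gv]] := edge_cases hs (pm_sub MK gM).
    by rewrite chE !inE => /orP[] /eqP gE; move: gM; rewrite gE ?b3 ?d3 ?b4 ?d4;
       case: (next_edge s x1 \in M); case: (next_edge s x2 \in M).
  move: vs gM; rewrite {g}gv ms => /or4P[vP|/eqP->|vQ|/eqP->].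
  + have := segP _ MK E ncP _ vP; have := segP _ M'K E ncP _ vP; rewrite p1.
    by case: (next_edge s v \in M) => //; case: (next_edge s v \in M') => //;
       case: (next_edge s x1 \in M); case: (c v); case: (c x1).
  + by rewrite b1 d1; case: (next_edge s x1 \in M); case: (next_edge s x2 \in M).
  + have := segQ _ MK E2 ncQ _ vQ; have := segQ _ M'K E2 ncQ _ vQ; rewrite p2.
    by case: (next_edge s v \in M) => //; case: (next_edge s v \in M') => //;
       case: (next_edge s x2 \in M); case: (c v); case: (c x2).
  + by rewrite b2 d2; case: (next_edge s x1 \in M); case: (next_edge s x2 \in M).
- by move=> M M' /FK MK /FK M'K; apply: pm_diff_ex MK M'K.
Qed.

(** Both b and d come after a and before g, so the cycle edge joining a and g can only be the
    closing one, from g to a. Likewise the one joining d and b runs from b to d. *)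
Lemma cross_tight j a b d g p1 p2 p3 p4 :
  rot j s = a :: p1 ++ b :: p2 ++ d :: p3 ++ g :: p4 ->
  [set a; g] \in cycle_edges s -> [set d; b] \in cycle_edges s ->
  p2 = [::] /\ p4 = [::].
Proof.
move=> E /(cycle_edgesP hs)[u us1 Eu] /(cycle_edgesP hs)[v vs1 Ev].
have uE := mem_next_edge s u; rewrite -Eu !inE in uE.
have vE := mem_next_edge s v; rewrite -Ev !inE in vE.
have nE (x y w : T) : [set x; y] = next_edge s w ->
    (w == x) || (w == y) -> next s x = y \/ next s y = x.
  move=> Ew /orP[] /eqP wE; move: Ew; rewrite wE; first by move/set2_injr; left.
  by rewrite /next_edge [[set x; y]]setUC => /set2_injr; right.
have uE' : uniq (a :: p1 ++ b :: p2 ++ d :: p3 ++ g :: p4) by rewrite -E rot_uniq.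
have na : next s a != g.
  case: (p1) E uE' => [|z p1'] E uE'.
    rewrite (@next_split _ s j [::] _ _ _ us E).
    apply: contraTneq uE' => ->.
    by rewrite /= !(mem_cat, inE) eqxx !orbT !andbF.
  rewrite (@next_split _ s j [::] _ z _ us E).
  apply: contraTneq uE' => ->.
  by rewrite /= !(mem_cat, inE) eqxx !orbT !andbF.
have nd : next s d != b.
  have E' : rot j s = (a :: p1 ++ b :: p2) ++ d :: p3 ++ g :: p4.
    by rewrite E /= -catA.
  case: (p3) E' uE' => [|z p3'] E' uE'.
    rewrite (@next_split _ s j _ _ _ _ us E').
    apply: contraTneq uE' => ->.
    by rewrite /= !cat_uniq /= !(mem_cat, inE) eqxx !orbT !andbF.
  rewrite (@next_split _ s j _ _ z _ us E').
  apply: contraTneq uE' => ->.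
  by rewrite /= !cat_uniq /= !(mem_cat, inE) eqxx !orbT !andbF.
have ng : next s g = a.
  by case: (nE _ _ _ Eu uE) => // nn; rewrite nn eqxx in na.
have nb : next s b = d.
  by case: (nE _ _ _ Ev vE) => // nn; rewrite nn eqxx in nd.
split.
  case: (p2) E uE' => // z p2' E uE'.
  have E' : rot j s = (a :: p1) ++ b :: z :: p2' ++ d :: p3 ++ g :: p4 by rewrite E.
  move: uE'; have -> : z = d by rewrite -nb (@next_split _ s j _ _ z _ us E').
  by rewrite /= !cat_uniq /= !(mem_cat, inE) eqxx !orbT !andbF.
case: (p4) E uE' => // z p4' E uE'.
have E' : rot j s = (a :: p1 ++ b :: p2 ++ d :: p3) ++ g :: z :: p4'.
  by rewrite E /= -catA /= -catA.
move: uE'; have -> : z = a by rewrite -ng (@next_split _ s j _ _ z _ us E').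
by rewrite /= !(mem_cat, inE) eqxx !orbT.
Qed.

Lemma strongly_crossed_good e f : chords K s = [set e; f] ->
  strongly_crossed c s e f -> hereditarily_good (matchings K).
Proof.
move=> chE [x1 [x2 [y1 [y2 [eE fE [cx cy cxy] ord str]]]]].
move: str; rewrite subUset !sub1set => /andP[str1 str2].
have [j [p1 [p2 [p3 [p4 [E|E]]]]]] := cyclic_order4 ord.
  have [p20 p40] := cross_tight E str1 str2.
  rewrite p20 p40 /= in E; apply: (crossed_good E); by rewrite // -eE -fE.
have [|| p20 p40] := cross_tight E; rewrite ?[[set y2; _]]setUC ?[[set y1; _]]setUC //.
rewrite p20 p40 /= in E; apply: (crossed_good E).
- by move: cx cy cxy; case: (c x1); case: (c x2); case: (c y1); case: (c y2).
- by rewrite eq_sym.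
- by rewrite eq_sym.
- by rewrite chE eE fE setUC [[set y1; _]]setUC [[set x1; _]]setUC.
Qed.

End HamColor.

(** * Chords whose arcs are pairwise disjoint *)

Section Parallel.
Variables (T : finType) (K : graph T) (s : seq T) (c : T -> bool).
Implicit Types (M N S I : {set {set T}}) (e f g : {set T}) (x y u v : T) (b : bool).
Hypothesis hs : hamilton_cycle K s.
Hypothesis cK : proper_coloring c (eset K).

Let us : uniq s. Proof. by case: hs. Qed.

Let cs : proper_coloring c (cycle_edges s).
Proof. by move=> x y xy xyC; apply: cK => //; case: hs => _ _ _ /subsetP; apply. Qed.

Notation Ch := (chords K s).

Lemma chord_ends b e : e \in Ch ->
  exists x y, [/\ e = [set x; y], x \in s, y \in s, c x = b & c y = ~~ b].
Proof.
rewrite inE => /andP[_ eK]; have [x [y [xy E xK yK]]] := edgeP eK.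
have cxy : c x != c y by apply: cK => //; rewrite -E.
have [cx|cx] := eqVneq (c x) b.
  exists x, y; rewrite !(ham_mem hs) xK yK E; split=> //.
  by move: cxy; rewrite cx; case: (c y); case: (b).
exists y, x; rewrite !(ham_mem hs) xK yK E setUC; split=> //.
  by move: cxy cx; case: (c x); case: (c y); case: (b).
by move: cx; case: (c x); case: (b).
Qed.

(* The arc of s from the end of e of color b to its other end, the latter
   excluded; the two unions only select these ends. *)
Definition arc_set b e : {set T} :=
  \bigcup_(x in e | c x == b) \bigcup_(y in e | c y != b) [set:: arc s x y].

Lemma arc_setE b x y : c x = b -> c y = ~~ b ->
  arc_set b [set x; y] = [set:: arc s x y].
Proof.
move=> cx cy; apply/setP => v; apply/bigcupP/idP => [[u /andP[]]|vA].
  rewrite !inE => /orP[/eqP->|/eqP->]; last by rewrite cy; case: (b).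
  move=> _ /bigcupP[w /andP[]]; rewrite !inE => /orP[/eqP->|/eqP->].
    by rewrite cx eqxx.
  by rewrite ?inE.
exists x; first by rewrite set21 cx eqxx.
by apply/bigcupP; exists y; rewrite // set22 cy; case: (b).
Qed.

Lemma arc_setP b e : e \in Ch -> exists x y j p q,
  [/\ e = [set x; y], c x = b, c y = ~~ b, rot j s = x :: p ++ y :: q
    & arc_set b e = [set:: x :: p]].
Proof.
case/(chord_ends b)=> x [y [-> xs ys cx cy]].
have xy : x != y by apply/eqP => xy; move: cx; rewrite xy cy; case: (b).
rewrite arc_setE //; case: (rot_to_arc us xs ys xy) => j p q E1 _ E.
by exists x, y, j, p, q; rewrite E1.
Qed.

Lemma arc_setC b e v : e \in Ch -> v \in s ->
  (v \in arc_set (~~ b) e) = (v \notin arc_set b e).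
Proof.
move=> ec; case/(chord_ends b): (ec) => x [y [-> xs ys cx cy]].
have xy : x != y by apply/eqP => xy; move: cx; rewrite xy cy; case: (b).
rewrite (arc_setE cx cy) [[set x; y]]setUC (arc_setE cy) ?negbK //.
case: (rot_to_arc us xs ys xy) => j p q <- <- E.
rewrite -(mem_rot j) E -cat_cons mem_cat [LHS]inE [in RHS]inE.
have : uniq ((x :: p) ++ y :: q) by rewrite -cat_cons in E; rewrite -E rot_uniq.
rewrite cat_uniq => /and3P[_ /hasPn H _].
by case vq: (v \in y :: q); [move/H: vq => /negbTE->|rewrite orbF => ->].
Qed.

Lemma arc_set_sub b e v : e \in Ch -> v \in arc_set b e -> v \in s.
Proof.
case/(arc_setP b)=> x [y [j [p [q [_ _ _ E ->]]]]]; rewrite inE => vp.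
by rewrite -(mem_rot j) E -cat_cons mem_cat vp.
Qed.

(** The arc is entered at the end of e of color b and left at its other end; only there do a vertex
    and its predecessor differ in status. *)
Lemma arc_set_prev b e v : e \in Ch -> v \in s ->
  (prev s v \in arc_set b e) = (v \in arc_set b e) (+) (v \in e).
Proof.
case/(arc_setP b)=> x [y [j [p [q [-> _ _ E ->]]]]] vs.
have uE : uniq (x :: p ++ y :: q) by rewrite -E rot_uniq.
have := uE; rewrite -cat_cons cat_uniq => /and3P[_ /hasPn H _].
have xy : x != y.
  by apply: contraTneq uE => ->; rewrite /= mem_cat inE eqxx orbT.
rewrite in_set2 2![_ \in [set:: _]]in_set.
have := vs; rewrite -(mem_rot j) E -cat_cons mem_cat => /orP[].
  rewrite in_cons => /predU1P[->|vp].
    rewrite eqxx orTb addbb -{1}(next_last us E) prev_next // last_cat /=.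
    apply/negbTE; exact: H (mem_last y q).
  have vx : v != x by apply: contraTneq uE => <-; rewrite /= mem_cat vp.
  have vy : v != y.
    apply: contraTneq vp => ->; have := H y (mem_head y q).
    by rewrite in_cons negb_or => /andP[].
  rewrite (negbTE vx) (negbTE vy) vp /=.
  case/splitPr: vp E => p1 p2 E.
  have E' : rot j s = belast x p1 ++ last x p1 :: v :: p2 ++ y :: q.
    by rewrite -[RHS]cat_rcons -lastI E /= -catA.
  by rewrite (prev_split us E') -cat_cons mem_cat mem_last.
move=> vq; have vp := H _ vq; rewrite (negbTE vp).
have vx : (v == x) = false by apply: contraNF vp => /eqP->; apply: mem_head.
rewrite vx /=; move: vq; rewrite in_cons => /predU1P[->|vq].
  rewrite eqxx.
  have E' : rot j s = belast x p ++ last x p :: y :: q.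
    by rewrite -[RHS]cat_rcons -lastI E.
  by rewrite (prev_split us E') mem_last.
have vy : v != y.
  by move: uE; rewrite /= cat_uniq /= => /and5P[_ _ _ yq _]; apply: contraTneq vq => ->.
rewrite (negbTE vy); case/splitPr: vq E H => q1 q2 E H.
have E' : rot j s = (x :: p ++ belast y q1) ++ last y q1 :: v :: q2.
  by rewrite -[RHS]cat_rcons rcons_cons rcons_cat -lastI E /= -catA.
rewrite (prev_split us E'); apply/negbTE; apply: H.
by rewrite -cat_cons mem_cat mem_last.
Qed.

Lemma arc_set_color b e v : e \in Ch -> v \in s -> v \in e ->
  (v \in arc_set b e) = (c v == b).
Proof.
move=> ec vs; case/(arc_setP b): (ec)=> x [y [j [p [q [-> cx cy E ->]]]]].
have uE : uniq (x :: p ++ y :: q) by rewrite -E rot_uniq.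
have := uE; rewrite -cat_cons cat_uniq => /and3P[_ /hasPn H _].
rewrite !inE => /orP[] /eqP->; first by rewrite cx !eqxx.
have := H y; rewrite !inE eqxx => /(_ isT)/negbTE->.
by rewrite cy; case: (b).
Qed.

(** * The perfect matchings of a Hamilton cycle with disjoint arcs *)

(** The two colors give the two perfect matchings of the cycle itself. *)
Definition alternate b : {set {set T}} := [set next_edge s x | x in [set:: s] & c x == b].

Lemma next_edge_alternate b x : x \in s -> (next_edge s x \in alternate b) = (c x == b).
Proof.
move=> xs; apply/imsetP/idP => [[y]|cx].
  rewrite !inE => /andP[ys cy] /(next_edge_inj hs xs ys) ->; exact: cy.
by exists x; rewrite // !inE xs.
Qed.

Lemma alternate_sub b e : e \in alternate b -> exists x, [/\ x \in s, c x = b & e = next_edge s x].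
Proof. by case/imsetP=> x; rewrite !inE => /andP[xs /eqP cx] ->; exists x. Qed.

Lemma chord_alternate b e : e \in Ch -> e \notin alternate b.
Proof.
move=> ec; apply/negP => /alternate_sub[x [xs _ E]].
by have := chord_next_edge hs xs ec; rewrite E eqxx.
Qed.

Variable b : bool.
Hypothesis disj : {in Ch &, forall e f v,
  v \in arc_set b e -> v \in arc_set b f -> e = f}.

Definition arc_edges e : {set {set T}} := [set next_edge s x | x in arc_set b e].

Lemma next_edge_arc e x : e \in Ch -> x \in s -> (next_edge s x \in arc_edges e) = (x \in arc_set b e).
Proof.
move=> ec xs; apply/imsetP/idP => [[y yA]|xA]; last by exists x.
by move/(next_edge_inj hs xs (arc_set_sub ec yA)) ->.
Qed.

Notation cubeK := (cube (alternate b) (alternate (~~ b)) arc_edges).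

Lemma cube_chord I e : I \subset Ch -> e \in Ch -> (e \in cubeK I) = (e \in I).
Proof.
by move=> IC; apply: (@cube_ch _ Ch) => f; apply: chord_alternate.
Qed.

Lemma cube_next_edge I x : I \subset Ch -> x \in s ->
  (next_edge s x \in cubeK I) = (c x == b) (+) (x \in \bigcup_(e in I) arc_set b e).
Proof.
move=> /subsetP IC xs; rewrite /cube !in_setU in_setD in_setI !next_edge_alternate //.
have -> : (next_edge s x \in I) = false.
  by apply/negP => /IC/(chord_next_edge hs xs); rewrite eqxx.
have -> : (next_edge s x \in \bigcup_(i in I) arc_edges i) = (x \in \bigcup_(e in I) arc_set b e).
  apply/bigcupP/bigcupP => -[e eI xe]; exists e => //; first by rewrite -next_edge_arc ?IC.
  by rewrite next_edge_arc ?IC.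
by case: (c x); case: (b); case: (x \in _).
Qed.

Lemma cube_cases I e : I \subset Ch -> e \in cubeK I ->
  e \in I \/ exists2 x, x \in s & e = next_edge s x.
Proof.
move=> IC /setUP[/setUP[eI|/setDP[/alternate_sub[x [xs _ E]] _]]|]; first by left.
  by right; exists x.
by case/setIP=> /alternate_sub[x [xs _ E]] _; right; exists x.
Qed.

(** A chord and its arc form an alternating cycle of [alternate b]. At an end of a chord in I both
    cycle edges are switched off; every other vertex has the same status as its predecessor with
    respect to the switched arcs, and keeps exactly one cycle edge. *)
Lemma cube_pm I : I \subset Ch -> perfect_matching K (cubeK I).
Proof.
move=> IC; have sI := subsetP IC.
pose Z := \bigcup_(e in I) arc_set b e.
have at_chord e v : e \in I -> v \in s -> v \in e ->
    [/\ next_edge s v \notin cubeK I, next_edge s (prev s v) \notin cubeK I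
      & forall f, f \in I -> v \in f -> f = e].
  move=> eI vs ve; have ec := sI _ eI.
  have vA := arc_set_color b ec vs ve; have pA := arc_set_prev b ec vs.
  rewrite ve addbT in pA.
  (* An end of color b lies in the arc of its chord, and for an end of the other color the
     predecessor does. Disjointness is accordingly applied at v or at prev s v. *)
  have uniq_e f : f \in I -> v \in f -> f = e.
    move=> fI vf; have fc := sI _ fI.
    have vAf := arc_set_color b fc vs vf; have pAf := arc_set_prev b fc vs.
    rewrite vf addbT in pAf.
    have [cv|cv] := boolP (c v == b).
      by apply: (disj fc ec (v := v)); rewrite ?vA ?vAf.
    by apply: (disj fc ec (v := prev s v)); rewrite ?pA ?pAf ?vA ?vAf.
  have nf f : f \in I -> f != e -> v \notin arc_set b f /\ prev s v \notin arc_set b f.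
    move=> fI fe; have fc := sI _ fI.
    have vf : v \notin f by apply: contraNN fe => /(uniq_e _ fI)->.
    have pAf := arc_set_prev b fc vs; rewrite (negbTE vf) addbF in pAf.
    rewrite pAf; split; apply: contraNN fe => vAf; apply/eqP.
      have [cv|cv] := boolP (c v == b).
        by apply: (disj fc ec (v := v)); rewrite ?vA.
      by apply: (disj fc ec (v := prev s v)); rewrite ?pA ?pAf ?vA.
    have [cv|cv] := boolP (c v == b).
      by apply: (disj fc ec (v := v)); rewrite ?vA.
    by apply: (disj fc ec (v := prev s v)); rewrite ?pA ?pAf ?vA.
  have Zv : (v \in Z) = (c v == b).
    apply/bigcupP/idP => [[f fI vAf]|cv]; last by exists e; rewrite ?vA.
    have [fe|fe] := eqVneq f e; first by rewrite -vA -fe.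
    by have [] := nf _ fI fe; rewrite vAf.
  have Zp : (prev s v \in Z) = (c v != b).
    apply/bigcupP/idP => [[f fI vAf]|cv]; last by exists e; rewrite ?pA ?vA.
    have [fe|fe] := eqVneq f e; first by rewrite -vA -pA -fe.
    by have [_] := nf _ fI fe; rewrite vAf.
  have ps : prev s v \in s by rewrite mem_prev.
  rewrite !cube_next_edge // -/Z Zv Zp (color_prev hs cs vs).
  by split=> //; case: (c v); case: (b).
have at_free v : v \in s -> (forall f, f \in I -> v \notin f) ->
    (next_edge s v \in cubeK I) = (next_edge s (prev s v) \notin cubeK I).
  move=> vs nf; have ps : prev s v \in s by rewrite mem_prev.
  rewrite !cube_next_edge // (color_prev hs cs vs).
  have -> : (prev s v \in Z) = (v \in Z).
    have pA f : f \in I -> (prev s v \in arc_set b f) = (v \in arc_set b f).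
      by move=> fI; rewrite (arc_set_prev b (sI _ fI) vs) (negbTE (nf _ fI)) addbF.
    by apply/bigcupP/bigcupP => -[f fI vA]; exists f; rewrite // ?pA // -pA.
  by rewrite -/Z; case: (c v); case: (b); case: (v \in Z).
have at_v e v : e \in cubeK I -> v \in s -> v \in e ->
    [\/ e = next_edge s v, e = next_edge s (prev s v) | e \in I].
  move=> eM vs ve; have [eI|[x xs E]] := cube_cases IC eM; first by constructor 3.
  by move: ve; rewrite E (mem_next_edgeE hs) // => /orP[] /eqP->;
    [constructor 1|constructor 2].
apply: pmI => [e eM|v|e f v eM fM ve vf].
- have [/sI|[x xs ->]] := cube_cases IC eM; last exact: next_edge_edge.
  by rewrite inE => /andP[].
- rewrite -(ham_mem hs) => vs.
  have [/exists_inP[f fI vf]|/exists_inPn nf] := boolP [exists f in I, v \in f].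
    exists f => //; by rewrite cube_chord // sI.
  have := at_free v vs nf; case: (boolP (next_edge s v \in cubeK I)) => m1.
    by move=> _; exists (next_edge s v) => //; apply: mem_next_edge.
  move/esym/negbFE => m2; exists (next_edge s (prev s v)) => //; exact: (mem_next_edge_prev hs).
have vs : v \in s.
  have [/sI|[x xs E]] := cube_cases IC eM.
    by rewrite inE => /andP[_ eK]; rewrite (ham_mem hs) (edge_vset eK).
  by move: ve; rewrite E !inE => /orP[] /eqP->; rewrite ?mem_next.
have [/exists_inP[g gI vg]|/exists_inPn nf] := boolP [exists g in I, v \in g].
  have [m1 m2 ug] := at_chord _ _ gI vs vg.
  have all_g h : h \in cubeK I -> v \in h -> h = g.
    move=> hM vh; case: (at_v h v hM vs vh) => [E|E|hI]; last exact: ug.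
      by rewrite E (negbTE m1) in hM.
    by rewrite E (negbTE m2) in hM.
  by rewrite (all_g e eM ve) (all_g f fM vf).
have fr := at_free v vs nf.
have noI h : h \in I -> v \in h -> False by move=> /nf /negP.
case: (at_v e v eM vs ve) => [E1|E1|/noI/(_ ve) //];
  case: (at_v f v fM vs vf) => [E2|E2|/noI/(_ vf) //]; rewrite ?E1 ?E2 //.
  by rewrite E1 in eM; rewrite E2 in fM; rewrite eM fM in fr.
by rewrite E1 in eM; rewrite E2 in fM; rewrite eM fM in fr.
Qed.

Lemma alternate_pm b' : perfect_matching K (alternate b').
Proof.
have kb x : x \in s -> (c (prev s x) == b') = (c x != b').
  by move=> xs; rewrite (color_prev hs cs xs); case: (c x); case: (b').
apply: pmI => [e /alternate_sub[x [xs _ ->]]|v|e f v].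
- exact: next_edge_edge.
- rewrite -(ham_mem hs) => vs; have [cv|cv] := boolP (c v == b').
    by exists (next_edge s v); rewrite ?next_edge_alternate ?mem_next_edge.
  exists (next_edge s (prev s v)); last exact: (mem_next_edge_prev hs).
  by rewrite next_edge_alternate ?mem_prev // kb.
- move=> /alternate_sub[x [xs cx ->]] /alternate_sub[y [ys cy ->]].
  rewrite !(mem_next_edgeE hs) // => /orP[] /eqP xv /orP[] /eqP yv; rewrite ?xv ?yv //.
    by have := kb x xs; rewrite {1}xv -yv cx cy eqxx.
  by have := kb y ys; rewrite {1}yv -xv cx cy eqxx.
Qed.

Lemma pm_no_chord M : perfect_matching K M -> {in Ch, forall e, e \notin M} ->
  M = alternate b \/ M = alternate (~~ b).
Proof.
move=> MK nc.
have nch b' e : e \in Ch -> (e \in M) = (e \in alternate b').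
  by move=> ec; rewrite (negbTE (nc _ ec)) (negbTE (chord_alternate b' ec)).
have [|flip] := pm_same_chords hs MK (alternate_pm b) (nch b); first by left.
right; apply: (pm_determined hs MK (alternate_pm _) (nch _)) => x xs.
by rewrite flip // !next_edge_alternate //; case: (c x); case: (b).
Qed.

Lemma disjoint_arcs_good : hereditarily_good (matchings K).
Proof.
apply: (@good_cube _ Ch (alternate b) (alternate (~~ b)) arc_edges).
- by move=> e; apply: chord_alternate.
- by move=> e; apply: chord_alternate.
- move=> e /alternate_sub[x [xs cx ->]]; rewrite next_edge_alternate // cx; by case: (b).
- move=> e f ec fc g /imsetP[x xA ->]; rewrite next_edge_arc // ?(arc_set_sub ec xA) //.
  exact: disj.
- move=> e ec; have [x [y [E xs ys cx cy]]] := chord_ends b ec.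
  exists (next_edge s x); first by rewrite next_edge_alternate ?cx.
  by rewrite next_edge_arc // arc_set_color // ?cx // E set21.
- by rewrite inE alternate_pm.
- by move=> I IC; rewrite inE cube_pm.
(* With the same chords, M either equals cube I or is complementary to it on the cycle edges.
   Complementarity fails at an end of a chord in I, where neither contains the next cycle edge; so
   in that case I is empty and M is one of the two alternating matchings. *)
- move=> M; rewrite inE => MK; pose I := M :&: Ch.
  have IC : I \subset Ch by apply: subsetIr.
  have same e : e \in Ch -> (e \in M) = (e \in cubeK I).
    by move=> ec; rewrite cube_chord // inE ec andbT.
  have [E|flip] := pm_same_chords hs MK (cube_pm IC) same.
    by right; exists I.
  have [I0|/set0Pn[e /setIP[eM ec]]] := eqVneq I set0.
    case: (pm_no_chord MK) => [e ec|E|E]; last by left.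
      by rewrite same // cube_chord // I0 inE.
    right; exists set0; first exact: sub0set.
    by rewrite cube0.
  have [x [y [E xs ys cx cy]]] := chord_ends b ec.
  have xe : x \in e by rewrite E set21.
  have [m1 _] := pm_chord hs MK xs ec xe eM.
  have eI : e \in cubeK I by rewrite -same.
  have [m2 _] := pm_chord hs (cube_pm IC) xs ec xe eI.
  by have := flip _ xs; rewrite (negbTE m1) m2.
- by move=> M M'; rewrite !inE => MK M'K; apply: pm_diff_ex MK M'K.
have [x xs] : exists x, x \in s.
  by case: hs => _; case: (s) => // x p _ _ _; exists x; rewrite inE eqxx.
apply/eqP => /setP/(_ (next_edge s x)); rewrite !next_edge_alternate //.
by case: (c x); case: (b).
Qed.

End Parallel.

Lemma arc_rot_split (T : eqType) (s : seq T) j a x p y q : uniq s ->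
  rot j s = a ++ x :: p ++ y :: q -> arc s x y = x :: p.
Proof.
move=> us E; have [k Ek] := rot_rot_ex (size a) j s.
have {}E : rot k s = x :: p ++ y :: (q ++ a) by rewrite -Ek E rot_size_cat /= -catA.
have xs : x \in s by rewrite -(mem_rot k) E inE eqxx.
by rewrite -(arc_rot k us xs) E left_arc // -E rot_uniq.
Qed.

(** * From parallel chords to disjoint arcs *)

Section ParallelGood.
Variables (T : finType) (K : graph T) (s : seq T) (c : T -> bool).
Implicit Types (e f g : {set T}) (x y v : T) (b : bool).
Hypothesis hs : hamilton_cycle K s.
Hypothesis cK : proper_coloring c (eset K).

Let us : uniq s. Proof. by case: hs. Qed.

Notation Ch := (chords K s).
Notation arc_set := (arc_set s c).
Notation D b e f := [disjoint arc_set b e & arc_set b f].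

Let cs : proper_coloring c (cycle_edges s).
Proof. by move=> x y xy xyC; apply: cK => //; case: hs => _ _ _ /subsetP; apply. Qed.

(** The arcs from x1 to x2 and from y1 to y2 are separate stretches of the cycle. The opposite arcs
    start at x2 and at y2, and the second one runs through x2. *)
Lemma order_disjoint j x1 p1 x2 p2 y1 p3 y2 p4 :
  rot j s = x1 :: p1 ++ x2 :: p2 ++ y1 :: p3 ++ y2 :: p4 ->
  c x1 != c x2 -> c y1 != c y2 -> c x1 = c y1 ->
  D (c x1) [set x1; x2] [set y1; y2] /\ ~~ D (~~ c x1) [set x1; x2] [set y1; y2].
Proof.
move=> E cx cy cxy.
have cx2 : c x2 = ~~ c x1 by move: cx; case: (c x1); case: (c x2).
have cy1 : c y1 = c x1 by [].
have cy2 : c y2 = ~~ c x1 by move: cy; rewrite cy1; case: (c x1); case: (c y2).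
have uE : uniq (x1 :: p1 ++ x2 :: p2 ++ y1 :: p3 ++ y2 :: p4) by rewrite -E rot_uniq.
have E2 : rot j s = (x1 :: p1 ++ x2 :: p2) ++ y1 :: p3 ++ y2 :: p4.
  by rewrite E /= -catA.
rewrite (arc_setE s erefl cx2) (arc_setE s cy1 cy2).
rewrite (@arc_rot_split _ s j [::] x1 p1 x2 _ us E) (arc_rot_split us E2).
split.
  rewrite -setI_eq0; apply/eqP/setP => v; rewrite !in_set; apply/negP => /andP[v1 v3].
  move: uE; rewrite -cat_cons cat_uniq => /and3P[_ /hasPn H _].
  have/H/negP[] // : v \in x2 :: p2 ++ y1 :: p3 ++ y2 :: p4.
  by move: v3; rewrite !(in_cons, mem_cat) => /orP[->|->]; rewrite !orbT.
have cx1 : c x1 = ~~ ~~ c x1 by rewrite negbK.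
have cy1' : c y1 = ~~ ~~ c x1 by rewrite negbK.
rewrite [[set x1; x2]]setUC (arc_setE s cx2 cx1) [[set y1; y2]]setUC (arc_setE s cy2 cy1').
rewrite -setI_eq0; apply/set0Pn; exists x2; rewrite !in_set.
have [k Ek] := rot_rot_ex (size (x1 :: p1)) j s.
have F1 : rot k s = x2 :: (p2 ++ y1 :: p3 ++ y2 :: p4) ++ x1 :: p1.
  by rewrite -Ek E -cat_cons rot_size_cat.
have [l El] := rot_rot_ex (size (x1 :: p1 ++ x2 :: p2 ++ y1 :: p3)) j s.
have F2 : rot l s = y2 :: (p4 ++ x1 :: p1 ++ x2 :: p2) ++ y1 :: p3.
  rewrite -El E; have -> : x1 :: p1 ++ x2 :: p2 ++ y1 :: p3 ++ y2 :: p4 =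
    (x1 :: p1 ++ x2 :: p2 ++ y1 :: p3) ++ y2 :: p4 by rewrite /= -!catA /= -catA.
  by rewrite rot_size_cat /= -!catA /= -!catA.
rewrite (@arc_rot_split _ s k [::] x2 _ x1 _ us F1).
rewrite (@arc_rot_split _ s l [::] y2 _ y1 _ us F2).
by rewrite !(inE, mem_cat) eqxx !orbT.
Qed.

Lemma parallel_disjoint (c0 : T -> bool) e f :
  proper_coloring c0 (cycle_edges s) -> e \in Ch -> f \in Ch -> parallel c0 s e f ->
  exists b, D b e f && ~~ D (~~ b) e f.
Proof.
move=> c0P ec fc [x1 [x2 [y1 [y2 [eE fE [_ _ cxy] ord]]]]].
(* The coloring c0 in which the chords are parallel may differ from c. Both alternate along the
   cycle, so they agree or are opposite on all of s, and equality of the colors of x1 and y1 carries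
   over. *)
have inv : {in s, forall x, c (next s x) (+) c0 (next s x) = c x (+) c0 x}.
  move=> x xs; rewrite (color_next hs cs xs) (color_next hs c0P xs).
  by case: (c x); case: (c0 x).
have ends g x y : g \in Ch -> g = [set x; y] -> [/\ x \in s, y \in s & c x != c y].
  rewrite inE => /andP[_ gK] gE; rewrite !(ham_mem hs).
  rewrite (edge_vset gK) ?gE ?set21 // (edge_vset gK) ?gE ?set22 //; split=> //.
  by apply: cK; rewrite -?gE //; apply: (@edge_neq _ K); rewrite -gE.
have [x1s x2s cx] := ends _ _ _ ec eE; have [y1s y2s cy] := ends _ _ _ fc fE.
have cxy' : c x1 = c y1.
  have := next_invariant us inv x1s y1s; rewrite cxy.
  by case: (c x1); case: (c y1); case: (c0 y1).
have [j [p1 [p2 [p3 [p4 [E|E]]]]]] := cyclic_order4 ord.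
  by exists (c x1); rewrite eE fE; apply/andP; exact: (order_disjoint E cx cy cxy').
have [||| d1 d2] := order_disjoint E.
- by rewrite eq_sym.
- by rewrite eq_sym.
- by move: cx cy cxy'; case: (c x1); case: (c x2); case: (c y1); case: (c y2).
exists (c y2); rewrite eE fE ![[disjoint arc_set _ [set x1; _] & _]]disjoint_sym.
by rewrite [[set x1; _]]setUC [[set y1; _]]setUC d1.
Qed.

(* If the arcs of e and f are disjoint for one color, the same color works for
   every pair: otherwise the arcs of e and g would cover s, and the arc of f
   would be empty or that of g would be all of s. *)
Lemma parallel_good (c0 : T -> bool) :
  proper_coloring c0 (cycle_edges s) ->
  {in Ch &, forall e f, e != f -> parallel c0 s e f} -> hereditarily_good (matchings K).
Proof.
move=> c0P par.
have pd e f : e \in Ch -> f \in Ch -> e != f -> exists b, D b e f && ~~ D (~~ b) e f.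
  by move=> ec fc ef; apply: parallel_disjoint c0P ec fc (par _ _ ec fc ef).
have Dcase b e f : e \in Ch -> f \in Ch -> e != f -> D b e f = ~~ D (~~ b) e f.
  move=> ec fc ef; have [b' /andP[d1 d2]] := pd _ _ ec fc ef.
  have [<-|bb] := eqVneq b' b; first by rewrite d1.
  have -> : b = ~~ b' by move: bb; case: (b); case: (b').
  by rewrite negbK d1 (negbTE d2).
have Dsym b e f : D b e f = D b f e by rewrite disjoint_sym.
have step b e f g : e \in Ch -> f \in Ch -> g \in Ch -> e != f -> e != g ->
    D b e f -> D b e g.
  move=> ec fc gc ef eg def; have [<- //|fg] := eqVneq f g.
  rewrite Dcase //; apply/negP => deg.
  have cover v : v \in s -> (v \in arc_set b e) || (v \in arc_set b g).
    move=> vs; apply: contraTT deg; rewrite negb_or => /andP[v1 v2].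
    rewrite -setI_eq0; apply/set0Pn; exists v.
    by rewrite in_setI !(arc_setC hs cK) // v1 v2.
  have sub_fg v : v \in arc_set b f -> v \in arc_set b g.
    move=> vf; have := cover v (arc_set_sub hs cK fc vf).
    by case/orP=> // ve; have /pred0P/(_ v) := def; rewrite /= ve vf.
  have [dfg|] := boolP (D b f g).
    have [x [y [E xs _ cx _]]] := chord_ends hs cK b fc.
    have xf : x \in arc_set b f by rewrite (arc_set_color hs cK) // ?cx // E set21.
    by have /pred0P/(_ x) := dfg; rewrite /= xf sub_fg.
  rewrite Dcase // negbK => dfg.
  have [x [y [E _ ys _ cy]]] := chord_ends hs cK b gc.
  have yg : y \notin arc_set b g.
    by rewrite (arc_set_color hs cK) // ?cy ?E ?set22 //; case: (b).
  have /pred0P/(_ y) := dfg; rewrite /= !(arc_setC hs cK) // yg andbT.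
  by move/negbFE/sub_fg; rewrite (negbTE yg).
have all_good b : {in Ch &, forall e f, e != f -> D b e f} -> hereditarily_good (matchings K).
  move=> all_d; apply: (@disjoint_arcs_good _ _ _ c hs cK b) => e f ec fc v ve vf.
  apply/eqP/negPn/negP => ef; have /pred0P/(_ v) := all_d _ _ ec fc ef.
  by rewrite /= ve vf.
have [/exists_inP[e ec /exists_inP[f fc /andP[ef def]]]|/exists_inPn no] :=
    boolP [exists e in Ch, exists f in Ch, (e != f) && D true e f].
  apply: (all_good true) => g h gc hc gh.
  have [eg|eg] := eqVneq e g; first by rewrite -eg; apply: (step _ e f); rewrite // eg.
  have deg := step _ _ _ _ ec fc gc ef eg def.
  have [<-|eh] := eqVneq e h; first by rewrite Dsym.
  by apply: (step _ g e h); rewrite // 1?eq_sym // Dsym.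
apply: (all_good false) => e f ec fc ef; rewrite Dcase //=.
by have := no _ ec => /exists_inPn/(_ _ fc); rewrite ef.
Qed.

End ParallelGood.

(** * The classes of the third statement are hereditarily good *)

Section Classes.
Variables (T : finType) (K : graph T) (c : T -> bool).
Hypothesis cK : proper_coloring c (eset K).

Lemma class_good : is_K2 K \/ [\/ in_B0 K, in_B1 K, in_B2 K | in_B3 K] ->
  hereditarily_good (matchings K).
Proof.
(* With at most one chord the condition on pairs is vacuous, so B_0 and B_1 are treated as cases of
   B_3. *)
have few s : hamilton_cycle K s -> #|chords K s| <= 1 -> hereditarily_good (matchings K).
  move=> hs c1; apply: (parallel_good hs cK (c0 := c)).
    by move=> x y xy xyC; apply: cK => //; case: hs => _ _ _ /subsetP; apply.
  move=> e f ec fc ef; move: c1; rewrite leqNgt => /negP[].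
  have <- : #|[set e; f]| = 2 by rewrite cards2 ef.
  by rewrite subset_leq_card // subUset !sub1set ec.
case=> [[x [y [xy _ EK]]]|[[s [hs _ c0]]|[_ [s [hs c1]]]|[s [c' [e [f [hs _ c'P [_ chE] sc]]]]]|]].
- move=> L U; set F := [set M in _ | _] => /set0Pn[M MF].
  suff -> : F = [set M] by apply: good1.
  have FE M' : M' \in F -> M' \subset [set [set x; y]].
    by rewrite !inE => /and3P[/andP[]]; rewrite EK.
  have F0 M' : M' \in F -> M' != set0.
    rewrite !inE => /and3P[M'K _ _]; have xK : x \in vset K.
      by apply: (@edge_vset _ _ [set x; y]); rewrite ?EK ?set11 ?set21.
    by have [e eM' _] := pm_ex M'K xK; apply/set0Pn; exists e.
  have FU M' : M' \in F -> M' = [set [set x; y]].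
    move=> M'F; have := FE _ M'F; rewrite subset1 (negbTE (F0 _ M'F)) orbF.
    by move/eqP.
  apply/setP => M'; rewrite [RHS]inE.
  by apply/idP/eqP => [/FU->|->//]; rewrite (FU _ MF).
- by apply: few hs _; rewrite c0 cards0.
- by apply: few hs _; rewrite c1.
- exact: (strongly_crossed_good hs c'P chE sc).
- by case=> _ [s [c0 [hs c0P par]]]; exact: (parallel_good hs cK c0P par).
Qed.

End Classes.

Lemma bipartite_elementary (T : finType) (G K : graph T) (c : T -> bool) :
  proper_coloring c (eset G) -> elementary_component K G -> proper_coloring c (eset K).
Proof.
move=> cG [x _ ->] u v uv; rewrite !inE => /andP[/andP[uvG _] _]; exact: cG.
Qed.

Theorem classes_strongly_uniform (T : finType) (G : graph T) :
  bipartite G ->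
  (forall K : graph T, elementary_component K G ->
     is_K2 K \/ [\/ in_B0 K, in_B1 K, in_B2 K | in_B3 K]) -> strongly_uniform G.
Proof.
move=> [c cG] cl; apply: strongly_uniformI => K KG.
exact: class_good (bipartite_elementary cG KG) (cl K KG).
Qed.

(** * Perfect matchings of bisubdivisions *)

Section PathEdge.
Variables (T : finType) (d : T).
Implicit Types (q : seq T) (v : T).

Definition nth_edge q k : {set T} := [set nth d q k; nth d q k.+1].

Lemma path_edges_nth q g :
  reflect (exists2 k, k.+1 < size q & g = nth_edge q k) (g \in path_edges q).
Proof.
apply: (iffP (path_edgesP _ _)) => [[a [x [y [b [-> ->]]]]]|[k kq ->]].
  exists (size a); first by rewrite size_cat /= !addnS !ltnS leq_addr.
  by rewrite /nth_edge !nth_cat ltnn subnn ltnNge leqnSn /= subSnn.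
exists (take k q), (nth d q k), (nth d q k.+1), (drop k.+2 q); split=> //.
by rewrite -[LHS](cat_take_drop k) (drop_nth d) ?(ltnW kq) // (drop_nth d kq).
Qed.

Lemma mem_nth_edge q k i : uniq q -> k.+1 < size q -> i < size q ->
  (nth d q i \in nth_edge q k) = (i == k) || (i == k.+1).
Proof. by move=> uq kq iq; rewrite !inE !nth_uniq // ltnW. Qed.

Lemma nth_edge_inj q k l : uniq q -> k.+1 < size q -> l.+1 < size q ->
  nth_edge q k = nth_edge q l -> k = l.
Proof.
move=> uq kq lq E.
have := mem_nth_edge uq lq (ltnW kq); rewrite -E !inE eqxx /= => /esym/orP[/eqP //|/eqP k1].
have := mem_nth_edge uq lq kq; rewrite -E !inE eqxx orbT k1 => /esym.
by rewrite gtn_eqF ?leqnSn // eqSS gtn_eqF.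
Qed.

End PathEdge.

Section Bisubdivision.
Variables (U T : finType) (J : graph U) (H : graph T) (h : U -> T) (P : {set U} -> seq T).
Variable d : T.
Implicit Types (e f : {set U}) (g : {set T}) (N : {set {set U}}) (M S : {set {set T}}).
Hypothesis h_inj : {in vset J &, injective h}.
Hypothesis P_odd : {in eset J, forall e, odd_path (P e) (h @: e)}.
Hypothesis P_int : {in eset J, forall e x, x \in P e -> x \notin h @: e ->
  x \notin h @: vset J /\ {in eset J, forall f, e != f -> x \notin P f}}.
Hypothesis HV : vset H = h @: vset J :|: \bigcup_(e in eset J) [set:: P e].
Hypothesis HE : eset H = \bigcup_(e in eset J) path_edges (P e).

Notation nth_edge := (nth_edge d).

Lemma bisub_path e : e \in eset J ->
  [/\ uniq (P e), odd (size (P e)).-1, 1 < size (P e)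
    & h @: e = [set nth d (P e) 0; nth d (P e) (size (P e)).-1]].
Proof.
case/P_odd=> uP [x [p [E op <-]]]; rewrite E in uP *; split=> //.
  by rewrite ltnS; case: (p) op.
by rewrite /= (set_nth_default x) // nth_last.
Qed.

Lemma bisub_edge_inj e f : e \in eset J -> f \in eset J -> h @: e = h @: f -> e = f.
Proof.
move=> eJ fJ E; apply/setP => u.
have sub e1 e2 : e1 \in eset J -> e2 \in eset J -> h @: e1 = h @: e2 -> u \in e1 -> u \in e2.
  move=> e1J e2J E1 ue1; have : h u \in h @: e2 by rewrite -E1 imset_f.
  case/imsetP=> w we2 /h_inj -> //; first exact: edge_vset ue1.
  exact: edge_vset we2.
by apply/idP/idP; apply: sub.
Qed.

Lemma bisub_shared e f x : e \in eset J -> f \in eset J -> e != f ->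
  x \in P e -> x \in P f -> x \in h @: e.
Proof.
move=> eJ fJ ef xe xf; apply: contraTT xf => xh.
by have [_] := P_int eJ xe xh; apply.
Qed.

(** Distinct paths share only end vertices, so both ends of a common edge would be the ends of both
    paths; then h maps e and f to the same set, and h is injective. *)
Lemma bisub_shared_edge e f g : e \in eset J -> f \in eset J ->
  g \in path_edges (P e) -> g \in path_edges (P f) -> e = f.
Proof.
move=> eJ fJ ge gf; apply/eqP/negPn/negP => ef.
have gH : g \in eset H by rewrite HE; apply/bigcupP; exists e.
have [a [b [ab E _ _]]] := edgeP gH.
have fe : f != e by rewrite eq_sym.
have sub e1 e2 : e1 \in eset J -> e2 \in eset J -> e1 != e2 ->
    g \in path_edges (P e1) -> g \in path_edges (P e2) -> h @: e1 = g.
  move=> e1J e2J e12 g1 g2; apply/esym/eqP; rewrite eqEcard; apply/andP; split.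
    apply/subsetP => x xg.
    by apply: (bisub_shared e1J e2J e12); apply: path_edges_mem xg.
  have [_ _ _ ->] := bisub_path e1J; rewrite cards2 E cards2 ab.
  by case: (_ != _).
apply: (elimN eqP ef); apply: bisub_edge_inj => //.
by rewrite (sub _ _ eJ fJ ef) // (sub _ _ fJ eJ fe).
Qed.

Lemma bisub_vertex e u : e \in eset J -> u \in vset J -> h u \in P e -> u \in e.
Proof.
move=> eJ uJ uP; have [/imsetP[w we /h_inj E]|nh] := boolP (h u \in h @: e).
  by rewrite E // (edge_vset eJ).
by have [/negP[]] := P_int eJ uP nh; apply: imset_f.
Qed.

Lemma bisub_end e u : e \in eset J -> u \in e ->
  h u = nth d (P e) 0 \/ h u = nth d (P e) (size (P e)).-1.
Proof.
move=> eJ ue; have [_ _ _ E] := bisub_path eJ.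
have : h u \in h @: e by apply: imset_f.
by rewrite E !inE => /orP[] /eqP; [left|right].
Qed.

Lemma bisub_edgeP g : reflect
  (exists e k, [/\ e \in eset J, k.+1 < size (P e) & g = nth_edge (P e) k])
  (g \in eset H).
Proof.
rewrite HE; apply: (iffP bigcupP) => [[e eJ /(path_edges_nth d)[k kP E]]|].
  by exists e, k.
by case=> e [k [eJ kP E]]; exists e => //; apply/(path_edges_nth d); exists k.
Qed.

(** A matching alternates along each path of odd length, so its first edge decides whether the edge
    of J is used. *)
Definition contraction M : {set {set U}} := [set e in eset J | nth_edge (P e) 0 \in M].

(** An inner vertex of a path meets only the two path edges at it, and exactly one of these is in
    M. *)
Lemma bisub_alternates M e k : perfect_matching H M -> e \in eset J ->
  k.+1 < size (P e) -> (nth_edge (P e) k \in M) = (e \in contraction M) (+) odd k.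
Proof.
move=> MH eJ; have [uP oP sP hE] := bisub_path eJ; rewrite inE eJ /=.
elim: k => [|k IH] kP; first by rewrite addbF.
rewrite /= addbN -IH 1?ltnW //.
have vP : nth d (P e) k.+1 \in P e by rewrite mem_nth // ltnW.
have vh : nth d (P e) k.+1 \notin h @: e.
  have s0 : 0 < size (P e) by apply: ltnW.
  have s1 : (size (P e)).-1 < size (P e) by rewrite prednK.
  rewrite hE !inE !nth_uniq // 1?ltnW //= ltn_eqF //.
  by rewrite -ltnS prednK // ltnW.
have [_ nP] := P_int eJ vP vh.
have vH : nth d (P e) k.+1 \in vset H.
  by rewrite HV inE; apply/orP; right; apply/bigcupP; exists e; rewrite ?inE.
have vk : nth d (P e) k.+1 \in nth_edge (P e) k by rewrite /nth_edge set22.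
have vk1 : nth d (P e) k.+1 \in nth_edge (P e) k.+1 by rewrite /nth_edge set21.
apply/idP/idP => [m1|m0].
  apply/negP => m0; have := pm_uniq MH m1 m0 vk1 vk.
  move/(nth_edge_inj uP kP (ltnW kP))/eqP; by rewrite gtn_eqF.
have [g gM vg] := pm_ex MH vH.
have [f [l [fJ lP E]]] := elimT (bisub_edgeP g) (pm_sub MH gM).
have vf : nth d (P e) k.+1 \in P f.
  by apply: (path_edges_mem (e := g)) vg; apply/(path_edges_nth d); exists l.
have ef : e = f by apply/eqP/negPn/negP => /(nP _ fJ); rewrite vf.
rewrite -ef in lP E; move: vg; rewrite E mem_nth_edge // 1?ltnW //.
case/orP=> /eqP E1; first by rewrite E1 -E.
by case: E1 => E1; move: m0; rewrite E1 -E gM.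
Qed.

Lemma bisub_end_edge M e u : perfect_matching H M -> e \in contraction M -> u \in e ->
  exists2 k, k.+1 < size (P e) & h u \in nth_edge (P e) k /\ nth_edge (P e) k \in M.
Proof.
move=> MH eM ue; have eJ : e \in eset J by move: eM; rewrite inE => /andP[].
have [uP oP sP _] := bisub_path eJ.
have [->|->] := bisub_end eJ ue.
  by exists 0 => //; rewrite /nth_edge set21 bisub_alternates // eM.
have k1 : (size (P e)).-2.+1 = (size (P e)).-1 by rewrite prednK // -subn1 subn_gt0.
have s1 : (size (P e)).-1 < size (P e) by rewrite prednK // ltnW.
exists (size (P e)).-2; first by rewrite k1.
split; first by rewrite /nth_edge k1 set22.
rewrite bisub_alternates ?k1 // eM.
by move: oP; rewrite -k1 /= => /negbTE->.
Qed.

(** An end of the path lies only on the edge of index 0 or on the last one, of index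
    [(size (P e)).-2]. The number of vertices is even, so both indices are even. *)
Lemma bisub_end_even e u k : e \in eset J -> u \in e ->
  k.+1 < size (P e) -> h u \in nth_edge (P e) k -> odd k = false.
Proof.
move=> eJ ue kP uk; have [uP oP sP _] := bisub_path eJ.
have s0 : 0 < size (P e) by apply: ltnW.
have s1 : (size (P e)).-1 < size (P e) by rewrite prednK.
have [E|E] := bisub_end eJ ue; move: uk; rewrite E mem_nth_edge //.
  by rewrite orbF => /eqP <-.
case/orP=> /eqP E1; first by move: kP; rewrite -E1 prednK ?ltnn.
by move: oP; rewrite E1 /= => /negbTE.
Qed.

Lemma bisub_end_index M e u k : perfect_matching H M -> e \in eset J -> u \in e ->
  k.+1 < size (P e) -> h u \in nth_edge (P e) k -> nth_edge (P e) k \in M -> e \in contraction M.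
Proof.
move=> MH eJ ue kP uk; rewrite bisub_alternates //.
have [uP oP sP _] := bisub_path eJ.
suff -> : odd k = false by rewrite addbF.
exact: bisub_end_even ue kP uk.
Qed.

Lemma contraction_pm M : perfect_matching H M -> perfect_matching J (contraction M).
Proof.
move=> MH; apply: pmI => [e|u uJ|e f u eM fM ue uf].
- by rewrite inE => /andP[].
- have uH : h u \in vset H by rewrite HV inE imset_f.
  have [g gM ug] := pm_ex MH uH.
  have [e [k [eJ kP E]]] := elimT (bisub_edgeP g) (pm_sub MH gM).
  have ue : u \in e.
    apply: bisub_vertex => //; apply: path_edges_mem ug.
    by apply/(path_edges_nth d); exists k.
  exists e => //; apply: (bisub_end_index MH eJ ue kP); rewrite -E //.
have eJ : e \in eset J by move: eM; rewrite inE => /andP[].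
have fJ : f \in eset J by move: fM; rewrite inE => /andP[].
have [k kP [uk kM]] := bisub_end_edge MH eM ue.
have [l lP [ul lM]] := bisub_end_edge MH fM uf.
have E := pm_uniq MH kM lM uk ul.
apply: (bisub_shared_edge (g := nth_edge (P e) k) eJ fJ).
  by apply/(path_edges_nth d); exists k.
by rewrite E; apply/(path_edges_nth d); exists l.
Qed.

Lemma contraction_inj M M' : perfect_matching H M -> perfect_matching H M' ->
  contraction M = contraction M' -> M = M'.
Proof.
move=> MH M'H E; apply/setP => g; apply/idP/idP => gM.
  have [e [k [eJ kP gE]]] := elimT (bisub_edgeP g) (pm_sub MH gM).
  by move: gM; rewrite gE !bisub_alternates // E.
have [e [k [eJ kP gE]]] := elimT (bisub_edgeP g) (pm_sub M'H gM).
by move: gM; rewrite gE !bisub_alternates // E.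
Qed.

(** The preimage takes the edges of even index on the paths of N and those of odd index on the other
    paths: the former cover both ends of the path, the latter only its inner vertices. *)
Lemma contraction_onto N : perfect_matching J N ->
  exists2 M, perfect_matching H M & contraction M = N.
Proof.
move=> NJ; pose M := [set g in eset H | [exists e in eset J,
  [exists k : 'I_(size (P e)), [&& k.+1 < size (P e), g == nth_edge (P e) k &
     (e \in N) (+) odd k]]]].
have MP g : reflect (exists e k, [/\ e \in eset J, k.+1 < size (P e),
    g = nth_edge (P e) k & (e \in N) (+) odd k]) (g \in M).
  rewrite inE; apply: (iffP andP) => [[_ /exists_inP[e eJ /existsP[k /and3P[kP /eqP gE o]]]]|].
    by exists e, k.
  case=> e [k [eJ kP gE o]]; split; first by apply/bisub_edgeP; exists e, k.
  apply/exists_inP; exists e => //; apply/existsP; exists (Ordinal (ltnW kP)).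
  by rewrite kP gE eqxx.
have cov_end u : u \in vset J -> exists2 g, g \in M & h u \in g.
  move=> uJ; have [e eN ue] := pm_ex NJ uJ; have eJ := pm_sub NJ eN.
  have [uP oP sP _] := bisub_path eJ; have [->|->] := bisub_end eJ ue.
    exists (nth_edge (P e) 0); last by rewrite /nth_edge set21.
    by apply/MP; exists e, 0; rewrite eN.
  have k1 : (size (P e)).-2.+1 = (size (P e)).-1 by rewrite prednK // -subn1 subn_gt0.
  have s1 : (size (P e)).-1 < size (P e) by rewrite prednK // ltnW.
  exists (nth_edge (P e) (size (P e)).-2); last by rewrite /nth_edge k1 set22.
  apply/MP; exists e, (size (P e)).-2; rewrite k1; split=> //.
  by move: oP; rewrite -k1 /= eN => /negbTE->.
have MH : perfect_matching H M.
  apply: pmI => [g|x|g g' x].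
  - by rewrite inE => /andP[].
  - rewrite HV inE => /orP[/imsetP[u uJ ->]|/bigcupP[e eJ]]; first exact: cov_end.
    rewrite inE => xP; have [uP oP sP hE] := bisub_path eJ.
    have [/imsetP[u ue ->]|xh] := boolP (x \in h @: e).
      by apply: cov_end; apply: edge_vset ue.
    have xE : nth d (P e) (index x (P e)) = x by rewrite nth_index.
    set i := index x (P e) in xE; have iP : i < size (P e) by rewrite index_mem.
    have i0 : 0 < i.
      by rewrite lt0n; apply: contraNneq xh => i0; rewrite hE -xE i0 set21.
    have in1 : i.+1 < size (P e).
      rewrite -ltn_predRL ltn_neqAle -ltnS prednK ?(ltnW sP) // iP andbT.
      by apply: contraNneq xh => i0'; rewrite hE -xE i0' set22.
    have [o|o] := boolP ((e \in N) (+) odd i).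
      exists (nth_edge (P e) i); last by rewrite /nth_edge xE set21.
      by apply/MP; exists e, i.
    exists (nth_edge (P e) i.-1); last by rewrite /nth_edge prednK // xE set22.
    apply/MP; exists e, i.-1; rewrite prednK //; split=> //.
    by move: o; rewrite -{1}(prednK i0) /= addbN negbK.
  - case/MP=> e [k [eJ kP -> ok]] /MP[f [l [fJ lP -> ol]]] xk xl.
    have [uP oP sP hE] := bisub_path eJ.
    have xe : x \in P e.
      by apply: path_edges_mem xk; apply/(path_edges_nth d); exists k.
    have xf : x \in P f.
      by apply: path_edges_mem xl; apply/(path_edges_nth d); exists l.
    have [ef|ef] := eqVneq e f.
      rewrite -ef in lP ol xl *; suff -> : k = l by [].
      have iP : index x (P e) < size (P e) by rewrite index_mem.
      have kl : odd k = odd l by move: ok ol; case: (e \in N); case: (odd k); case: (odd l).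
      have := mem_nth_edge d uP kP iP; have := mem_nth_edge d uP lP iP.
      rewrite nth_index // xk xl => /esym/orP[] /eqP-> /esym/orP[] /eqP E //.
      * by move: kl; rewrite E /=; case: (odd k).
      * by move: kl; rewrite -E /=; case: (odd l).
      * by case: E.
    have := bisub_shared eJ fJ ef xe xf => /imsetP[u ue xE].
    have uJ : u \in vset J by apply: edge_vset ue.
    have uf : u \in f by apply: bisub_vertex => //; rewrite -xE.
    rewrite xE in xk xl; rewrite (bisub_end_even eJ ue kP xk) addbF in ok.
    rewrite (bisub_end_even fJ uf lP xl) addbF in ol.
    by rewrite (pm_uniq NJ ok ol ue uf) eqxx in ef.
exists M => //; apply/esym/(pm_subset_eq NJ (contraction_pm MH)).
apply/subsetP => e eN; have eJ := pm_sub NJ eN.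
have [_ _ sP _] := bisub_path eJ.
by rewrite inE eJ; apply/MP; exists e, 0; rewrite eN.
Qed.

(** A separating set of H yields one of J that is not larger: the edges whose paths it meets, since
    one bit determines a matching on a whole path. Conversely, the first edges of the paths turn an
    anti-forcing set of J into one of H. *)
Lemma bad_bisub : bad (matchings J) -> bad (matchings H).
Proof.
case=> n [lo up]; exists n; split=> [S sS|M].
  pose ES e := S :&: path_edges (P e).
  pose S' := [set e in eset J | ES e != set0].
  (* A representative of S on the path of e. Distinct paths have no common edge, so w is injective
     on S' and S' is no larger than S. *)
  pose w e := odflt set0 [pick g in ES e].
  have wP e : e \in S' -> w e \in S /\ w e \in path_edges (P e).
    rewrite inE => /andP[_ /set0Pn[g gE]]; rewrite /w; case: pickP => [g'|/(_ g)].
      by rewrite inE => /andP.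
    by rewrite gE.
  have S'J e : e \in S' -> e \in eset J by rewrite inE => /andP[].
  have w_inj : {in S' &, injective w}.
    move=> e f eS fS E; have [_ we] := wP _ eS; have [_ wf] := wP _ fS.
    by apply: (bisub_shared_edge (g := w e)); rewrite ?S'J // E.
  have S'S : #|S'| <= #|S|.
    rewrite -(card_in_imset w_inj) subset_leq_card //.
    by apply/subsetP => _ /imsetP[e /wP[wS _] ->].
  apply: leq_trans S'S; apply: lo => N N'; rewrite !inE => NJ N'J E.
  have [M MH MN] := contraction_onto NJ; have [M' M'H M'N'] := contraction_onto N'J.
  rewrite -MN -M'N'; congr contraction; apply: sS; rewrite ?inE //.
  apply/setP => g; rewrite !inE; case gS: (g \in S) => //=.
  have [gH|gH] := boolP (g \in eset H); last first.
    by apply/idP/idP => /pm_sub => [/(_ _ MH)|/(_ _ M'H)]; rewrite (negbTE gH).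
  have [e [k [eJ kP gE]]] := elimT (bisub_edgeP g) gH.
  have eS : e \in S'.
    rewrite inE eJ; apply/set0Pn; exists g; rewrite inE gS.
    by apply/(path_edges_nth d); exists k.
  rewrite gE !bisub_alternates // MN M'N'.
  by move/setP/(_ e): E; rewrite !in_setI eS /= => ->.
rewrite inE => MH; have [|S [SN aS] Sn] := up (contraction M); first by rewrite inE contraction_pm.
exists [set nth_edge (P e) 0 | e in S :&: eset J]; last first.
  apply: leq_trans (leq_imset_card _ _) _; apply: leq_trans Sn.
  exact: subset_leq_card (subsetIl _ _).
apply: antiI => [_ /imsetP[e /setIP[eS eJ] ->]|M'].
  by apply/negP => eM; move/setP/(_ e): SN; rewrite !inE eS eJ eM.
rewrite inE => M'H ne; have /set0Pn[e] : S :&: contraction M' != set0.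
  apply: contra ne => /eqP E; apply/eqP/contraction_inj => //; apply: aS => //.
  by rewrite inE contraction_pm.
rewrite !inE => /and3P[eS eJ eM']; exists (nth_edge (P e) 0) => //.
by apply: imset_f; rewrite inE eS.
Qed.

End Bisubdivision.

Lemma bad_conformal_minor (U T : finType) (J : graph U) (G : graph T) (u0 : U) :
  matchable J -> bad (matchings J) -> strongly_uniform G -> ~ conformal_minor J G.
Proof.
move=> /matchableP[N NJ] bJ uG [H HG [h [P [h_inj P_odd P_int HV HE]]]].
apply: (bad_gf_Af (bad_bisub (h u0) h_inj P_odd P_int HV HE bJ)).
apply: uG => //; apply/matchableP.
by have [M MH _] := contraction_onto (h u0) h_inj P_odd P_int HV HE NJ; exists M.
Qed.

(** * Computing with the four small graphs *)

Fixpoint all_bits n : seq bitseq :=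
  if n is n'.+1 then map (cons true) (all_bits n') ++ map (cons false) (all_bits n')
  else [:: [::]].

Lemma mem_all_bits n (bs : bitseq) : (bs \in all_bits n) = (size bs == n).
Proof.
elim: n bs => [|n IH] [|b bs] //=; rewrite mem_cat.
  by apply/orP => -[] /mapP[].
have inj x : injective (cons x : bitseq -> bitseq) by move=> ? ? [].
rewrite eqSS -IH; case: b; rewrite (mem_map (inj _)).
  by apply: orb_idr => /mapP[].
by apply: orb_idl => /mapP[].
Qed.

Definition meet_bits (a b : bitseq) : bitseq := [seq p.1 && p.2 | p <- zip a b].

Lemma nth_meet a b i : size a = size b ->
  nth false (meet_bits a b) i = nth false a i && nth false b i.
Proof.
move=> ab; have [ia|ia] := ltnP i (size a); last first.
  by rewrite !nth_default // ?size_map ?size_zip -?ab ?minnn.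
by rewrite (nth_map (false, false)) ?nth_zip //= size_zip -ab minnn.
Qed.

Lemma has_bitP (a : bitseq) : reflect (exists i, nth false a i) (has id a).
Proof.
apply: (iffP (has_nthP false)) => [[i _ ai]|[i ai]]; exists i => //.
by rewrite ltnNge; apply: contraL ai => /(nth_default false) ->.
Qed.

Section FiniteCheck.
Variables (U : finType) (el : seq (U * U)) (vs : seq U).

Definition incident (u : U) (a : U * U) := (u == a.1) || (u == a.2).

Definition valid_bits (bs : bitseq) :=
  all (fun u => count (fun p => p.1 && incident u p.2) (zip bs el) == 1) vs.

Definition pm_bits := [seq bs <- all_bits (size el) | valid_bits bs].

Definition simple_list := pairwise (fun a b : U * U =>
  ~~ ((a.1 == b.1) && (a.2 == b.2) || (a.1 == b.2) && (a.2 == b.1))) el.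

(** Edge sets are bit masks along [el], which makes the condition decidable by evaluation. Every
    mask of weight at most k leaves two perfect matchings undistinguished, hence gf > k. *)
Definition separation_check k := let L := pm_bits in
  all (fun mk => (count id mk <= k) ==>
    has (fun a => has (fun b => (a != b) && (meet_bits mk a == meet_bits mk b)) L) L)
  (all_bits (size el)).

(** Each perfect matching has a mask of weight at most k that avoids it and meets all others, hence
    Af <= k. *)
Definition antiforcing_check k := let L := pm_bits in
  all (fun a => has (fun mk =>
    [&& count id mk <= k, ~~ has id (meet_bits mk a)
      & all (fun b => (b == a) || has id (meet_bits mk b)) L]) (all_bits (size el))) L.

Definition edge_list : seq {set U} := [seq [set a.1; a.2] | a <- el].
Notation es := edge_list.

Lemma edge_list_uniq : simple_list -> uniq es.
Proof.
rewrite uniq_pairwise pairwise_map; apply: sub_pairwise => a b /= ne.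
apply: contraNneq ne => E.
have : a.1 \in [set b.1; b.2] by rewrite -E set21.
have : a.2 \in [set b.1; b.2] by rewrite -E set22.
have : b.1 \in [set a.1; a.2] by rewrite E set21.
have : b.2 \in [set a.1; a.2] by rewrite E set22.
rewrite !inE ![b.1 == _]eq_sym ![b.2 == _]eq_sym.
by case: (a.1 == b.1); case: (a.1 == b.2); case: (a.2 == b.1); case: (a.2 == b.2).
Qed.

Variable J : graph U.
Implicit Types (e f : {set U}) (N S : {set {set U}}).
Hypothesis es_uniq : uniq es.
Hypothesis J_vset : vset J = [set: U].
Hypothesis J_eset : eset J = [set:: es].
Hypothesis vs_all : forall u, u \in vs.

Definition bits_of (N : {set {set U}}) : bitseq := [seq e \in N | e <- es].
Definition set_of (bs : bitseq) : {set {set U}} :=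
  [set e in es | nth false bs (index e es)].

Lemma mem_es e : (e \in eset J) = (e \in es). Proof. by rewrite J_eset inE. Qed.

Lemma size_es : size es = size el. Proof. exact: size_map. Qed.

Lemma size_bits_of N : size (bits_of N) = size el.
Proof. by rewrite size_map size_es. Qed.

Lemma nth_bits_of N e : e \in es -> nth false (bits_of N) (index e es) = (e \in N).
Proof. by move=> ee; rewrite (nth_map set0) ?index_mem // nth_index. Qed.

Lemma set_ofK bs : size bs = size el -> bits_of (set_of bs) = bs.
Proof.
move=> sb; apply: (@eq_from_nth _ false) => [|i]; rewrite size_bits_of // => iE.
rewrite (nth_map set0) ?size_es // inE mem_nth ?size_es //.
by rewrite index_uniq // size_es.
Qed.

Lemma bits_ofK N : {subset N <= es} -> set_of (bits_of N) = N.
Proof.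
move=> NE; apply/setP => e; rewrite inE.
have [ee|ee] := boolP (e \in es); first by rewrite nth_bits_of.
by apply/esym/negbTE; apply: contra ee => /NE.
Qed.

Lemma valid_count N u :
  count (fun p => p.1 && incident u p.2) (zip (bits_of N) el) =
  count (fun e : {set U} => (e \in N) && (u \in e)) es.
Proof.
rewrite /bits_of /es -map_comp count_map.
elim: (el) => //= a l IH; rewrite IH; congr (_ + _).
by rewrite /incident !inE.
Qed.

Lemma valid_pm N : perfect_matching J N <-> {subset N <= es} /\ valid_bits (bits_of N).
Proof.
have count1 u : count (fun e : {set U} => (e \in N) && (u \in e)) es == 1 <->
    exists e, [/\ e \in es, (e \in N) && (u \in e) &
       forall f, f \in es -> (f \in N) && (u \in f) -> f = e].
  rewrite -size_filter; split=> [|[e [e1 e2 e3]]].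
    case E: (filter _ _) => [|e [|? ?]] // _; exists e.
    have := mem_head e [::]; rewrite -E mem_filter => /andP[e2 e1].
    split=> // f f1 f2; have : f \in [:: e] by rewrite -E mem_filter f1 f2.
    by rewrite inE => /eqP.
  suff /perm_size -> : perm_eq (filter (fun f : {set U} => (f \in N) && (u \in f)) es) [:: e] by [].
  apply: uniq_perm; rewrite ?filter_uniq // => f; rewrite mem_filter inE.
  by apply/andP/eqP => [[f2 f1]|->]; [apply: e3|].
split=> [NJ|[NE /allP val]].
  have NE : {subset N <= es} by move=> e eN; rewrite -mem_es (pm_sub NJ).
  split=> //; apply/allP => u _; rewrite valid_count; apply/count1.
  have [|e eN ue] := @pm_ex _ _ _ u NJ; first by rewrite J_vset inE.
  exists e; rewrite eN ue NE //; split=> // f _ /andP[fN uf].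
  exact: (pm_uniq NJ fN eN uf ue).
apply: pmI => [e /NE|u _|e f u eN fN ue uf]; first by rewrite mem_es.
  have := val _ (vs_all u); rewrite valid_count => /count1[e [_ /andP[eN ue] _]].
  by exists e.
have := val _ (vs_all u); rewrite valid_count => /count1[g [_ _ ug]].
by rewrite (ug e) ?NE ?eN // (ug f _) ?fN ?NE.
Qed.

Lemma pm_bits_of N : perfect_matching J N -> bits_of N \in pm_bits.
Proof. by move=> /valid_pm[_ v]; rewrite mem_filter v mem_all_bits size_bits_of eqxx. Qed.

Lemma pm_set_of bs : bs \in pm_bits -> size bs = size el /\ perfect_matching J (set_of bs).
Proof.
rewrite mem_filter mem_all_bits => /andP[v /eqP sb]; split=> //; apply/valid_pm.
by rewrite set_ofK //; split=> // e; rewrite inE => /andP[].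
Qed.

Lemma bits_of_meet S N e : e \in es ->
  nth false (meet_bits (bits_of S) (bits_of N)) (index e es) = (e \in S) && (e \in N).
Proof. by move=> ee; rewrite nth_meet ?size_bits_of // !nth_bits_of. Qed.

Lemma count_bits_of S : count id (bits_of S) = #|S :&: [set:: es]|.
Proof.
rewrite count_map -size_filter -(card_uniqP (filter_uniq _ es_uniq)).
by apply: eq_card => e; rewrite !inE mem_filter.
Qed.

Lemma bad_check k : separation_check k -> antiforcing_check k -> bad (matchings J).
Proof.
move=> /allP sep /allP ant; exists k; split=> [S sS|N].
  rewrite ltnNge; apply/negP => Sk.
  have /sep/implyP : bits_of S \in all_bits (size el).
    by rewrite mem_all_bits size_bits_of.
  case/(_ _)/hasP.
    by rewrite count_bits_of; apply: leq_trans Sk; rewrite subset_leq_card ?subsetIl.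
  move=> a /pm_set_of[sa aJ] /hasP[b /pm_set_of[sb bJ] /andP[/eqP ab /eqP E]].
  apply: ab; rewrite -(set_ofK sa) -(set_ofK sb); congr bits_of.
  apply: sS; rewrite ?inE //; apply/setP => e; rewrite !in_setI.
  have [ee|ee] := boolP (e \in es); last by rewrite !inE (negbTE ee).
  by rewrite -!bits_of_meet // !set_ofK // E.
rewrite inE => NJ; have /ant/hasP[mk] := pm_bits_of NJ.
rewrite mem_all_bits => /eqP smk /and3P[ck na /allP hit].
exists (set_of mk).
  apply: antiI => [e|N'].
    rewrite inE => /andP[ee em]; apply: contra na => eN; apply/has_bitP.
    by exists (index e es); rewrite nth_meet ?size_bits_of // em nth_bits_of.
  rewrite inE => N'J ne; have /orP[/eqP E|/has_bitP[i]] := hit _ (pm_bits_of N'J).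
    have [[NE _] [N'E _]] := (iffLR (valid_pm N) NJ, iffLR (valid_pm N') N'J).
    by rewrite -(bits_ofK NE) -E bits_ofK ?eqxx in ne.
  rewrite nth_meet ?size_bits_of // => /andP[mi Ni].
  have iE : i < size es.
    by rewrite size_es -smk ltnNge; apply: contraL mi => /(nth_default false)->.
  exists (nth set0 es i); first by rewrite inE mem_nth // index_uniq.
  by move: Ni; rewrite (nth_map set0).
rewrite -[mk](set_ofK smk) count_bits_of in ck; apply: leq_trans ck.
by apply: subset_leq_card; apply/subsetP => e; rewrite !inE => /andP[-> ->].
Qed.

Lemma matchable_check : 0 < size pm_bits -> matchable J.
Proof.
case E: pm_bits => [|bs l] // _; have : bs \in pm_bits by rewrite E mem_head.
by case/pm_set_of=> _ bJ; apply/matchableP; exists (set_of bs).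
Qed.

End FiniteCheck.

Lemma rel_graph_edge_list (U : finType) (r : rel U) (el : seq (U * U)) (vs : seq U) :
  (forall u, u \in vs) ->
  all (fun p => (p.1 != p.2) && r p.1 p.2) el ->
  all (fun u => all (fun v => ((u != v) && r u v) ==>
     (((u, v) \in el) || ((v, u) \in el))) vs) vs ->
  eset (rel_graph r) = [set:: edge_list el].
Proof.
move=> vs_all /allP el_r /allP r_el.
apply/setP => e; rewrite inE; apply/imsetP/mapP => [[[u v]]|[p pe ->]].
  rewrite inE /= => uvr ->; have /allP/(_ v (vs_all v)) := r_el u (vs_all u).
  rewrite uvr /= => /orP[] uv; first by exists (u, v).
  by exists (v, u); rewrite // setUC.
by exists p; rewrite // inE el_r.
Qed.

Lemma bad_rel_graph (U : finType) (r : rel U) (el : seq (U * U)) (vs : seq U) k :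
  (forall u, u \in vs) ->
  all (fun p => (p.1 != p.2) && r p.1 p.2) el ->
  all (fun u => all (fun v => ((u != v) && r u v) ==>
     (((u, v) \in el) || ((v, u) \in el))) vs) vs ->
  simple_list el -> 0 < size (pm_bits el vs) ->
  separation_check el vs k -> antiforcing_check el vs k ->
  matchable (rel_graph r) /\ bad (matchings (rel_graph r)).
Proof.
move=> vs_all el_r r_el /edge_list_uniq ues pm0 sep ant.
have EE := rel_graph_edge_list vs_all el_r r_el.
by split; [apply: (matchable_check ues _ EE vs_all)|apply: (bad_check ues _ EE vs_all sep ant)].
Qed.

Definition ord8_list : seq 'I_8 := [:: @Ordinal 8 0 isT; @Ordinal 8 1 isT; @Ordinal 8 2 isT;
  @Ordinal 8 3 isT; @Ordinal 8 4 isT; @Ordinal 8 5 isT; @Ordinal 8 6 isT; @Ordinal 8 7 isT].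
Definition ord10_list : seq 'I_10 := [:: @Ordinal 10 0 isT; @Ordinal 10 1 isT; @Ordinal 10 2 isT;
  @Ordinal 10 3 isT; @Ordinal 10 4 isT; @Ordinal 10 5 isT; @Ordinal 10 6 isT;
  @Ordinal 10 7 isT; @Ordinal 10 8 isT; @Ordinal 10 9 isT].
Definition ord3_list : seq 'I_3 := [:: @Ordinal 3 0 isT; @Ordinal 3 1 isT; @Ordinal 3 2 isT].

Lemma mem_ord8_list u : u \in ord8_list.
Proof. by rewrite -(mem_map val_inj) /= (mem_iota 0 8) ltn_ord. Qed.
Lemma mem_ord10_list u : u \in ord10_list.
Proof. by rewrite -(mem_map val_inj) /= (mem_iota 0 10) ltn_ord. Qed.
Lemma mem_ord3_list u : u \in ord3_list.
Proof. by rewrite -(mem_map val_inj) /= (mem_iota 0 3) ltn_ord. Qed.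

Definition rel_list (U : finType) (vs : seq U) (r : rel U) : seq (U * U) :=
  [seq p <- [seq (u, v) | u <- vs, v <- vs] | (p.1 != p.2) && r p.1 p.2].

(** Each perfect matching takes the outer edges of one path and the middle edges of the other two.
    One edge cannot separate three matchings, but the middle edge of the distinguished path alone is
    anti-forcing. *)
Lemma bad_A1 : matchable A1 /\ bad (matchings A1).
Proof.
by apply: (@bad_rel_graph _ _ (rel_list ord8_list (fun i j : 'I_8 =>
  (val i, val j) \in [:: (0, 2); (2, 3); (3, 1);
                         (0, 4); (4, 5); (5, 1);
                         (0, 6); (6, 7); (7, 1)])) ord8_list 1 mem_ord8_list); vm_compute.
Qed.

(** There are four perfect matchings, and two edges separate them only if each lies in exactly two.
    The edges of this kind are v_4v_5 and v_5v_6, which induce the same split; so gf > 2. *)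
Lemma bad_A2 : matchable A2 /\ bad (matchings A2).
Proof.
by apply: (@bad_rel_graph _ _ (rel_list ord8_list (fun i j : 'I_8 =>
  (val j == i.+1 %% 8) || ((val i, val j) \in [:: (0, 3); (0, 5)]))) ord8_list 2 mem_ord8_list); vm_compute.
Qed.

(** Again there are four perfect matchings, and all edges lying in exactly two of them induce the
    same split. *)
Lemma bad_A3 : matchable A3 /\ bad (matchings A3).
Proof.
by apply: (@bad_rel_graph _ _ (rel_list ord10_list (fun i j : 'I_10 =>
  (val j == i.+1 %% 10) || ((val i, val j) \in [:: (0, 3); (5, 8)]))) ord10_list 2 mem_ord10_list); vm_compute.
Qed.

Definition bool_ord3_list : seq (bool * 'I_3) := [seq (b, i) | b <- [:: true; false], i <- ord3_list].

Lemma mem_bool_ord3_list u : u \in bool_ord3_list.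
Proof. by case: u => b i; apply: allpairs_f; rewrite ?mem_ord3_list //; case: b. Qed.

(** Removing three edges leaves six edges on six vertices, hence a cycle. Every cycle of K_{3,3} is
    conformal, and the two matchings that differ by switching it are not separated by the removed
    edges; so gf > 3. *)
Lemma bad_A4 : matchable A4 /\ bad (matchings A4).
Proof.
by apply: (@bad_rel_graph _ _ (rel_list bool_ord3_list (fun u v : bool * 'I_3 =>
  u.1 && ~~ v.1)) bool_ord3_list 3 mem_bool_ord3_list); vm_compute.
Qed.

Lemma strongly_uniform_minors (T : finType) (G : graph T) : strongly_uniform G ->
  [/\ ~ conformal_minor A1 G, ~ conformal_minor A2 G,
      ~ conformal_minor A3 G & ~ conformal_minor A4 G].
Proof.
move=> uG; have [[m1 b1] [m2 b2] [m3 b3] [m4 b4]] := And4 bad_A1 bad_A2 bad_A3 bad_A4.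
have i8 := @Ordinal 8 0 isT; have i10 := @Ordinal 10 0 isT.
have i3 := (true, @Ordinal 3 0 isT).
split; [exact: bad_conformal_minor i8 m1 b1 uG|exact: bad_conformal_minor i8 m2 b2 uG
       |exact: bad_conformal_minor i10 m3 b3 uG|exact: bad_conformal_minor i3 m4 b4 uG].
Qed.

Lemma uniq_map_inj (A B : eqType) (f : A -> B) (s : seq A) :
  uniq (map f s) -> {in s &, injective f}.
Proof.
elim: s => //= x s IH /andP[xs us] a b; rewrite !inE.
move=> /predU1P[->|sa] /predU1P[->|sb] E //; last exact: IH E.
  by case/negP: xs; rewrite E map_f.
by case/negP: xs; rewrite -E map_f.
Qed.

(** * Exhibiting conformal minors *)

Section MinorList.
Variables (U T : finType) (K : graph T) (J : graph U) (h : U -> T).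
Variables (vs : seq U) (el : seq (U * U * seq T)).

Definition entry_path (a : U * U * seq T) : seq T := h a.1.1 :: rcons a.2 (h a.1.2).
Definition minor_vertices : seq T := map h vs ++ flatten [seq a.2 | a <- el].

(** An entry of [el] is an edge of J with the inner vertices of its path. All placed and inner
    vertices are collected in one list, so a single [uniq] yields the injectivity of h and the
    disjointness of the paths. *)
Lemma minor_list :
  (forall u, u \in vs) -> vset J = [set: U] ->
  eset J = [set:: edge_list (map fst el)] -> simple_list (map fst el) ->
  all (fun a => ~~ odd (size a.2)) el ->
  uniq minor_vertices ->
  all (fun a => path (adj K) (h a.1.1) (rcons a.2 (h a.1.2))) el ->
  {subset minor_vertices <= vset K} ->
  matchable (del_vertices K [set:: minor_vertices]) ->
  conformal_minor J K.
Proof.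
move=> vs_all JV JE sl /allP ev uV /allP adjP VK mat.
have ues := edge_list_uniq sl.
have szE : size (edge_list (map fst el)) = size el by rewrite !size_map.
have keyE : edge_list (map fst el) = [seq [set a.1.1; a.1.2] | a <- el].
  by rewrite /edge_list -map_comp.
have key_inj : {in el &, injective (fun a : U * U * seq T => [set a.1.1; a.1.2])}.
  by apply: uniq_map_inj; move: ues; rewrite keyE.
have memV a : a \in el -> {subset a.2 <= flatten [seq a.2 | a <- el]}.
  by move=> ael x xa; apply/flattenP; exists a.2; rewrite // map_f.
have memh u : h u \in map h vs by apply: map_f.
have memP a : a \in el -> {subset entry_path a <= minor_vertices}.
  move=> ael x; rewrite inE mem_rcons inE mem_cat => /or3P[/eqP->|/eqP->|xa].
  - by rewrite memh.
  - by rewrite memh.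
  - by rewrite (memV _ ael) ?orbT.
have h_inj : injective h.
  move=> u v E; have := uV; rewrite cat_uniq => /and3P[um _ _].
  have ut : uniq vs by apply: map_uniq um.
  have iv w : index (h w) (map h vs) = index w vs.
    rewrite -{1}(nth_index w (vs_all w)) -(nth_map w (h w)) ?index_mem //.
    by rewrite index_uniq // size_map index_mem.
  by rewrite -(nth_index u (vs_all u)) -iv E iv (set_nth_default v) ?index_mem // nth_index.
have disj u a : a \in el -> h u \in a.2 -> False.
  move=> ael ua; move: uV; rewrite cat_uniq => /and3P[_ /hasPn H _].
  by have /negP[] := H _ (memV _ ael _ ua).
have uniq_int a : a \in el -> uniq a.2.
  move=> ael; move: uV; rewrite cat_uniq => /and3P[_ _].
  elim: (el) ael => //= b l IH; rewrite inE cat_uniq => /predU1P[->|al] /and3P[] //.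
  by move=> _ _; apply: IH.
have int_disj a b x : a \in el -> b \in el -> x \in a.2 -> x \in b.2 -> a = b.
  move=> ael bel; move: uV; rewrite cat_uniq => /and3P[_ _].
  elim: (el) ael bel => //= d l IH; rewrite !inE cat_uniq.
  have fl f : f \in l -> x \in f.2 -> x \in flatten [seq a.2 | a <- l].
    by move=> fl xf; apply/flattenP; exists f.2; rewrite // map_f.
  move=> /predU1P[->|al] /predU1P[->|bl] /and3P[_ /hasPn H u] xa xb //.
  - by have /negP[] := H _ (fl _ bl xb).
  - by have /negP[] := H _ (fl _ al xa).
  - exact: IH.
have el0 a : a \in el -> exists2 e, e = [set a.1.1; a.1.2] & e \in eset J.
  move=> ael; exists [set a.1.1; a.1.2] => //.
  by rewrite JE inE keyE; apply/mapP; exists a.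
(* The entry for e is unique because the edges in [el] are distinct; the empty list is returned only
   off the edges of J. *)
pose P e := if [seq a <- el | [set a.1.1; a.1.2] == e] is a :: _ then entry_path a else [::].
have PE a : a \in el -> P [set a.1.1; a.1.2] = entry_path a.
  move=> ael; rewrite /P.
  suff -> : [seq b <- el | [set b.1.1; b.1.2] == [set a.1.1; a.1.2]] = [:: a] by [].
  apply: perm_small_eq => //; apply: uniq_perm => // [|b].
    by rewrite filter_uniq // (@map_uniq _ _ (fun a => [set a.1.1; a.1.2])) // -keyE.
  rewrite mem_filter inE; apply/andP/eqP => [[/eqP E bel]|-> //].
  exact: key_inj E.
have eJ e : e \in eset J -> exists2 a, a \in el & e = [set a.1.1; a.1.2].
  by rewrite JE inE keyE => /mapP[a ael ->]; exists a.
pose S := \bigcup_(e in eset J) path_edges (P e).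
(* Inducing on the vertex list only trims the vertex set here, since all edges of S have their ends
   in the list. *)
pose H := induced (spanning K S) [set:: minor_vertices].
have SK e : e \in S -> e \in eset K /\ e \subset [set:: minor_vertices].
  case/bigcupP=> f /eJ[a ael ->]; rewrite PE // => ea; split.
    have := adjP _ ael; rewrite -path_edges_adj => /subsetP; exact.
  by apply/subsetP => x xe; rewrite inE (memP _ ael) // (path_edges_mem ea).
have HV : vset H = [set:: minor_vertices].
  by apply/setP => x; rewrite !inE andb_idl // => /VK.
have HE : eset H = S.
  apply/setP => e; rewrite !inE; apply/idP/idP => [/andP[/andP[] //]|eS].
  by have [-> ->] := SK _ eS; rewrite eS.
have end_im a : h @: [set a.1.1; a.1.2] = [set h a.1.1; h a.1.2].
  by rewrite imsetU1 imset_set1.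
have ne a : a \in el -> a.1.1 != a.1.2.
  move=> /el0[e -> eJ']; exact: edge_neq eJ'.
exists H.
  apply/andP; split; last by rewrite HV.
  apply/andP; split; last by apply/subsetP => e; rewrite HE => /SK[].
  by rewrite HV; apply/subsetP => x; rewrite inE => /VK.
exists h, P; split.
- by move=> u v _ _; apply: h_inj.
- move=> e /eJ[a ael ->]; rewrite PE //; split.
    rewrite /= mem_rcons inE negb_or (inj_eq h_inj) (ne _ ael) /=.
    rewrite rcons_uniq uniq_int // andbT.
    by apply/andP; split; apply/negP; apply: disj.
  exists (h a.1.1), (rcons a.2 (h a.1.2)); rewrite size_rcons /= ev // last_rcons.
  by rewrite end_im.
- move=> e /eJ[a ael ->] x; rewrite PE // end_im inE mem_rcons inE.
  rewrite !inE => xP; rewrite negb_or => /andP[x1 x2].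
  have xa : x \in a.2 by move: xP; rewrite (negbTE x1) (negbTE x2).
  split; first by apply/imsetP => -[u _ xu]; apply: (disj u a); rewrite -?xu.
  move=> f /eJ[b bel ->] ab; rewrite PE // inE mem_rcons inE.
  apply/negP => /or3P[/eqP E|/eqP E|xb].
  + by apply: (disj b.1.1 a); rewrite -?E.
  + by apply: (disj b.1.2 a); rewrite -?E.
  + by rewrite (int_disj a b x) ?eqxx in ab.
- rewrite HV; apply/setP => x; rewrite in_set in_setU; apply/idP/orP.
    rewrite mem_cat => /orP[/mapP[u _ ->]|/flattenP[q /mapP[a ael ->] xa]].
      by left; apply: imset_f; rewrite JV.
    right; have [e ee eJ'] := el0 _ ael; apply/bigcupP; exists e => //.
    by rewrite ee inE PE // inE mem_rcons inE xa !orbT.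
  case=> [/imsetP[u _ ->]|/bigcupP[e /eJ[a ael ->]]]; first by rewrite mem_cat memh.
  by rewrite inE PE // => /(memP _ ael).
- exact: HE.
Qed.

End MinorList.

(** Applied to the inner vertices of an odd path of length at least 3: a and b are placed as
    vertices of the minor, and q subdivides the middle edge. *)
Lemma even_split (T : Type) (p : seq T) : 0 < size p -> ~~ odd (size p) ->
  exists a q b, p = a :: rcons q b /\ ~~ odd (size q).
Proof.
case: p => // a p _; case/lastP: p => // q b; rewrite /= size_rcons /= negbK => oq.
by exists a, q, b.
Qed.

(** Compares two arrangements of the same pieces: after [permP] both sides are sums of counts, which
    become variables of a linear identity. *)
Ltac count_lia := rewrite ?count_cat /= ?count_cat /= ?count_cat /= ?count_cat /= ?count_rev;
  repeat match goal with |- context [nat_of_bool ?b] => generalize (nat_of_bool b) => ? end;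
  repeat match goal with |- context [@count ?A ?P ?s] => generalize (@count A P s) => ? end; clear; lia.

Section Minors.
Variables (T : finType) (K : graph T).
Implicit Types (x y z w : T) (p q s : seq T).
Notation adj := (adj K).
Notation o8 k := (@Ordinal 8 k isT).
Notation o10 k := (@Ordinal 10 k isT).

Lemma theta_A1 x y p1 p2 p3 :
  uniq (x :: y :: p1 ++ p2 ++ p3) ->
  all (fun p => [&& 0 < size p, ~~ odd (size p) & path adj x (rcons p y)])
    [:: p1; p2; p3] ->
  {subset x :: y :: p1 ++ p2 ++ p3 <= vset K} ->
  matchable (del_vertices K [set:: x :: y :: p1 ++ p2 ++ p3]) ->
  conformal_minor A1 K.
Proof.
rewrite /= => u /and4P[/and3P[p10 e1 a1] /and3P[p20 e2 a2] /and3P[p30 e3 a3] _].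
case: (even_split p10 e1) u a1 => c1 [q1 [d1 [-> {}e1]]] u a1 {p10 p1}.
case: (even_split p20 e2) u a2 => c2 [q2 [d2 [-> {}e2]]] u a2 {p20 p2}.
case: (even_split p30 e3) u a3 => c3 [q3 [d3 [-> {}e3]]] u a3 {p30 p3}.
set W := x :: _ => VK mat.
pose l := [:: x; y; c1; d1; c2; d2; c3; d3].
pose h (i : 'I_8) := nth x l i.
pose el := [:: (o8 0, o8 2, [::]); (o8 2, o8 3, q1); (o8 3, o8 1, [::]);
  (o8 0, o8 4, [::]); (o8 4, o8 5, q2); (o8 5, o8 1, [::]);
  (o8 0, o8 6, [::]); (o8 6, o8 7, q3); (o8 7, o8 1, [::])].
have pW : perm_eq (minor_vertices h ord8_list el) W.
  apply/permP => P; rewrite /W /minor_vertices /= /h /= -!cats1 ?cats0.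
  count_lia.
move: a1 a2 a3; rewrite /= ![path adj _ (rcons (rcons _ _) _)]rcons_path !last_rcons.
case/and3P=> a11 a12 a13 /and3P[a21 a22 a23] /and3P[a31 a32 a33].
apply: (@minor_list _ _ _ _ h ord8_list el mem_ord8_list) => //.
- by apply: (rel_graph_edge_list mem_ord8_list); vm_compute.
- by rewrite /= e1 e2 e3.
- by rewrite (perm_uniq pW).
- by rewrite /= /h /= a11 a12 a13 a21 a22 a23 a31 a32 a33.
- by move=> z; rewrite (perm_mem pW); apply: VK.
- suff -> : [set:: minor_vertices h ord8_list el] = [set:: W] by [].
  by apply/setP => z; rewrite !in_set (perm_mem pW).
Qed.

(** The arc between y and z has an odd number of inner vertices: the first is placed as v_5, and the
    others subdivide v_5v_6. *)
Lemma chords_A2 x p1 y p2 z p3 (W := x :: p1 ++ y :: p2 ++ z :: p3) :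
  uniq W -> cycle adj W -> adj x y -> adj x z ->
  0 < size p1 -> ~~ odd (size p1) -> odd (size p2) ->
  0 < size p3 -> ~~ odd (size p3) ->
  {subset W <= vset K} -> matchable (del_vertices K [set:: W]) ->
  conformal_minor A2 K.
Proof.
rewrite {}/W => u a xy xz p10 e1 o2 p30 e3.
case: (even_split p10 e1) u a => c1 [q1 [d1 [-> {}e1]]] u a {p10 p1}.
case: (even_split p30 e3) u a => c3 [q3 [d3 [-> {}e3]]] u a {p30 p3}.
case: p2 o2 u a => // c2 q2 /= e2; set W := x :: _ => u a VK mat.
pose l := [:: x; c1; d1; y; c2; z; c3; d3].
pose h (i : 'I_8) := nth x l i.
pose el := [:: (o8 0, o8 1, [::]); (o8 1, o8 2, q1); (o8 2, o8 3, [::]);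
  (o8 3, o8 4, [::]); (o8 4, o8 5, q2); (o8 5, o8 6, [::]);
  (o8 6, o8 7, q3); (o8 7, o8 0, [::]); (o8 0, o8 3, [::]); (o8 0, o8 5, [::])].
have pW : perm_eq (minor_vertices h ord8_list el) W.
  apply/permP => P; rewrite /W /minor_vertices /= /h /= -!cats1 ?cats0.
  count_lia.
move: a; rewrite /W /= rcons_cat /= cat_path last_rcons /= rcons_cat /=.
rewrite -(cat_rcons z) cat_path last_rcons /= [path adj c3 _]rcons_path last_rcons.
case/and5P=> a1 a2 a3 a4 /and4P[a5 a6 a7 a8].
apply: (@minor_list _ _ _ _ h ord8_list el mem_ord8_list) => //.
- by apply: (rel_graph_edge_list mem_ord8_list); vm_compute.
- by rewrite /= e1 e2 e3.
- by rewrite (perm_uniq pW).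
- by rewrite /= /h /= a1 a2 a3 a4 a5 a6 a7 a8 xy xz.
- by move=> v; rewrite (perm_mem pW); apply: VK.
- suff -> : [set:: minor_vertices h ord8_list el] = [set:: W] by [].
  by apply/setP => v; rewrite !in_set (perm_mem pW).
Qed.

Lemma chords_A3 x p1 y p2 z p3 w p4 (W := x :: p1 ++ y :: p2 ++ z :: p3 ++ w :: p4) :
  uniq W -> cycle adj W -> adj x y -> adj z w ->
  0 < size p1 -> ~~ odd (size p1) -> odd (size p2) ->
  0 < size p3 -> ~~ odd (size p3) -> odd (size p4) ->
  {subset W <= vset K} -> matchable (del_vertices K [set:: W]) ->
  conformal_minor A3 K.
Proof.
rewrite {}/W => u a xy zw p10 e1 o2 p30 e3 o4.
case: (even_split p10 e1) u a => c1 [q1 [d1 [-> {}e1]]] u a {p10 p1}.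
case: (even_split p30 e3) u a => c3 [q3 [d3 [-> {}e3]]] u a {p30 p3}.
case: p2 o2 u a => // c2 q2 /= e2 u a.
case: p4 o4 u a => // c4 q4 /= e4; set W := x :: _ => u a VK mat.
pose l := [:: x; c1; d1; y; c2; z; c3; d3; w; c4].
pose h (i : 'I_10) := nth x l i.
pose el := [:: (o10 0, o10 1, [::]); (o10 1, o10 2, q1); (o10 2, o10 3, [::]);
  (o10 3, o10 4, [::]); (o10 4, o10 5, q2); (o10 5, o10 6, [::]);
  (o10 6, o10 7, q3); (o10 7, o10 8, [::]); (o10 8, o10 9, [::]); (o10 9, o10 0, q4);
  (o10 0, o10 3, [::]); (o10 5, o10 8, [::])].
have pW : perm_eq (minor_vertices h ord10_list el) W.
  apply/permP => P; rewrite /W /minor_vertices /= /h /= -!cats1 ?cats0.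
  count_lia.
move: a; rewrite /W /= rcons_cat /= cat_path last_rcons /= rcons_cat /=.
rewrite -(cat_rcons z) cat_path last_rcons /= rcons_cat cat_path last_rcons /=.
case/and5P=> a1 a2 a3 a4 /and5P[a5 a6 a7 a8 /andP[a9 a10]].
apply: (@minor_list _ _ _ _ h ord10_list el mem_ord10_list) => //.
- by apply: (rel_graph_edge_list mem_ord10_list); vm_compute.
- by rewrite /= e1 e2 e3 e4.
- by rewrite (perm_uniq pW).
- by rewrite /= /h /= a1 a2 a3 a4 a5 a6 a7 a8 a9 a10 xy zw.
- by move=> v; rewrite (perm_mem pW); apply: VK.
- suff -> : [set:: minor_vertices h ord10_list el] = [set:: W] by [].
  by apply/setP => v; rewrite !in_set (perm_mem pW).
Qed.

(** A hexagon with its three long diagonals is K_{3,3}; the sides are the alternate vertices x1, y1,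
    w and u, x2, y2. *)
Lemma K33_A4 x1 u y1 x2 w y2 (W := [:: x1; u; y1; x2; w; y2]) :
  uniq W -> cycle adj W -> adj x1 x2 -> adj y1 y2 -> adj u w ->
  {subset W <= vset K} -> matchable (del_vertices K [set:: W]) ->
  conformal_minor A4 K.
Proof.
move=> uW a b1 b2 b3 VK mat.
pose h (v : bool * 'I_3) := if v.1 then nth x1 [:: x1; y1; w] v.2 else nth x1 [:: u; x2; y2] v.2.
pose el : seq (bool * 'I_3 * (bool * 'I_3) * seq T) :=
  [seq ((true, i), (false, j), [::]) | i <- ord3_list, j <- ord3_list].
have pW : perm_eq (minor_vertices h bool_ord3_list el) W.
  apply/permP => P; rewrite /W /minor_vertices /= /h /=.
  count_lia.
move: a; rewrite /= andbT => /and5P[a1 a2 a3 a4 /andP[a5 a6]].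
apply: (@minor_list _ _ _ _ h bool_ord3_list el mem_bool_ord3_list) => //.
- by apply: (rel_graph_edge_list mem_bool_ord3_list); vm_compute.
- by rewrite (perm_uniq pW).
- by rewrite /= /h /= a1 b1 adj_sym a6 adj_sym a2 a3 b2 adj_sym b3 adj_sym a4 a5.
- by move=> v; rewrite (perm_mem pW); apply: VK.
- suff -> : [set:: minor_vertices h bool_ord3_list el] = [set:: W] by [].
  by apply/setP => v; rewrite !in_set (perm_mem pW).
Qed.

End Minors.

(** * Elementary components inside the whole graph *)

Section Component.
Variables (T : finType) (G K : graph T).
Hypothesis KG : elementary_component K G.

Lemma component_sub : {subset vset K <= vset G} /\ {subset eset K <= eset G}.
Proof.
case: KG => x _ ->; split=> [v|e]; rewrite !inE => /andP[] //.
by case/andP.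
Qed.

(** A perfect matching of G never leaves K, so its edges outside K complete a matching of K minus
    the minor. *)
Lemma component_minor (U : finType) (J : graph U) : matchable G ->
  conformal_minor J K -> conformal_minor J G.
Proof.
move=> /matchableP[M MG] [H /andP[/andP[/subsetP HV /subsetP HE] /matchableP[N NP]] bis].
have [KV KE] := component_sub.
exists H => //; apply/andP; split.
  by apply/andP; split; apply/subsetP => z zH; [apply/KV/HV|apply/KE/HE].
have NK e : e \in N -> e \in eset K /\ e \subset ~: vset H.
  by move/(pm_sub NP); rewrite inE => /andP[].
have touch e v : e \in M -> v \in e -> v \in vset K -> e \in eset K.
  case: KG => x _ -> eM; exact: component_edge (pm_allowed_edge MG eM).
apply/matchableP; exists (N :|: (M :\: eset K)); apply: pmI => [e|v|e f v].
- case/setUP=> [/NK[eK eH]|/setDP[eM eK]]; first by rewrite inE KE.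
  rewrite inE (pm_sub MG eM); apply/subsetP => v ve; rewrite inE.
  by apply: contra eK => /HV; apply: touch eM ve.
- rewrite !inE => /andP[vG vH]; have [vK|vK] := boolP (v \in vset K).
    have [|e eN ve] := @pm_ex _ _ _ v NP; first by rewrite !inE vK.
    by exists e; rewrite // inE eN.
  have [e eM ve] := pm_ex MG vG; exists e => //; rewrite in_setU in_setD eM andbT.
  by rewrite orbC; apply/orP; left; apply: contra vK => /edge_vset; apply.
- have sep e1 e2 : e1 \in N -> e2 \in M :\: eset K -> v \in e1 -> v \in e2 -> False.
    move=> /NK[e1K _] /setDP[e2M /negP e2K] v1 v2; apply: e2K.
    exact: touch e2M v2 (edge_vset e1K v1).
  case/setUP=> eM /setUP[] fM ve vf.
  + exact: (pm_uniq NP eM fM ve vf).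
  + by case: (sep _ _ eM fM).
  + by case: (sep _ _ fM eM).
  + by case/setDP: eM fM => eM _ /setDP[fM _]; apply: (pm_uniq MG eM fM ve vf).
Qed.

(** Connectedness of K in the form needed to grow a cycle: walking from x to z along allowed edges
    must leave W at some step. *)
Lemma component_exit (W : {set T}) x z : x \in vset K -> z \in vset K ->
  x \in W -> z \notin W -> exists a b, [/\ a \in W, b \notin W & adj K a b].
Proof.
case: KG => x0 _ KE xK zK; have Kx : K = component (allowed_subgraph G) x.
  by rewrite KE; apply/esym/component_eq; rewrite -KE.
have: connect (adj (allowed_subgraph G)) x z by move: zK; rewrite Kx !inE => /andP[].
case/connectP=> p; elim: p x xK {KE} Kx => [|y p IH] x xK Kx /=.
  by move=> _ -> ->.
case/andP=> xy pp zE xW zW; have xyK : adj K x y.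
  by rewrite /adj Kx; apply: component_edge xy (set21 x y) _; rewrite -Kx.
have [yW|yW] := boolP (y \in W); last by exists x, y.
have yK := adj_vr xyK; apply: (IH y) => //.
by rewrite Kx; apply/esym/component_eq; rewrite -Kx.
Qed.

Lemma component_allowed e : e \in eset K -> exists2 M, perfect_matching K M & e \in M.
Proof.
move=> eK; have : allowed G e.
  by case: KG eK => x _ ->; rewrite !inE => /andP[/andP[]].
case/existsP=> M /andP[MG eM]; exists (M :&: eset K); last by rewrite inE eM.
exact: pm_component KG MG.
Qed.

End Component.

(** * Ears and the Hamilton cycle *)

Section Elementary.
Variables (T : finType) (K : graph T) (c : T -> bool).
Implicit Types (x y z a b v w : T) (p q s : seq T) (W e f : {set T}) (M N : {set {set T}}).
Hypothesis cK : proper_coloring c (eset K).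
Hypothesis K_exit : forall W x z, x \in vset K -> z \in vset K ->
  x \in W -> z \notin W -> exists a b, [/\ a \in W, b \notin W & adj K a b].
Hypothesis K_allowed : forall e, e \in eset K -> exists2 M, perfect_matching K M & e \in M.

Notation adj := (adj K).

Lemma color_path x p : path adj x p -> c (last x p) = c x (+) odd (size p).
Proof.
elim: p x => [|y p IH] x /=; first by rewrite addbF.
by case/andP=> xy /IH->; rewrite (colorP cK xy) addbN addNb.
Qed.

Lemma odd_arc x p y : path adj x (rcons p y) -> odd (size p) = (c x == c y).
Proof.
move=> /color_path; rewrite last_rcons size_rcons /= => ->.
by case: (c x); case: (odd _).
Qed.

Lemma path_rev x p y : path adj x (rcons p y) -> path adj y (rcons (rev p) x).
Proof.
rewrite -!path_edges_adj; suff -> : y :: rcons (rev p) x = rev (x :: rcons p y).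
  by rewrite path_edges_rev.
by rewrite rev_cons rev_rcons.
Qed.

(** * Matchings that do not leave a set *)

(** No edge of M leaves W; then the rest of M matches the complement of W. *)
Definition closed_under M W : Prop := forall e x, e \in M -> x \in e -> x \in W -> e \subset W.

Lemma closed_matchable M W : perfect_matching K M -> closed_under M W ->
  matchable (del_vertices K W).
Proof.
move=> MK cl; apply/matchableP; exists [set e in M | e \subset ~: W].
apply: pmI => [e|x|e f x].
- by rewrite !inE => /andP[/(pm_sub MK)-> ->].
- rewrite !inE => /andP[xK xW]; have [e eM xe] := pm_ex MK xK.
  exists e; rewrite // inE eM; apply/subsetP => y ye; rewrite inE.
  by apply: contra xW => yW; apply: (subsetP (cl e y eM ye yW)).
- by rewrite !inE => /andP[eM _] /andP[fM _]; apply: (pm_uniq MK).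
Qed.

Fixpoint path_matching q : {set {set T}} :=
  if q is a :: b :: q' then [set a; b] |: path_matching q' else set0.

Lemma path_matchingP q : uniq q -> ~~ odd (size q) -> sorted adj q ->
  [/\ {in path_matching q, forall e, e \in eset K /\ {subset e <= q}},
      {in q, forall x, exists2 e, e \in path_matching q & x \in e}
    & {in path_matching q &, forall e f x, x \in e -> x \in f -> e = f}].
Proof.
have [n] := ubnP (size q); elim: n q => // n IH [|a [|b q]] //= qn; first by split=> // e; rewrite ?in_set0.
rewrite negbK => /and3P[aq bq uq] oq /andP[ab sq].
have [|||H1 H2 H3] := IH q _ uq.
- by rewrite ltnS in qn; apply: leq_trans qn.
- exact: oq.
- exact: path_sorted sq.
have ne e x : e \in path_matching q -> x \in e -> x \in [set a; b] -> False.
  move=> /H1[_ eq] /eq xq; rewrite !inE => /orP[] /eqP E; rewrite E in xq.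
    by rewrite inE xq orbT in aq.
  by rewrite xq in bq.
split=> [e|x|e f].
- case/setU1P=> [->|/H1[eK eq]].
    by split=> // x; rewrite !inE orbA => ->.
  by split=> // x /eq xq; rewrite !inE xq !orbT.
- rewrite !inE orbA => /orP[xab|/H2[e eM xe]].
    by exists [set a; b]; rewrite ?setU11 // !inE.
  by exists e; rewrite // setU1r.
- case/setU1P=> [->|eM] /setU1P[->|fM] x xe xf //.
  + by case: (ne f x).
  + by case: (ne e x).
  + exact: H3 eM fM x xe xf.
Qed.

Lemma path_matchable q W : uniq q -> ~~ odd (size q) -> sorted adj q ->
  vset K :&: ~: W = [set:: q] -> matchable (del_vertices K W).
Proof.
move=> uq oq sq E; have [H1 H2 H3] := path_matchingP uq oq sq.
apply/matchableP; exists (path_matching q); apply: pmI => [e eM|x|e f x eM fM].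
- have [eK eq] := H1 _ eM; rewrite inE eK; apply/subsetP => x /eq xq.
  by have : x \in [set:: q] by [rewrite inE]; rewrite -E inE => /andP[].
- by rewrite /= E inE => /H2.
- exact: H3.
Qed.

Section Mate.
Variable M : {set {set T}}.
Hypothesis MK : perfect_matching K M.

(** The partner of x in M. Vertices outside K are their own partners, which makes [mate] an
    involution on the whole type and [step] a permutation. *)
Definition mate x := odflt x [pick y | [set x; y] \in M].

Lemma mateP x : x \in vset K -> [set x; mate x] \in M.
Proof.
move=> xK; rewrite /mate; case: pickP => // none.
by have [y _ xy] := pm_other MK xK; rewrite none in xy.
Qed.

Lemma mate_adj x : x \in vset K -> adj x (mate x).
Proof. by move/mateP/(pm_sub MK). Qed.

Lemma mate_eq x y : [set x; y] \in M -> mate x = y.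
Proof.
move=> xy; have xK : x \in vset K by apply: (edge_vset (pm_sub MK xy)); rewrite set21.
exact: pm_pair_uniq MK (mateP xK) xy.
Qed.

Lemma mateK : involutive mate.
Proof.
move=> x; have [xK|xK] := boolP (x \in vset K).
  by apply: mate_eq; rewrite setUC mateP.
suff E : mate x = x by rewrite !E.
rewrite /mate; case: pickP => // y xy.
by rewrite (edge_vset (pm_sub MK xy) (set21 x y)) in xK.
Qed.

Lemma mate_closed W x : closed_under M W -> x \in vset K -> (mate x \in W) = (x \in W).
Proof.
move=> cl xK; have xm := mateP xK.
by apply/idP/idP => H; apply: (subsetP (cl _ _ xm _ H)); rewrite ?set21 ?set22.
Qed.

End Mate.

Section Ear.
Variables (M M' : {set {set T}}) (W : {set T}).
Hypotheses (MK : perfect_matching K M) (M'K : perfect_matching K M').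
Hypothesis clW : closed_under M W.

(** Two steps along the symmetric difference of M and M'. The orbits of this permutation run around
    the alternating cycles, visiting one color class. *)
Definition step v := mate M' (mate M v).

Fixpoint ear k v : seq T := if k is k'.+1 then v :: mate M v :: ear k' (step v) else [::].

Lemma step_inj : injective step.
Proof. by apply: inj_comp; apply: can_inj (mateK _). Qed.

Lemma step_vset v : v \in vset K -> step v \in vset K.
Proof. by move=> vK; apply: adj_vr (mate_adj M'K (adj_vr (mate_adj MK vK))). Qed.

Lemma color_step v : v \in vset K -> c (step v) = c v.
Proof.
move=> vK; have m1 := mate_adj MK vK; have m2 := mate_adj M'K (adj_vr m1).
by rewrite (colorP cK m2) (colorP cK m1) negbK.
Qed.

Lemma size_ear k v : size (ear k v) = k.*2.
Proof. by elim: k v => //= k IH v; rewrite IH. Qed.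

Lemma ear_path k v w : v \in vset K -> adj w v -> path adj w (rcons (ear k v) (iter k step v)).
Proof.
elim: k v w => [|k IH] v w vK wv /=; first by rewrite wv.
have m1 := mate_adj MK vK; rewrite wv m1 -iterS iterSr.
by apply: IH; [apply: step_vset|apply: (mate_adj M'K (adj_vr m1))].
Qed.

Lemma mem_ear k v x : x \in ear k v ->
  exists2 i, i < k & x = iter i step v \/ x = mate M (iter i step v).
Proof.
elim: k v => //= k IH v; rewrite !inE => /or3P[/eqP->|/eqP->|/IH[i ik]].
- by exists 0 => //; left.
- by exists 0 => //; right.
- by rewrite -iterSr; exists i.+1.
Qed.

Lemma iter_vset i v : v \in vset K -> iter i step v \in vset K.
Proof. by move=> vK; elim: i => //= i IH; apply: step_vset. Qed.

Lemma iter_color i v : v \in vset K -> c (iter i step v) = c v.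
Proof. by move=> vK; elim: i => //= i IH; rewrite color_step ?iter_vset. Qed.

Lemma ear_mate k v x : v \in vset K -> x \in ear k v -> mate M x \in ear k v.
Proof.
elim: k v => //= k IH v vK; rewrite !inE => /or3P[/eqP->|/eqP->|xe].
- by rewrite eqxx orbT.
- by rewrite mateK // eqxx.
- by rewrite IH ?step_vset ?orbT.
Qed.

Lemma ear_uniq k v : v \in vset K -> uniq (traject step v k) -> uniq (ear k v).
Proof.
elim: k v => //= k IH v vK /andP[vt ut].
have sK := step_vset vK; rewrite IH // andbT inE negb_or -andbA.
have cm w : w \in vset K -> c (mate M w) = ~~ c w.
  by move=> wK; rewrite (colorP cK (mate_adj MK wK)).
have nv i : i < k -> v != iter i step (step v).
  by move=> ik; apply: contraNneq vt => E; apply/trajectP; exists i.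
apply/and3P; split.
- by apply/eqP => E; have := cm _ vK; rewrite -E; case: (c v).
- apply/negP => /mem_ear[i ik [E|E]]; first by have := nv i ik; rewrite -E eqxx.
  have := cm _ (iter_vset i sK); rewrite -E iter_color // color_step //.
  by case: (c v).
- apply/negP => /mem_ear[i ik [E|E]].
    have := cm _ vK; rewrite E iter_color // color_step //; by case: (c v).
  by have /eqP[] := nv i ik; apply: (can_inj (mateK MK)) E.
Qed.

(** From b the walk follows M and M' alternately. Edges of M do not cross the border of W, so W can
    be re-entered only by an edge of M', that is at an iterate of [step]; the first such iterate
    ends the ear. *)
Lemma ear_exists a b : a \in W -> b \notin W -> [set a; b] \in M' ->
  exists q z, [/\ path adj a (rcons q z), 0 < size q, ~~ odd (size q), uniq q
    & [/\ {in q, forall x, x \notin W /\ x \in vset K}, z \in W, c z != c a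
        & closed_under M (W :|: [set:: q])]].
Proof.
move=> aW bW abM; have ab : adj a b by apply: pm_sub M'K abM.
have [aK bK] := (adj_vl ab, adj_vr ab).
have o0 : 0 < order step b by rewrite order_gt0.
(* The predecessor of b on its orbit. Its M-partner is the M'-partner of b, which is a; hence v lies
   in W and the walk does return to W. *)
pose v := iter (order step b).-1 step b.
have sv : step v = b by rewrite /v -iterS prednK // iter_order //; apply: step_inj.
have vK : v \in vset K by apply: iter_vset.
have vW : v \in W.
  rewrite -(mate_closed MK clW vK); suff -> : mate M v = a by [].
  have baM : [set b; a] \in M' by rewrite setUC.
  by rewrite -(mateK M'K (mate M v)) -/(step v) sv (mate_eq M'K baM).
have ex : exists k, iter k step b \in W by exists (order step b).-1.
have [k kW kmin] := ex_minnP ex.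
have k0 : 0 < k by rewrite lt0n; apply: contraNneq bW => k0; rewrite k0 in kW.
have ko : k <= order step b by apply: leq_trans (kmin _ vW) (leq_pred _).
exists (ear k b), (iter k step b); split.
- exact: ear_path.
- by rewrite size_ear double_gt0.
- by rewrite size_ear odd_double.
- apply: ear_uniq => //; have := orbit_uniq step b.
  by rewrite /orbit -(subnKC ko) trajectD cat_uniq => /andP[].
have earW x : x \in ear k b -> x \notin W /\ x \in vset K.
  case/mem_ear=> i ik xE; have iK := iter_vset i bK.
  have iW : iter i step b \notin W.
    by apply: contraL ik => /kmin; rewrite -leqNgt.
  case: xE => ->; first by rewrite iW.
  by rewrite (mate_closed MK clW iK) iW (adj_vr (mate_adj MK iK)).
split=> //.
  by rewrite iter_color // (colorP cK ab); case: (c a).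
move=> e x eM xe /setUP[xW|]; first by apply: subset_trans (subsetUl _ _); apply: clW xe xW.
rewrite inE => xq; have [_ xK] := earW _ xq.
have -> : e = [set x; mate M x] by apply: (pm_uniq MK eM (mateP MK xK) xe); rewrite set21.
by rewrite subUset !sub1set !inE xq ear_mate ?orbT.
Qed.

End Ear.

(** * A Hamilton cycle *)

(** Two vertices are allowed: an edge traversed back and forth is the starting point for the
    extension. *)
Definition conformal_cycle s : Prop :=
  [/\ uniq s, 1 < size s, {subset s <= vset K}, cycle adj s
    & exists2 M, perfect_matching K M & closed_under M [set:: s]].

Lemma closed_under_eq M W W' : W =i W' -> closed_under M W -> closed_under M W'.
Proof.
move=> E cl e x eM xe xW; apply/subsetP => y ye; rewrite -E.
by apply: (subsetP (cl e x eM xe _)); rewrite ?E.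
Qed.

(** The ends of an ear cut the cycle into two arcs. If one arc is a single edge, the ear replaces it
    in a longer conformal cycle; otherwise both arcs and the ear have positive even numbers of inner
    vertices and form a theta graph that contains A_1. *)
Lemma extend_cycle s : conformal_cycle s ->
  [\/ {subset vset K <= s}, conformal_minor A1 K
    | exists2 s', conformal_cycle s' & size s < size s'].
Proof.
case=> us s1 sK cy [M MK cl].
have [/subsetP|/subsetPn[z0 z0K z0s]] := boolP (vset K \subset s); first by constructor 1.
have [x0 x0s] : exists x, x \in s by case: (s) s1 => // x p _; exists x; rewrite inE eqxx.
have [||a [b [aW bW ab]]] := K_exit (sK _ x0s) z0K (W := [set:: s]); rewrite ?inE //.
have [M' M'K abM'] := K_allowed ab.
have [q [z [aqz q0 oq uq [qW zW cz clq]]]] := ear_exists MK M'K cl aW bW abM'.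
rewrite !inE in aW zW.
have az : a != z by apply: contraNneq cz => ->.
case: (rot_to_arc us aW zW az) => i p1 p2 _ _ E.
have qs x : x \in q -> x \notin s by case/qW; rewrite inE.
have qK x : x \in q -> x \in vset K by case/qW.
have uE : uniq (a :: p1 ++ z :: p2) by rewrite -E rot_uniq.
have mE x : (x \in s) = (x \in a :: p1 ++ z :: p2) by rewrite -(mem_rot i) E.
have szE : size s = size (a :: p1 ++ z :: p2) by rewrite -(size_rot i) E.
have cE : cycle adj (a :: p1 ++ z :: p2) by rewrite -E rot_cycle.
have [pz pa] : path adj a (rcons p1 z) /\ path adj z (rcons p2 a).
  by move: cE; rewrite /= rcons_cat rcons_cons -cat_rcons cat_path last_rcons => /andP[].
have o1 : ~~ odd (size p1) by rewrite (odd_arc pz) eq_sym.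
have o2 : ~~ odd (size p2) by rewrite (odd_arc pa).
have clq' W' : W' =i [predU s & q] -> closed_under M W'.
  move=> EW; apply: closed_under_eq clq => x; rewrite EW !inE.
  by [].
have u_all : uniq (a :: z :: p1 ++ p2 ++ q).
  have pe : perm_eq (a :: z :: p1 ++ p2 ++ q) ((a :: p1 ++ z :: p2) ++ q).
    by apply/permP => P; count_lia.
  rewrite (perm_uniq pe) cat_uniq uE uq andbT; apply/hasPn => x /qs.
  by rewrite mE.
have [p1E|p1n] := eqVneq p1 [::].
  constructor 3; exists (a :: q ++ z :: p2); last first.
    by move: q0; rewrite szE p1E /= !size_cat /=; clear; lia.
  have pe : perm_eq (a :: q ++ z :: p2) (a :: z :: p1 ++ p2 ++ q).
    by rewrite p1E; apply/permP => P; count_lia.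
  split.
  - by rewrite (perm_uniq pe).
  - by rewrite /= size_cat /= addnS.
  - move=> x; rewrite (perm_mem pe) p1E /= !inE mem_cat => /or4P[/eqP->|/eqP->|xp|/qK //];
    by apply: sK; rewrite mE p1E !inE ?eqxx ?xp ?orbT.
  - by rewrite /= rcons_cat /= -cat_rcons cat_path aqz last_rcons.
  - exists M => //; apply: clq' => x; rewrite inE (perm_mem pe) !inE mE p1E /= !inE mem_cat.
    by case: (x == a); case: (x == z); case: (x \in p2); case: (x \in q).
have [p2E|p2n] := eqVneq p2 [::].
  constructor 3; exists (a :: p1 ++ z :: rev q); last first.
    by move: q0; rewrite szE p2E /= !size_cat /= size_rev; clear; lia.
  have pe : perm_eq (a :: p1 ++ z :: rev q) (a :: z :: p1 ++ p2 ++ q).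
    by rewrite p2E; apply/permP => P; count_lia.
  split.
  - by rewrite (perm_uniq pe).
  - by rewrite /= size_cat /= addnS.
  - move=> x; rewrite (perm_mem pe) p2E /= !inE mem_cat => /or4P[/eqP->|/eqP->|xp|/qK //];
    by apply: sK; rewrite mE p2E !(inE, mem_cat) ?eqxx ?xp ?orbT.
  - by rewrite /= rcons_cat /= -cat_rcons cat_path pz last_rcons path_rev.
  - exists M => //; apply: clq' => x; rewrite inE (perm_mem pe) !inE mE p2E /= !(inE, mem_cat).
    by case: (x == a); case: (x == z); case: (x \in p1); case: (x \in q).
constructor 2; have pe : a :: z :: p1 ++ rev p2 ++ q =i a :: z :: p1 ++ p2 ++ q.
  by move=> x; rewrite !(inE, mem_cat, mem_rev).
apply: (@theta_A1 _ _ a z p1 (rev p2) q).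
- suff pe' : perm_eq (a :: z :: p1 ++ rev p2 ++ q) (a :: z :: p1 ++ p2 ++ q).
    by rewrite (perm_uniq pe').
  by apply/permP => P; count_lia.
- rewrite /= size_rev o1 o2 oq pz aqz (path_rev pa) q0 !andbT.
  by apply/andP; split; [case: (p1) p1n|case: (p2) p2n].
- move=> x; rewrite pe !(inE, mem_cat) => H.
  have [/qK //|xq] := boolP (x \in q); apply: sK; rewrite mE !(inE, mem_cat).
  by move: H; rewrite (negbTE xq) orbF; case: (x == a); case: (x == z);
     case: (x \in p1); case: (x \in p2).
- apply: (closed_matchable MK); apply: clq' => x; rewrite inE pe !inE mE !(inE, mem_cat).
  by case: (x == a); case: (x == z); case: (x \in p1); case: (x \in p2); case: (x \in q).
Qed.

Lemma hamilton_or_A1 : matchable K -> vset K != set0 ->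
  conformal_minor A1 K \/ exists2 s, conformal_cycle s & {subset vset K <= s}.
Proof.
move=> /matchableP[M MK] /set0Pn[x xK].
have [s0 cs0] : exists s, conformal_cycle s.
  have xy := mate_adj MK xK; exists [:: x; mate M x]; split=> //.
  - by rewrite /= inE andbT; apply: edge_neq xy.
  - by move=> z; rewrite !inE => /orP[] /eqP-> //; apply: adj_vr xy.
  - by rewrite /= xy adj_sym xy.
  - exists M => // e z eM ze zs.
    have -> : e = [set x; mate M x].
      apply: (pm_uniq MK eM (mateP MK xK) ze).
      by move: zs; rewrite !inE.
    by apply/subsetP => w; rewrite !inE.
have [n] := ubnP (#|vset K| - size s0); elim: n s0 cs0 => // n IH s cs sn.
have [span|A1|[s' cs' ss']] := extend_cycle cs; [by right; exists s|by left|].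
have s'K : size s' <= #|vset K|.
  case: cs' => us' _ s'K _ _; rewrite -(card_uniqP us') subset_leq_card //.
  exact/subsetP.
by apply: (IH s' cs'); move: sn ss' s'K; clear; lia.
Qed.

End Elementary.

Lemma rot_shift (T : Type) (s : seq T) i (a b : seq T) :
  rot i s = a ++ b -> exists j, rot j s = b ++ a.
Proof.
move=> E; have [ns|ns] := leqP i (size s); last first.
  by exists (size a); move: E; rewrite rot_oversize ?(ltnW ns) // => ->; rewrite rot_size_cat.
have [ms|ms] := leqP (size a) (size s); last first.
  by move: ms; rewrite -(size_rot i) E size_cat ltnNge leq_addr.
exists (if size a + i <= size s then size a + i else size a + i - size s).
by rewrite -rot_add_mod // E rot_size_cat.
Qed.

(** A search through the enumeration, as A and B are propositions without a decision procedure. *)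
Lemma finite_dichotomy (I : finType) (A B : I -> Prop) :
  (forall i, A i \/ B i) -> (forall i, A i) \/ exists i, B i.
Proof.
move=> AB; suff [H|[i Bi]] : {in enum I, forall i, A i} \/ exists i, B i.
- by left=> i; apply: H; rewrite mem_enum.
- by right; exists i.
elim: (enum I) => [|i l [H|]]; [by left|case: (AB i) => [Ai|Bi]|by right].
  by left=> j; rewrite inE => /predU1P[->|/H].
by right; exists i.
Qed.

Lemma subseq_skip (T : eqType) (x : T) p t s :
  subseq t s -> subseq (x :: t) (p ++ x :: s).
Proof.
move=> ts; rewrite -[x :: t]cat0s; apply: cat_subseq; first exact: sub0seq.
by rewrite /= eqxx.
Qed.

(** * Pairs and triples of chords of a Hamilton cycle *)

Section Chords.
Variables (T : finType) (K : graph T) (c : T -> bool) (s : seq T).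
Implicit Types (x y z u v w : T) (p q a b d g : seq T) (e f : {set T}) (i j : nat).
Hypothesis cK : proper_coloring c (eset K).
Hypothesis hs : hamilton_cycle K s.

Notation adj := (adj K).
Notation Ch := (chords K s).

Definition has_minor : Prop :=
  [\/ conformal_minor A1 K, conformal_minor A2 K,
      conformal_minor A3 K | conformal_minor A4 K].

Let us : uniq s. Proof. by case: hs. Qed.

Let cyc i : cycle adj (rot i s).
Proof. by rewrite rot_cycle -cycle_edges_adj; case: hs. Qed.

Lemma chord_adj x y : [set x; y] \in Ch -> adj x y.
Proof. by rewrite inE => /andP[]. Qed.

Lemma chord_color x y : [set x; y] \in Ch -> c y = ~~ c x.
Proof. by move/chord_adj/(colorP cK). Qed.

Lemma segment_path i a x p y q : rot i s = a ++ x :: p ++ y :: q -> path adj x (rcons p y).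
Proof.
move=> E; have [j] := rot_shift E; rewrite /= -catA /= => Ej.
by have := cyc j; rewrite Ej /= rcons_cat /= -cat_rcons cat_path => /andP[].
Qed.

Lemma segment_odd i a x p y q : rot i s = a ++ x :: p ++ y :: q ->
  odd (size p) = (c x == c y).
Proof. by move/segment_path/(odd_arc cK). Qed.

Lemma last_path i x p y q : rot i s = x :: p ++ y :: q -> path adj y (rcons q x).
Proof.
by move=> E; have := cyc i; rewrite E /= rcons_cat /= -cat_rcons cat_path last_rcons => /andP[].
Qed.

Lemma last_odd i x p y q : rot i s = x :: p ++ y :: q -> odd (size q) = (c y == c x).
Proof. by move/last_path/(odd_arc cK). Qed.

Lemma chord_gap i x p y q : rot i s = x :: p ++ y :: q -> [set x; y] \in Ch ->
  0 < size p /\ 0 < size q.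
Proof.
move=> E; rewrite inE -(cycle_edges_rot i) E cycle_edges_path => /andP[xy _].
split; rewrite lt0n size_eq0; apply: contraNneq xy => p0; rewrite p0.
  by rewrite path_edges_cons setU11.
apply/path_edgesP; exists (x :: p), y, x, [::]; rewrite setUC; split=> //.
by rewrite rcons_cat.
Qed.

Lemma rot_facts i W : rot i s = W ->
  [/\ uniq W, cycle adj W, {subset W <= vset K} & matchable (del_vertices K [set:: W])].
Proof.
move=> E; have WK x : (x \in W) = (x \in vset K) by rewrite -E mem_rot (ham_mem hs).
split; [by rewrite -E rot_uniq|by rewrite -E|by move=> x; rewrite WK|].
apply: (@path_matchable _ _ [::]) => //; apply/setP => x.
by rewrite !inE WK andbN.
Qed.

Lemma minor_A2 i x p1 y p2 z p3 : rot i s = x :: p1 ++ y :: p2 ++ z :: p3 ->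
  [set x; y] \in Ch -> [set x; z] \in Ch -> has_minor.
Proof.
move=> E xy xz; have [uW cW WK mW] := rot_facts E.
have E' : rot i s = x :: (p1 ++ y :: p2) ++ z :: p3 by rewrite E /= -catA.
have [p10 _] := chord_gap E xy; have [_ p30] := chord_gap E' xz.
have cy := chord_color xy; have cz := chord_color xz.
constructor 2; apply: (chords_A2 uW cW (chord_adj xy) (chord_adj xz)) => //.
- by rewrite (@segment_odd i [::] x p1 y _ E) cy; case: (c x).
- by rewrite (@segment_odd i (x :: p1) y p2 z p3) // cy cz eqxx.
- by rewrite (last_odd E') cz; case: (c x).
Qed.

(** For parallel chords in this order x and z would have the same color. With x and w of the same
    color the arcs from y to z and from w to x have even length, as in A_3. *)
Lemma minor_A3 i x p1 y p2 z p3 w p4 : rot i s = x :: p1 ++ y :: p2 ++ z :: p3 ++ w :: p4 ->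
  [set x; y] \in Ch -> [set z; w] \in Ch -> c x = c w -> has_minor.
Proof.
move=> E xy zw cxw; have [uW cW WK mW] := rot_facts E.
have E1 : rot i s = (x :: p1) ++ y :: p2 ++ z :: p3 ++ w :: p4 by [].
have E2 : rot i s = (x :: p1 ++ y :: p2) ++ z :: p3 ++ w :: p4 by rewrite E /= -catA.
have E3 : rot i s = x :: (p1 ++ y :: p2 ++ z :: p3) ++ w :: p4.
  by rewrite E /= -?catA /= -?catA.
have [j Ej] := rot_shift E2; rewrite /= -catA /= in Ej.
have [p10 _] := chord_gap E xy; have [p30 _] := chord_gap Ej zw.
have cy := chord_color xy; have cw := chord_color zw.
constructor 3; apply: (chords_A3 uW cW (chord_adj xy) (chord_adj zw)) => //.
- by rewrite (@segment_odd i [::] x p1 y _ E) cy; case: (c x).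
- by rewrite (segment_odd E1) cy cxw cw negbK eqxx.
- by rewrite (segment_odd E2) cw; case: (c z).
- by rewrite (last_odd E3) cxw eqxx.
Qed.

(** A theta graph with ends y1 and x2: its paths are the arc b, the chord y1y2 followed by the
    reverse of d, and the reverse of a followed by the chord x1x2. The even arc g is left over and
    matched along itself. *)
Lemma minor_A1_left i x1 a y1 b x2 d y2 g :
  rot i s = x1 :: a ++ y1 :: b ++ x2 :: d ++ y2 :: g ->
  [set x1; x2] \in Ch -> [set y1; y2] \in Ch -> c x1 = c y1 -> 0 < size b -> has_minor.
Proof.
move=> E x12 y12 cxy b0; have [uW cW WK mW] := rot_facts E.
have E1 : rot i s = (x1 :: a) ++ y1 :: b ++ x2 :: d ++ y2 :: g by [].
have E2 : rot i s = (x1 :: a ++ y1 :: b) ++ x2 :: d ++ y2 :: g by rewrite E /= -catA.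
have E3 : rot i s = x1 :: (a ++ y1 :: b ++ x2 :: d) ++ y2 :: g.
  by rewrite E /= -?catA /= -?catA.
have cx2 := chord_color x12; have cy2 := chord_color y12.
have pa := @segment_path i [::] x1 a y1 _ E.
have pb := segment_path E1; have pd := segment_path E2; have pg := last_path E3.
have oa := odd_arc cK pa; have ob := odd_arc cK pb; have od := odd_arc cK pd.
have og := odd_arc cK pg.
rewrite cxy eqxx in oa; rewrite cx2 cxy eq_sym in ob; rewrite cx2 cy2 cxy eqxx in od.
rewrite cy2 cxy in og.
have {}ob : ~~ odd (size b) by rewrite ob; case: (c y1).
have {}og : ~~ odd (size g) by rewrite og; case: (c y1).
have pe : perm_eq (y1 :: x2 :: b ++ (y2 :: rev d) ++ (rev a ++ [:: x1]) ++ g)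
    (x1 :: a ++ y1 :: b ++ x2 :: d ++ y2 :: g).
  by apply/permP => P; count_lia.
have uV : uniq ((y1 :: x2 :: b ++ (y2 :: rev d) ++ (rev a ++ [:: x1])) ++ g).
  by move: uW; rewrite -(perm_uniq pe) /= -?catA /= -?catA.
have memV z : (z \in vset K) =
    (z \in y1 :: x2 :: b ++ (y2 :: rev d) ++ (rev a ++ [:: x1])) || (z \in g).
  rewrite -(ham_mem hs) -(mem_rot i) E -(perm_mem pe) -mem_cat.
  by rewrite /= -?catA /= -?catA.
move: uV; rewrite cat_uniq => /and3P[uV /hasPn dis ug].
constructor 1; apply: (@theta_A1 _ _ y1 x2 b (y2 :: rev d) (rev a ++ [:: x1])) => //.
- apply/and4P; split=> //.
  + by rewrite b0 ob pb.
  + rewrite /= size_rev od /= (chord_adj y12) /=; exact: path_rev pd.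
  + rewrite size_cat /= size_rev addn1 /= negbK oa /= cats1 rcons_path last_rcons.
    by rewrite (path_rev pa) (chord_adj x12).
- by move=> z zV; rewrite memV zV.
- apply: (@path_matchable _ _ g) => //.
    case: (g) pg => // z g' /= /andP[_]; rewrite rcons_path => /andP[] //.
  apply/setP => z; rewrite in_setI in_setC !in_set memV.
  have [zg|zg] := boolP (z \in g); last by rewrite orbF andbN.
  by rewrite orbT; apply: dis.
Qed.

(** Starting the cycle at x2 and exchanging the ends of both chords puts g in the place of b. *)
Lemma minor_A1 i x1 a y1 b x2 d y2 g :
  rot i s = x1 :: a ++ y1 :: b ++ x2 :: d ++ y2 :: g ->
  [set x1; x2] \in Ch -> [set y1; y2] \in Ch -> c x1 = c y1 ->
  has_minor \/ b = [::] /\ g = [::].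
Proof.
move=> E x12 y12 cxy; have cx2 := chord_color x12; have cy2 := chord_color y12.
have [b0|b0] := posnP (size b); last by left; apply: minor_A1_left E x12 y12 cxy b0.
have [g0|g0] := posnP (size g); first by right; split; apply: size0nil.
left; have E' : rot i s = (x1 :: a ++ y1 :: b) ++ x2 :: d ++ y2 :: g by rewrite E /= -catA.
have [j Ej] := rot_shift E'; rewrite /= -?catA /= in Ej.
rewrite setUC in x12; rewrite setUC in y12.
by apply: (minor_A1_left Ej x12 y12 _ g0); rewrite cx2 cy2 cxy.
Qed.

Lemma chords_share e f v : e \in Ch -> f \in Ch -> e != f -> v \in e -> v \in f -> has_minor.
Proof.
move=> ec fc ef ve vf.
have [eK fK] : e \in eset K /\ f \in eset K.
  by move: ec fc; rewrite !inE => /andP[_ ->] /andP[_ ->].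
have [y yv eE] := edge_other eK ve; have [z zv fE] := edge_other fK vf.
have yz : y != z by apply: contraNneq ef => yz; rewrite eE fE yz.
have inS w : w \in e \/ w \in f -> w \in s.
  by rewrite (ham_mem hs) => -[]; apply: edge_vset.
have vs : v \in s by apply: inS; left.
have [i p E] := rot_to vs.
have mp w : w \in s -> w != v -> w \in p.
  by rewrite -(mem_rot i) E inE => /predU1P[->|//]; rewrite eqxx.
have yp : y \in p by apply: mp yv; apply: inS; left; rewrite eE set22.
have zp : z \in p by apply: mp zv; apply: inS; right; rewrite fE set22.
rewrite eE in ec; rewrite fE in fc.
case/splitPr: yp E zp => p1 p2 E; rewrite mem_cat inE eq_sym (negbTE yz) /=.
case/orP=> zp; case/splitPr: zp E => q1 q2 E.
  by rewrite -catA in E; apply: (minor_A2 E fc ec).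
exact: (minor_A2 E ec fc).
Qed.

(** Strongly crossed chords in normal form: y1x2 and the closing y2x1 are cycle edges. For the fixed
    direction of s the relation is not symmetric, so both orders of e and f have to be
    considered. *)
Definition crossing e f : Prop := exists j x1 p y1 x2 q y2,
  [/\ rot j s = x1 :: p ++ y1 :: x2 :: q ++ [:: y2],
      e = [set x1; x2], f = [set y1; y2] & c x1 = c y1].

(** From x1 onwards the other three ends come in one of six orders: two are parallel, two give A_3,
    and in two the chords cross. *)
Lemma chord_pair e f : e \in Ch -> f \in Ch -> e != f ->
  [\/ has_minor, parallel c s e f | crossing e f \/ crossing f e].
Proof.
move=> ec fc ef.
have [x1 [x2 [eE x1s x2s cx1 cx2]]] := chord_ends hs cK true ec.
have [y1 [y2 [fE y1s y2s cy1 cy2]]] := chord_ends hs cK true fc.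
have xy1 : x1 != y2 by apply/eqP => E; move: cx1; rewrite E cy2.
have xy2 : x2 != y1 by apply/eqP => E; move: cx2; rewrite E cy1.
have x12 : x1 != x2 by apply/eqP => E; move: cx1; rewrite E cx2.
have y12 : y1 != y2 by apply/eqP => E; move: cy1; rewrite E cy2.
have [x1y1|x1y1] := eqVneq x1 y1.
  by constructor 1; apply: (chords_share (v := x1) ec fc ef); rewrite ?eE ?fE ?x1y1 set21.
have [x2y2|x2y2] := eqVneq x2 y2.
  by constructor 1; apply: (chords_share (v := x2) ec fc ef); rewrite ?eE ?fE ?x2y2 set22.
have [i p E] := rot_to x1s.
have mp w : w \in s -> x1 != w -> w \in p.
  by rewrite -(mem_rot i) E inE => /predU1P[->|//]; rewrite eqxx.
have x2p := mp _ x2s x12; have y1p := mp _ y1s x1y1; have y2p := mp _ y2s xy1.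
rewrite eE in ec; rewrite fE in fc.
have cxy : c x1 = c y1 by rewrite cx1 cy1.
have ec' : [set x2; x1] \in Ch by rewrite setUC.
have fc' : [set y2; y1] \in Ch by rewrite setUC.
case/splitPr: x2p E y1p y2p => p1 p2 E.
rewrite !mem_cat !inE ![_ == x2]eq_sym (negbTE xy2) (negbTE x2y2) /=.
case/orP=> y1p /orP[] y2p.
- case/splitPr: y1p E y2p => q1 q2 E; rewrite mem_cat inE [y2 == y1]eq_sym (negbTE y12) /=.
  case/orP=> y2p; case/splitPr: y2p E => r1 r2 E.
  + (* cyclic order x1 y2 y1 x2 *)
    constructor 2; exists x1, x2, y1, y2; split=> //; first by rewrite cx1 cx2 cy1 cy2.
    have {}E : rot i s = [:: x1] ++ (r1 ++ y2 :: r2 ++ y1 :: q2 ++ x2 :: p2).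
      by rewrite E /= -?catA /= -?catA.
    have [j Ej] := rot_shift E; exists (size (rev s) - j); right.
    have : subseq [:: y2; y1; x2; x1] (rot j s).
      rewrite Ej -?catA /= -?catA /= -?catA /= -?catA /=.
      by do 4![apply: subseq_skip].
    by rewrite -subseq_rev rev_rot.
  + (* cyclic order x1 y1 y2 x2 *)
    constructor 1; have {}E : rot i s = (x1 :: q1) ++ (y1 :: r1 ++ y2 :: r2 ++ x2 :: p2).
      by rewrite E /= -?catA /= -?catA.
    have [j Ej] := rot_shift E; rewrite /= -?catA /= -?catA /= in Ej.
    by apply: (minor_A3 Ej fc ec').
- (* cyclic order x1 y1 x2 y2 *)
  case/splitPr: y1p E => q1 q2 E; case/splitPr: y2p E => r1 r2 E.
  rewrite -catA /= in E.
  have [H|[q20 r20]] := minor_A1 E ec fc cxy; first by constructor 1.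
  constructor 3; left; exists i, x1, q1, y1, x2, r1, y2.
  by rewrite E q20 r20.
- (* cyclic order x1 y2 x2 y1 *)
  case/splitPr: y1p E => q1 q2 E; case/splitPr: y2p E => r1 r2 E.
  have {}E : rot i s = (x1 :: r1 ++ y2 :: r2 ++ x2 :: q1) ++ (y1 :: q2).
    by rewrite E /= -?catA /= -?catA.
  have [j Ej] := rot_shift E; rewrite /= in Ej.
  have [H|[r10 q20]] := minor_A1 Ej fc ec (esym cxy); first by constructor 1.
  constructor 3; right; exists j, y1, q2, x1, y2, r2, x2.
  by rewrite Ej r10 q20.
- case/splitPr: y1p E y2p => q1 q2 E; rewrite mem_cat inE [y2 == y1]eq_sym (negbTE y12) /=.
  case/orP=> y2p; case/splitPr: y2p E => r1 r2 E.
  + (* cyclic order x1 x2 y2 y1 *)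
    constructor 1; rewrite -catA /= in E; exact: (minor_A3 E ec fc' cxy).
  + (* cyclic order x1 x2 y1 y2 *)
    constructor 2; exists x1, x2, y1, y2; split=> //; first by rewrite cx1 cx2 cy1 cy2.
    exists i; left; rewrite E /= eqxx.
    rewrite -?catA /=; do 3![apply: subseq_skip]; exact: sub0seq.
Qed.

(* A third chord inside one of the two long arcs is not parallel to one of the
   crossing chords. *)
Lemma third_chord_ordered j x1 a u b w d y1 x2 q y2 :
  rot j s = x1 :: (a ++ u :: b ++ w :: d) ++ y1 :: x2 :: q ++ [:: y2] ->
  [set x1; x2] \in Ch -> [set y1; y2] \in Ch -> c x1 = c y1 ->
  [set u; w] \in Ch -> has_minor.
Proof.
move=> E x12 y12 cxy uw.
have E1 : rot j s = (x1 :: a) ++ (u :: b ++ w :: d ++ y1 :: x2 :: q ++ [:: y2]).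
  by rewrite E /= -?catA /= -?catA /= -?catA.
have [k Ek] := rot_shift E1.
have [cux|cux] := eqVneq (c u) (c x1).
  have {}Ek : rot k s = u :: b ++ w :: (d ++ [:: y1]) ++ x2 :: (q ++ [:: y2]) ++ x1 :: a.
    by rewrite Ek /= -?catA /= -?catA /= -?catA /= -?catA.
  rewrite setUC in x12; exact: minor_A3 Ek uw x12 cux.
have {}Ek : rot k s = u :: b ++ w :: d ++ y1 :: (x2 :: q) ++ y2 :: (x1 :: a).
  by rewrite Ek /= -?catA /= -?catA /= -?catA /= -?catA.
apply: (minor_A3 Ek uw y12); rewrite (chord_color y12) -cxy.
by case: (c u) cux; case: (c x1).
Qed.

Lemma third_chord_same j x1 p y1 x2 q y2 u w :
  rot j s = x1 :: p ++ y1 :: x2 :: q ++ [:: y2] ->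
  [set x1; x2] \in Ch -> [set y1; y2] \in Ch -> c x1 = c y1 ->
  [set u; w] \in Ch -> u \in p -> w \in p -> has_minor.
Proof.
move=> E x12 y12 cxy uw up; have ne := edge_neq (chord_adj uw).
case/splitPr: up E => a d E; rewrite mem_cat inE eq_sym (negbTE ne) /=.
case/orP=> wi; case/splitPr: wi E => b1 b2 E; last first.
  exact: third_chord_ordered E x12 y12 cxy uw.
rewrite setUC in uw; rewrite -catA /= in E.
exact: third_chord_ordered E x12 y12 cxy uw.
Qed.

(** If u has the color of x1, the third chord crosses x1x2 with y1 strictly between u and x2, so not
    strongly. Otherwise it crosses both chords, and unless A_1 occurs every remaining arc is empty
    and s is a hexagon. *)
Lemma third_chord_across j x1 p y1 x2 q y2 u w :
  rot j s = x1 :: p ++ y1 :: x2 :: q ++ [:: y2] ->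
  [set x1; x2] \in Ch -> [set y1; y2] \in Ch -> c x1 = c y1 ->
  [set u; w] \in Ch -> u \in p -> w \in q -> has_minor.
Proof.
move=> E x12 y12 cxy uw up wq; have cw := chord_color uw.
case/splitPr: up E => a b E; case/splitPr: wq E => d g E.
have [cux|cux] := eqVneq (c x1) (c u).
  have E1 : rot j s = x1 :: a ++ u :: (b ++ [:: y1]) ++ x2 :: d ++ w :: (g ++ [:: y2]).
    by rewrite E /= -?catA /= -?catA /= -?catA.
  by have [hm|[]] := minor_A1 E1 x12 uw cux; [|case: (b)].
have cwx : c w = c x1 by rewrite cw; case: (c u) cux; case: (c x1).
have wu : [set w; u] \in Ch by rewrite setUC.
have E1 : rot j s = (x1 :: a ++ u :: b ++ y1 :: x2 :: d) ++ (w :: g ++ [:: y2]).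
  by rewrite E /= -?catA /= -?catA /= -?catA.
have [k Ek] := rot_shift E1.
have {}E1 : rot k s = w :: (g ++ [:: y2]) ++ x1 :: a ++ u :: (b ++ [:: y1]) ++ x2 :: d.
  by rewrite Ek /= -?catA /= -?catA /= -?catA.
have [hm|[a0 d0]] := minor_A1 E1 wu x12 cwx; first exact: hm.
have E2 : rot j s = (x1 :: a ++ u :: b) ++ (y1 :: (x2 :: d) ++ w :: g ++ [:: y2]).
  by rewrite E /= -?catA /= -?catA /= -?catA.
have [l El] := rot_shift E2.
have {}E2 : rot l s = y1 :: (x2 :: d) ++ w :: g ++ y2 :: (x1 :: a) ++ u :: b.
  by rewrite El /= -?catA /= -?catA /= -?catA.
have cyw : c y1 = c w by rewrite cwx.
have [hm|[g0 b0]] := minor_A1 E2 y12 wu cyw; first exact: hm.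
rewrite a0 b0 d0 g0 /= in E.
have [uW cW WK mW] := rot_facts E.
constructor 4; exact: (K33_A4 uW cW (chord_adj x12) (chord_adj y12) (chord_adj uw)).
Qed.

(** A third chord sharing an end with e or f gives a minor at once; otherwise its ends are inside
    the two long arcs. The case of both ends in the second arc becomes the first one by starting the
    cycle at x2. *)
Lemma crossing_only e f : e \in Ch -> f \in Ch -> crossing e f ->
  has_minor \/ Ch = [set e; f].
Proof.
move=> ec fc [j [x1 [p [y1 [x2 [q [y2 [E eE fE cxy]]]]]]]].
have [/eqP|] := boolP (Ch == [set e; f]); first by right.
move=> ne; left; have /subsetPn[g gc] : ~~ (Ch \subset [set e; f]).
  by apply: contra ne => sub; rewrite eqEsubset sub subUset !sub1set ec.
rewrite !inE negb_or => /andP[ge gf].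
have [u [w [gE us' ws' cu cw]]] := chord_ends hs cK (c x1) gc.
have [cx2 cy2] : c x2 = ~~ c x1 /\ c y2 = ~~ c y1.
  by split; apply: chord_color; [rewrite -eE|rewrite -fE].
have inpq v : v \in g -> v \in s -> has_minor \/ (v \in p) || (v \in q).
  move=> vg; rewrite -(mem_rot j) E !(inE, mem_cat).
  have [ve|] := boolP (v \in e).
    by left; apply: (chords_share gc ec ge vg ve).
  rewrite eE !inE negb_or => /andP[/negbTE-> /negbTE->].
  have [vf|] := boolP (v \in f).
    by left; apply: (chords_share gc fc gf vg vf).
  rewrite fE !inE negb_or => /andP[/negbTE-> /negbTE->] /=.
  by rewrite orbF; right.
rewrite gE in inpq gc.
have [hm|ui] := inpq u (set21 _ _) us'; first exact: hm.
have [hm|wi] := inpq w (set22 _ _) ws'; first exact: hm.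
rewrite eE in ec; rewrite fE in fc.
have wu : [set w; u] \in Ch by rewrite setUC.
case/orP: ui => ui; case/orP: wi => wi.
- exact: third_chord_same E ec fc cxy gc ui wi.
- exact: third_chord_across E ec fc cxy gc ui wi.
- exact: third_chord_across E ec fc cxy wu wi ui.
have E1 : rot j s = (x1 :: p ++ [:: y1]) ++ (x2 :: q ++ [:: y2]) by rewrite E /= -catA.
have [k Ek] := rot_shift E1.
have {}Ek : rot k s = x2 :: q ++ y2 :: x1 :: p ++ [:: y1] by rewrite Ek /= -catA.
rewrite setUC in ec; rewrite setUC in fc.
by apply: (third_chord_same Ek ec fc _ gc ui wi); rewrite cx2 cy2 cxy.
Qed.

(** If all pairs of chords are parallel, K belongs to B_3, which here also covers cycles with at
    most one chord. Otherwise some pair yields a minor or crosses strongly, and in the latter case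
    there is no third chord. *)
Lemma hamilton_class : ~~ odd (size s) ->
  has_minor \/ [\/ in_B0 K, in_B1 K, in_B2 K | in_B3 K].
Proof.
move=> es; have cs : proper_coloring c (cycle_edges s).
  by move=> x y xy xyC; apply: cK => //; case: hs => _ _ _ /subsetP; apply.
pose A (ef : {set T} * {set T}) :=
  ef.1 \in Ch -> ef.2 \in Ch -> ef.1 != ef.2 -> parallel c s ef.1 ef.2.
pose B (ef : {set T} * {set T}) :=
  has_minor \/ [/\ ef.1 \in Ch, ef.2 \in Ch, ef.1 != ef.2 & crossing ef.1 ef.2].
have AB ef : A ef \/ (B ef \/ B (ef.2, ef.1)).
  case: ef => e f; rewrite /A /B /=.
  have [ec|_] := boolP (e \in Ch); last by left.
  have [fc|_] := boolP (f \in Ch); last by left.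
  have [_|ef] := eqVneq e f; first by left.
  have [hm|par|[cr|cr]] := chord_pair ec fc ef; [right|by left|right|right].
  - by left; left.
  - by left; right.
  - by right; right; split=> //; rewrite eq_sym.
case: (finite_dichotomy AB) => [all_par|[ef0 B0]].
  right; constructor 4; split; first by exists c.
  exists s, c; split=> // e f ec fc ef; exact: (all_par (e, f)).
have [ef [hm|[ec fc ne cr]]] : exists ef, B ef.
  by case: B0 => H; [exists ef0|exists (ef0.2, ef0.1)].
- by left.
have [hm|chE] := crossing_only ec fc cr; [by left|right].
constructor 3; exists s, c, ef.1, ef.2; split=> //.
case: cr => j [x1 [p [y1 [x2 [q [y2 [E eE fE cxy]]]]]]].
exists x1, x2, y1, y2; split=> //.
- rewrite eE in ec; rewrite fE in fc.
  by rewrite (chord_color ec) (chord_color fc) cxy; split=> //; case: (c y1).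
- exists j; left; rewrite E /= eqxx.
  apply: subseq_skip; rewrite /= eqxx; apply: subseq_skip; exact: sub0seq.
rewrite subUset !sub1set -(cycle_edges_rot j) E cycle_edges_path; apply/andP; split.
  apply/path_edgesP; exists (x1 :: p ++ y1 :: x2 :: q), y2, x1, [::].
  split; last by rewrite setUC.
  by rewrite !rcons_cat /= !rcons_cat /= -?catA.
apply/path_edgesP; exists (x1 :: p), y1, x2, (rcons (q ++ [:: y2]) x1).
by split; [rewrite rcons_cat|rewrite setUC].
Qed.

End Chords.

Lemma elementary_class (T : finType) (G K : graph T) (c : T -> bool) :
  matchable G -> proper_coloring c (eset G) -> elementary_component K G ->
  has_minor K \/ (is_K2 K \/ [\/ in_B0 K, in_B1 K, in_B2 K | in_B3 K]).
Proof.
move=> /matchableP[M MG] cG KG; have cK := bipartite_elementary cG KG.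
have mK : matchable K by apply/matchableP; exists (M :&: eset K); apply: pm_component KG MG.
have K0 : vset K != set0.
  by case: KG => x xG ->; apply/set0Pn; exists x; apply: component_vset.
have [A1K|[s [us s1 sK cy [N NK cl]] span]] :=
    hamilton_or_A1 cK (component_exit KG) (component_allowed KG) mK K0.
  by left; constructor 1.
have VE : [set:: s] = vset K.
  by apply/setP => x; rewrite inE; apply/idP/idP => [/sK|/span].
(* A spanning cycle on two vertices is the degenerate one, and K is K_2; from three vertices on it
   is a genuine Hamilton cycle. *)
case: s => [|x [|y [|z s]]] // in us s1 sK cy cl span VE *.
  right; left; exists x, y; split.
  - by move: us; rewrite /= inE andbT.
  - by rewrite -VE; apply/setP => v; rewrite !inE.
  - have xy : adj K x y by move: cy => /= /andP[].
    apply/setP => e; rewrite inE; apply/idP/eqP => [eK|-> //].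
    have [a [b [ab E aK bK]]] := edgeP eK.
    move: (span _ aK) (span _ bK) ab; rewrite E !inE.
    by case/orP=> /eqP-> /orP[] /eqP->; rewrite ?eqxx // setUC.
set t := [:: x, y, z & s] in us s1 sK cy cl span VE *.
have hs : hamilton_cycle K t by split; rewrite // cycle_edges_adj.
suff et : ~~ odd (size t) by case: (hamilton_class cK hs et) => H; [left|right; right].
have : path (adj K) x (rcons [:: y, z & s] x) by [].
by move/(odd_arc cK); rewrite eqxx /= => ->.
Qed.

Theorem minor_free_classes (T : finType) (G : graph T) : matchable G -> bipartite G ->
  [/\ ~ conformal_minor A1 G, ~ conformal_minor A2 G,
      ~ conformal_minor A3 G & ~ conformal_minor A4 G] ->
  forall K : graph T, elementary_component K G ->
    is_K2 K \/ [\/ in_B0 K, in_B1 K, in_B2 K | in_B3 K].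
Proof.
move=> mG [c cG] [n1 n2 n3 n4] K KG.
case: (elementary_class mG cG KG) => // -[] H.
- by case: n1; exact: (component_minor KG mG H).
- by case: n2; exact: (component_minor KG mG H).
- by case: n3; exact: (component_minor KG mG H).
- by case: n4; exact: (component_minor KG mG H).
Qed.

Theorem corollary3p2 (T : finType) (G : graph T)
    (G_matchable : matchable G) (G_bipartite : bipartite G) :
  [<-> strongly_uniform G;
       [/\ ~ conformal_minor A1 G, ~ conformal_minor A2 G,
           ~ conformal_minor A3 G & ~ conformal_minor A4 G];
       forall K : graph T, elementary_component K G ->
         is_K2 K \/ [\/ in_B0 K, in_B1 K, in_B2 K | in_B3 K] ].
Proof.
tfae.
- exact: strongly_uniform_minors.
- exact: minor_free_classes G_matchable G_bipartite.
- exact: classes_strongly_uniform G_bipartite.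
Qed.
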